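(* Let $m,p\in\mathbb N$, $\beta_0\in(-1,0]$ and $\beta=\beta_0+p$. The reproducing kernel of the Hilbert space $H^2_{m,\beta}(\mathbb D)$ is given by $\mathbb H_{m,\beta}(z,w)=\mathcal H_{m,\beta}(z\overline w)$ ($z,w\in\mathbb D^*$), where, for $0<|\xi|<1$, $$\mathcal H_{m,\beta}(\xi)=\lim_{\alpha\to-1}\mathcal K_{\alpha,\beta}^{m,1}(\xi)=\frac{1-\xi^m}{1-\xi}+\frac{\xi^m}{(m!)^2}\ {}_3F_2\left(\left.\begin{array}{c}1,1,1\\ m+1,m+1\end{array}\right|\xi\right)+C_{m,\beta}(\xi)$$ with $$C_{m,\beta}(\xi)=\sum_{k=0}^{p-m-1}\left(\frac{k!}{(m+k)!}\right)^2\frac{1}{\xi^{k+1}}\ \text{ if } p>m,\qquad C_{m,\beta}(\xi)=0\ \text{ if } p\le m.$$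
   Context: $\mathbb N=\{0,1,2,\dots\}$, $\mathbb D$ is the unit disk, $\mathbb D^*=\mathbb D\setminus\{0\}$. Here $\beta=\beta_0+p$ with $\beta_0\in(-1,0]$, $p\in\mathbb N$. The modified Hardy space $H^2_\beta(\mathbb D)$ is the set of holomorphic functions $f$ on $\mathbb D^*$ such that $0$ is a removable singularity of $f$ (put $\eta(f)=0$) or a pole of order $\eta(f)\le p$, and $\|f\|_{H^2_\beta}^2:=\sup_{0<r<1}\frac{r^{2\eta(f)}}{2\pi}\int_0^{2\pi}|f(re^{i\theta})|^2d\theta<\infty$. Each such $f$ has a radial extension $f^*(e^{i\theta})=\lim_{r\to1^-}f(re^{i\theta})$ for a.e. $\theta$, and the norm comes from the inner product $\langle f,g\rangle_{H^2_\beta}=\frac1{2\pi}\int_0^{2\pi}f^*(e^{i\theta})\overline{g^*(e^{i\theta})}\,d\theta$. The modified Hardy-Dirichlet space $H^2_{m,\beta}(\mathbb D)$ is the set of holomorphic functions $f$ on $\mathbb D^*$ with $f^{(m)}\in H^2_\beta(\mathbb D)$. Each such $f$ has a Laurent expansion $f(z)=\sum_{n\ge\min(0,m-p)}a_nz^n$; write $f=f_1+f_2$ with $f_1(z)=\sum_{n=0}^{m-1}a_nz^n$, $f_2=f-f_1$. The inner product is $\langle f,g\rangle_{H^2_{m,\beta}}=\langle f_1,g_1\rangle_{H^2_\beta}+\langle f_2^{(m)},g_2^{(m)}\rangle_{H^2_\beta}$. For $\alpha>-1$ and $0<|\xi|<1$, $$\mathcal K_{\alpha,\beta}^{m,1}(\xi)=\sum_{n=0}^{m-1}\frac{(\alpha+\beta+2)_n}{(\beta+1)_n}\xi^n+\frac{\xi^m}{(m!)^2}\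 {}_4F_3\left(\left.\begin{array}{c}1,1,1,\alpha+\beta+2\\ m+1,m+1,\beta+1\end{array}\right|\xi\right)+A_{\alpha,\beta}^{m,1}(\xi),$$ where $A_{\alpha,\beta}^{m,1}(\xi)=0$ if $p\le m$ and $A_{\alpha,\beta}^{m,1}(\xi)=\sum_{k=0}^{p-m-1}\frac{\Gamma(\alpha+\beta+1-m-k)}{\Gamma(\beta-m-k)}\frac{\Gamma(\beta+1)}{\Gamma(\alpha+\beta+2)}\left(\frac{k!}{(m+k)!}\right)^2\frac1{\xi^{k+1}}$ if $p>m$. $(a)_n=a(a+1)\cdots(a+n-1)$ is the Pochhammer symbol, and ${}_kF_j\left(\left.\begin{array}{c}a_1,\dots,a_k\\ b_1,\dots,b_j\end{array}\right|\xi\right)=\sum_{n=0}^{\infty}\frac{(a_1)_n\cdots(a_k)_n}{(b_1)_n\cdots(b_j)_n}\frac{\xi^n}{n!}$. *)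

(* Defs.v *)
(* MathComp-Analysis; the complex numbers are R[i] over an arbitrary R : realType. *)
From HB Require Import structures.
From mathcomp Require Import all_boot all_order all_algebra.
From mathcomp Require Import complex.
From mathcomp Require Import all_classical all_reals all_analysis.
Set Implicit Arguments.
Unset Strict Implicit.
Unset Printing Implicit Defensive.
Import Order.TTheory GRing.Theory Num.Theory numFieldNormedType.Exports.
Local Open Scope classical_set_scope.
Local Open Scope complex_scope.
Local Open Scope ring_scope.

(* R[i] receives its norm topology only as the regular module R[i]^o over
   itself; `derivable` and `derive1n` on it are then complex differentiation. *)
Notation cplx R := (R[i]^o)%type.

Section Defs.
Variable R : realType.
Local Notation C := (cplx R).
Local Notation mu := (@lebesgue_measure R).

Definition unit_disk : set C := [set z | `|z| < 1].
Definition punctured_disk : set C := [set z | 0 < `|z| < 1].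

(* Functions on the punctured disk are represented by total functions; no
   definition below looks at their values outside of it. *)
Definition holomorphic_on (U : set C) (f : C -> C) : Prop :=
  forall z, U z -> derivable f z 1.

Definition removable_at0 (f : C -> C) : Prop :=
  exists2 g : C -> C, holomorphic_on unit_disk g
    & forall z, punctured_disk z -> f z = g z.

Definition pole_at0 (k : nat) (f : C -> C) : Prop :=
  exists2 g : C -> C, holomorphic_on unit_disk g /\ g 0 != 0
    & forall z, punctured_disk z -> f z = g z / z ^+ k.

Definition sing_order (f : C -> C) (k : nat) : Prop :=
  if k is 0%N then removable_at0 f else pole_at0 k f.

(* eta(f); the order is unique when it exists. *)
Definition eta (f : C -> C) : nat := xget 0%N [set k | sing_order f k].

Definition polar (r t : R) : C := (r * cos t) +i* (r * sin t).

Definition hardy_sqnorm (f : C -> C) : \bar R :=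
  ereal_sup [set ((r ^+ (2 * eta f) / (2 * pi))%:E *
      \int[mu]_(t in `[0%R, (2 * pi)%R]) ((complex.Re `|f (polar r t)|) ^+ 2)%:E)%E
    | r in `]0, 1[].

(* H^2_beta for beta = beta0 + p with beta0 in ]-1, 0]; beta enters the
   definition only through p. *)
Definition hardy (p : nat) : set (C -> C) := [set f |
  [/\ holomorphic_on punctured_disk f,
      exists2 k, (k <= p)%N & sing_order f k
    & (hardy_sqnorm f < +oo)%E]].

Definition radial_lim (f : C -> C) (t : R) : C :=
  lim (f (polar r t) @[r --> (1 : R)^'-]).

Definition cintegral (D : set R) (F : R -> C) : C :=
  (\int[mu]_(t in D) complex.Re (F t)) +i* (\int[mu]_(t in D) complex.Im (F t)).

Definition hardy_inner (f g : C -> C) : C :=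
  ((2 * pi)^-1)%:C *
  cintegral `[0, 2 * pi] (fun t => radial_lim f t * conjc (radial_lim g t)).

Definition hardy_dirichlet (m p : nat) : set (C -> C) := [set f |
  holomorphic_on punctured_disk f /\ hardy p (derive1n m f)].

Definition laurent_expansion (N : nat) (f : C -> C) (a : int -> C) : Prop :=
  (forall n : int, n < - N%:Z -> a n = 0) /\
  (forall z, punctured_disk z ->
     series (fun k : nat => a (k%:Z - N%:Z) * z ^ (k%:Z - N%:Z)) @ \oo --> f z).

(* The coefficients of the expansion starting at min(0, m - p) = -(p - m)%N. *)
Definition laurent_coef (m p : nat) (f : C -> C) : int -> C :=
  xget (fun=> 0) [set a | laurent_expansion (p - m) f a].

(* f_1; the second component f_2 is f - f_1. *)
Definition low_part (m p : nat) (f : C -> C) : C -> C :=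
  fun z => \sum_(n < m) laurent_coef m p f n%:Z * z ^+ n.

Definition hardy_dirichlet_inner (m p : nat) (f g : C -> C) : C :=
  hardy_inner (low_part m p f) (low_part m p g) +
  hardy_inner (derive1n m (fun z : C => f z - low_part m p f z))
              (derive1n m (fun z : C => g z - low_part m p g z)).

Definition reproducing_kernel (E : set C) (H : set (C -> C))
    (inner : (C -> C) -> (C -> C) -> C) (K : C -> C -> C) : Prop :=
  (forall w, E w -> H (fun z => K z w)) /\
  (forall f w, H f -> E w -> f w = inner f (fun z => K z w)).

(* Euler's integral; every argument it receives below is positive. *)
Definition Gamma (x : R) : R :=
  \int[mu]_(t in `]0, +oo[) (t `^ (x - 1) * expR (- t)).

Definition pochhammer (a : R) (n : nat) : R := \prod_(i < n) (a + i%:R).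

Definition hypergeometric (a b : seq R) (xi : C) : C :=
  lim (series (fun n : nat =>
    ((\prod_(x <- a) pochhammer x n) / (\prod_(x <- b) pochhammer x n))%:C *
    (xi ^+ n / n`!%:R) : C) @ \oo).

(* The truncated p - m makes the sum empty when p <= m. *)
Definition kernelA (alpha beta : R) (m p : nat) (xi : C) : C :=
  \sum_(k < p - m)
    (Gamma (alpha + beta + 1 - m%:R - k%:R) / Gamma (beta - m%:R - k%:R) *
     (Gamma (beta + 1) / Gamma (alpha + beta + 2)) *
     (k`!%:R / (m + k)`!%:R) ^+ 2)%:C * (xi ^+ k.+1)^-1.

Definition kernelK (alpha beta : R) (m p : nat) (xi : C) : C :=
  \sum_(n < m) (pochhammer (alpha + beta + 2) n / pochhammer (beta + 1) n)%:C * xi ^+ n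
  + xi ^+ m / m`!%:R ^+ 2 *
    hypergeometric [:: 1; 1; 1; alpha + beta + 2] [:: m.+1%:R; m.+1%:R; beta + 1] xi
  + kernelA alpha beta m p xi.

Definition kernelC (m p : nat) (xi : C) : C :=
  \sum_(k < p - m) ((k`!%:R / (m + k)`!%:R) ^+ 2)%:C * (xi ^+ k.+1)^-1.

Definition kernelH (m p : nat) (xi : C) : C :=
  (1 - xi ^+ m) / (1 - xi)
  + xi ^+ m / m`!%:R ^+ 2 *
    hypergeometric [:: 1; 1; 1] [:: m.+1%:R; m.+1%:R] xi
  + kernelC m p xi.

End Defs.

Arguments unit_disk {R}.
Arguments punctured_disk {R}.

(* Main.v *)
Require Import Defs.
From HB Require Import structures.
From mathcomp Require Import all_boot all_order all_algebra.
From mathcomp Require Import complex.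
From mathcomp Require Import all_classical all_reals all_analysis.
From mathcomp Require Import measurable_realfun.
From mathcomp Require Import zify ring lra.
Set Implicit Arguments.
Unset Strict Implicit.
Unset Printing Implicit Defensive.
Import Order.TTheory GRing.Theory Num.Theory numFieldNormedType.Exports.
Import Normc.
Local Open Scope classical_set_scope.
Local Open Scope complex_scope.
Local Open Scope ring_scope.

(** The theorem has three parts: a limit formula for the kernel, its reproducing
property, and its uniqueness.

The reproducing property is a computation with coefficients. A holomorphic
function on the punctured disk is the sum of its Laurent series ([laurent_series]),
which is proved here from Goursat's lemma ([goursat]). In terms of the
coefficients [a n] of [f], the first term of the inner product of the
Hardy-Dirichlet space pairs the [a n] with [0 <= n < m], and the second one pairs
the other [a n], each multiplied by the factor [ffall m n] by which the derivative
of order [m] multiplies [z ^ n]. The kernel is the Laurent series whose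
coefficients are [conj w ^ n], divided by the squares of these factors
([kernelH_pser], [ffall_sq_kcoef]); its inner product with [f] is therefore the
Laurent series of [f] at [w] ([kernel_reproduces]). Two details need care: that
the derivative of the kernel has a pole of order exactly [p] when [p > m], for
the norm of the Hardy space depends on that order ([hardy_pser]), and that the
splitting of [f] commutes with the derivative of order [m] ([laurent_high_derive]).

What turns this computation into a proof is that the inner product of the Hardy
space, an integral of radial limits, is the pairing of the coefficients
([boundary_pairing], [hardy_inner_pser]). The coefficients of the second function
are summable, as they are for the kernel, so that its series converges up to the circle. The coefficients
of the first function are square summable by Bessel's inequality on the circles
inside the disk ([hardy_laurent]). That its radial limits exist almost everywhere
([radial_cvg_ae]) is Fatou's theorem: Poisson's formula bounds the values on a
radius by the Hardy-Littlewood maximal function ([poisson_maximal]), the maximal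
inequality shows that the tails of the power series are uniformly small on radii
outside a set of small measure ([weak_type]), and the partial sums have radial
limits everywhere. Fatou's lemma then carries the mean bounds for the tails to the
boundary.

For the limit formula every term of [kernelK] tends to the corresponding term of
[kernelH], the ratios of Pochhammer symbols and of values of the Gamma function
tending to [1] ([cvg_pochhammer_ratio], [cvg_Gamma]); the hypergeometric series
converges by a uniform geometric bound ([cvg_hypergeometricK]).

Uniqueness is the usual argument: the inner product is hermitian, so the value at
[z] of one kernel function taken at [w] is the conjugate of the value at [w] of
the other kernel function taken at [z]. *)

(** * The modulus of a complex number, and limits of complex functions *)

Section Modulus.
Variable R : realType.
Local Notation C := (cplx R).
Local Notation Re := (@complex.Re R).
Local Notation Im := (@complex.Im R).
Implicit Types (z w : C) (r : R).

Lemma normrcE z : `|z| = (normc z)%:C :> C.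
Proof. by case: z. Qed.

Lemma normc_0 : normc (0 : C) = 0.
Proof. exact: normc0. Qed.

Lemma normc_1 : normc (1 : C) = 1.
Proof. exact: normc1. Qed.

Lemma normc_M z w : normc (z * w) = normc z * normc w.
Proof. exact: normcM. Qed.

Lemma normc_V z : normc (z^-1) = (normc z)^-1.
Proof. exact: normcV. Qed.

Lemma normc_N z : normc (- z) = normc z.
Proof. exact: normcN. Qed.

Lemma normc_D z w : normc (z + w) <= normc z + normc w.
Proof. exact: le_normcD. Qed.

Lemma normc_ge0 z : 0 <= normc z.
Proof. by rewrite -ler0c -normrcE normr_ge0. Qed.

Lemma normc_eq0 z : (normc z == 0) = (z == 0).
Proof.
apply/eqP/eqP => [/eq0_normc //|->]; exact: normc0.
Qed.

Lemma normc_gt0 z : (0 < normc z) = (z != 0).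
Proof. by rewrite lt0r normc_ge0 normc_eq0 andbT. Qed.

Lemma normcBC z w : normc (z - w) = normc (w - z).
Proof. by rewrite -normcN opprB. Qed.

Lemma normcX z n : normc (z ^+ n) = normc z ^+ n.
Proof.
by elim: n => [|n IH]; rewrite ?expr0 ?normc1// !exprS normcM IH.
Qed.

Lemma normc_real r : normc (r%:C) = `|r|.
Proof. by rewrite /= expr0n/= addr0 sqrtr_sqr. Qed.

Lemma normc_conj z : normc (conjc z) = normc z.
Proof. by case: z => a b /=; rewrite sqrrN. Qed.

Lemma normc_nat n : normc (n%:R : C) = n%:R.
Proof.
by rewrite -(rmorph_nat (real_complex R)) normc_real ger0_norm.
Qed.

Lemma normc_sqrE z : normc z ^+ 2 = Re z ^+ 2 + Im z ^+ 2.
Proof. by case: z => a b /=; rewrite sqr_sqrtr// addr_ge0// sqr_ge0. Qed.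

Lemma mul_conjc z : z * conjc z = (normc z ^+ 2)%:C.
Proof.
rewrite normc_sqrE; case: z => a b; apply/eqP; rewrite eq_complex /=.
apply/andP; split; apply/eqP; ring.
Qed.

Lemma Re_le_normc z : `|Re z| <= normc z.
Proof. by rewrite -lecR -normrcE normc_ge_Re. Qed.

Lemma Im_le_normc z : `|Im z| <= normc z.
Proof.
rewrite -sqrtr_sqr; case: z => a b /=; apply: ler_wsqrtr.
by rewrite lerDr sqr_ge0.
Qed.

Lemma normc_le_ReIm z : normc z <= `|Re z| + `|Im z|.
Proof.
rewrite -(@ler_pXn2r _ 2) ?nnegrE ?normc_ge0 ?addr_ge0 ?normr_ge0//.
rewrite normc_sqrE sqrrD -!(@real_normK _ (_ z)) ?num_real//.
by rewrite lerD2r lerDl mulrn_wge0// mulr_ge0.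
Qed.

Lemma ltc0r z : (0 < `|z| < 1) = (0 < normc z < 1).
Proof. by rewrite normrcE !ltcR. Qed.

Lemma ltc1 z : (`|z| < 1) = (normc z < 1).
Proof. by rewrite normrcE ltcR. Qed.

(** The topology of the complex plane is defined by balls whose radii are
complex numbers; this restates convergence with real moduli. *)
Lemma cvgC_norm {T : Type} {F : set_system T} {FF : Filter F} (f : T -> C) (l : C) :
  f @ F --> l <-> (fun t => normc (l - f t)) @ F --> (0 : R).
Proof.
split.
- move=> /cvgrPdist_lt H; apply/cvgrPdist_lt => e e0.
  have e0c : 0 < e%:C :> C by rewrite ltcR.
  apply: filterS (H _ e0c) => t; rewrite normrcE ltcR sub0r normrN.
  by rewrite ger0_norm// normc_ge0.
- move=> /cvgrPdist_lt H; apply/cvgrPdist_lt => e.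
  rewrite ltcE => /andP[/eqP ie re].
  have ee : e = (Re e)%:C by case: e ie re => a b /= ->.
  rewrite ee.
  apply: filterS (H _ re) => t.
  by rewrite sub0r normrN ger0_norm ?normc_ge0// normrcE ltcR.
Qed.

Lemma cvgC_normP {T : Type} {F : set_system T} {FF : Filter F} (f : T -> C) (l : C) :
  f @ F --> l <-> forall e : R, 0 < e -> \forall t \near F, normc (l - f t) < e.
Proof.
rewrite cvgC_norm; split.
- move=> /cvgrPdist_lt H e e0.
  apply: filterS (H _ e0) => t.
  by rewrite sub0r normrN ger0_norm ?normc_ge0.
- move=> H; apply/cvgrPdist_lt => e e0; apply: filterS (H _ e0) => t.
  by rewrite sub0r normrN ger0_norm ?normc_ge0.
Qed.

Lemma cvgC_ReIm {T : Type} {F : set_system T} {FF : Filter F} (f : T -> C) (l : C) :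
  f @ F --> l <-> ((Re \o f) @ F --> Re l /\ (Im \o f) @ F --> Im l).
Proof.
have ReB (z w : C) : Re (z - w) = Re z - Re w by case: z; case: w.
have ImB (z w : C) : Im (z - w) = Im z - Im w by case: z; case: w.
split.
- move=> /cvgC_normP H; split; apply/cvgrPdist_lt => e e0;
  apply: filterS (H _ e0) => t /=; apply: le_lt_trans.
  + by rewrite -ReB Re_le_normc.
  + by rewrite -ImB Im_le_normc.
- move=> [/cvgrPdist_lt H1 /cvgrPdist_lt H2]; apply/cvgC_normP => e e0.
  have e20 : 0 < e / 2 by rewrite divr_gt0.
  apply: filterS2 (H1 _ e20) (H2 _ e20) => t /= h1 h2.
  rewrite (le_lt_trans (normc_le_ReIm _))// ReB ImB.
  by rewrite [ltRHS]splitr ltrD.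
Qed.

Lemma cvgC_real {T : Type} {F : set_system T} {FF : Filter F} (f : T -> R) (l : R) :
  f @ F --> l -> (fun t => (f t)%:C : C) @ F --> (l%:C : C).
Proof.
by move=> fl; apply/cvgC_ReIm; split => //=; exact: cvg_cst.
Qed.

Lemma cvgC_conj {T : Type} {F : set_system T} {FF : Filter F} (f : T -> C) (l : C) :
  f @ F --> l -> (fun t => conjc (f t) : C) @ F --> (conjc l : C).
Proof.
move=> /cvgC_norm H; apply/cvgC_norm.
by under eq_cvg do rewrite -rmorphB/= normc_conj.
Qed.

Lemma cvg_normc {T : Type} {F : set_system T} {FF : Filter F} (f : T -> C) (l : C) :
  f @ F --> l -> (fun t => normc (f t)) @ F --> normc l.
Proof.
move=> /cvgC_normP H; apply/cvgrPdist_lt => e e0.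
apply: filterS (H _ e0) => t; apply: le_lt_trans.
have tri (z w : C) : normc z - normc w <= normc (z - w).
  by rewrite lerBlDr -{1}(subrK w z) le_normcD.
rewrite ler_norml tri andbT lerNl opprB normcBC; exact: tri.
Qed.

Section CvgArith.
Context {T : Type} {F : set_system T} {FF : Filter F}.
Implicit Types (f g : T -> C) (a b : C).

Lemma cvgCD f g a b : f @ F --> a -> g @ F --> b ->
  (fun t => f t + g t) @ F --> a + b.
Proof. exact: cvgD. Qed.

Lemma cvgCN f a : f @ F --> a -> (fun t => - f t) @ F --> - a.
Proof. exact: cvgN. Qed.

Lemma cvgCB f g a b : f @ F --> a -> g @ F --> b ->
  (fun t => f t - g t) @ F --> a - b.
Proof. exact: cvgB. Qed.

Lemma cvgCM f g a b : f @ F --> a -> g @ F --> b ->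
  (fun t => f t * g t) @ F --> a * b.
Proof. exact: cvgM. Qed.

Lemma cvgCV f a : a != 0 -> f @ F --> a -> (fun t => (f t)^-1) @ F --> a^-1.
Proof. move=> a0; exact: cvgV. Qed.

Lemma cvgCX f a n : f @ F --> a -> (fun t => f t ^+ n) @ F --> a ^+ n.
Proof.
move=> fa; elim: n => [|n IH].
  by under eq_fun do rewrite expr0; rewrite expr0; exact: cvg_cst.
by under eq_fun do rewrite exprS; rewrite exprS; exact: cvgCM.
Qed.

Lemma cvgC_cst a : (fun _ : T => a) @ F --> a.
Proof. exact: cvg_cst. Qed.

Lemma cvgC_sum (I : Type) (s : seq I) (f : I -> T -> C) (a : I -> C) :
  (forall i, f i @ F --> a i) ->
  (fun t => \sum_(i <- s) f i t) @ F --> \sum_(i <- s) a i.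
Proof.
move=> fa; elim: s => [|i s IH].
  have -> : (fun t => \sum_(i <- [::]) f i t) = (fun=> 0).
    by apply/funext => t; rewrite big_nil.
  rewrite big_nil; exact: cvgC_cst.
have -> : (fun t => \sum_(j <- i :: s) f j t) =
          (fun t => f i t + \sum_(j <- s) f j t).
  by apply/funext => t; rewrite big_cons.
rewrite big_cons; exact: (cvgCD (fa i) IH).
Qed.

End CvgArith.

#[global] Instance nbhsC_pfilter z : ProperFilter (nbhs z).
Proof. exact: nbhs_pfilter. Qed.

#[global] Instance nbhsC_filter z : Filter (nbhs z).
Proof. exact: nbhs_filter. Qed.

Lemma cvgC_id z : (fun y : C => y) @ z --> z.
Proof. exact: cvg_id. Qed.

Lemma cvgR_id r : (fun y : R => y) @ r --> r.
Proof. exact: cvg_id. Qed.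

Lemma cvgR_subC r : (fun s : R => (s - r)%:C : C) @ r --> (0 : C).
Proof.
have -> : (0:C) = (r - r)%:C by rewrite subrr.
by apply: cvgC_real; apply: cvgB; [exact: cvg_id|exact: cvg_cst].
Qed.

Lemma cvgC_sub z : (fun y : C => y - z) @ z --> (0 : C).
Proof.
have -> : (0:C) = z - z by rewrite subrr.
exact: (cvgCB (cvgC_id (z:=z)) (cvgC_cst (a:=z))).
Qed.

Lemma nearC_ball z r : 0 < r -> \forall y \near z, normc (y - z) < r.
Proof.
move=> r0; have := (cvgC_normP (FF := nbhsC_filter z) _ _).1 (cvgC_id (z:=z)) _ r0.
by apply: (@filterS _ _ (nbhsC_filter z)) => y; rewrite normcBC.
Qed.

Lemma nearCP z (P : C -> Prop) :
  (\forall y \near z, P y) <->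
  exists2 r : R, 0 < r & forall y : C, normc (y - z) < r -> P y.
Proof.
split=> [|[r r0 H]]; last first.
  near=> y; apply: H; near: y; exact: nearC_ball.
move=> [e /= e0 He].
move: e0; rewrite ltcE => /andP[/eqP ie re].
have ee : e = (Re e)%:C by move: ie re; case: (e) => a b /= ->.
exists (Re e) => // y yz; apply: He.
by rewrite /= distrC normrcE ee ltcR.
Unshelve. all: by end_near. Qed.

Lemma nearC_neq z w : z != w -> \forall y \near z, y != w.
Proof.
move=> zw; apply/nearCP; exists (normc (z - w)); first by rewrite normc_gt0 subr_eq0.
by move=> y; apply: contraPneq => ->; rewrite normcBC ltxx.
Qed.

End Modulus.
Arguments cvgC_cst {R} {T F FF} a.
Arguments cvgC_id {R} z.
Arguments cvgC_sub {R} z.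
Arguments cvgR_subC {R} r.
Arguments cvgR_id {R} r.

#[global] Arguments normc : simpl never.
#[global] Arguments polar : simpl never.

(** * Integrals of complex functions over real sets *)

Section ComplexIntegral.
Variable R : realType.
Local Notation C := (cplx R).
Local Notation Re := (@complex.Re R).
Local Notation Im := (@complex.Im R).
Local Notation mu := (@lebesgue_measure R).
Implicit Types (z w : C) (r : R) (D : set (measurableTypeR R)) (F G : R -> C).

Lemma cReD z w : Re (z + w) = Re z + Re w. Proof. by case: z; case: w. Qed.
Lemma cImD z w : Im (z + w) = Im z + Im w. Proof. by case: z; case: w. Qed.
Lemma cReN z : Re (- z) = - Re z. Proof. by case: z. Qed.
Lemma cImN z : Im (- z) = - Im z. Proof. by case: z. Qed.
Lemma cReM z w : Re (z * w) = Re z * Re w - Im z * Im w.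
Proof. by case: z; case: w. Qed.
Lemma cImM z w : Im (z * w) = Re z * Im w + Im z * Re w.
Proof. by case: z; case: w. Qed.
Lemma complex_eq z w : Re z = Re w -> Im z = Im w -> z = w.
Proof. by case: z => a b; case: w => c d /= -> ->. Qed.

Definition cintegrable D F :=
  mu.-integrable D (EFin \o (Re \o F)) /\ mu.-integrable D (EFin \o (Im \o F)).

Lemma RintegrableZl D k (f : R -> R) : measurable (D : set (measurableTypeR R)) ->
  mu.-integrable D (EFin \o f) -> mu.-integrable D (EFin \o (fun x => k * f x)).
Proof.
move=> mD intf; have := integrableZl mD k intf.
by congr (mu.-integrable D _); apply/funext => t /=; rewrite EFinM.
Qed.

Lemma cintegrableD D F G : measurable (D : set (measurableTypeR R)) -> cintegrable D F -> cintegrable D G ->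
  cintegrable D (fun t => F t + G t).
Proof.
move=> mD [F1 F2] [G1 G2]; split.
- have -> : EFin \o (Re \o (fun t => F t + G t)) =
     ((EFin \o (Re \o F)) \+ (EFin \o (Re \o G)))%E.
    by apply/funext => t /=; rewrite cReD.
  exact: integrableD.
- have -> : EFin \o (Im \o (fun t => F t + G t)) =
     ((EFin \o (Im \o F)) \+ (EFin \o (Im \o G)))%E.
    by apply/funext => t /=; rewrite cImD.
  exact: integrableD.
Qed.

Lemma cintegrableZ D c F : measurable (D : set (measurableTypeR R)) -> cintegrable D F ->
  cintegrable D (fun t => c * F t).
Proof.
move=> mD [F1 F2]; split.
- have -> : EFin \o (Re \o (fun t => c * F t)) =
     ((fun t => (Re c)%:E * (EFin \o (Re \o F)) t) \-
      (fun t => (Im c)%:E * (EFin \o (Im \o F)) t))%E.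
    by apply/funext => t /=; rewrite cReM.
  by apply: integrableB => //; exact: integrableZl.
- have -> : EFin \o (Im \o (fun t => c * F t)) =
     ((fun t => (Re c)%:E * (EFin \o (Im \o F)) t) \+
      (fun t => (Im c)%:E * (EFin \o (Re \o F)) t))%E.
    by apply/funext => t /=; rewrite cImM.
  by apply: integrableD => //; exact: integrableZl.
Qed.

Lemma cintegrable0 D : measurable (D : set (measurableTypeR R)) -> cintegrable D (fun=> 0).
Proof.
by move=> mD; split; exact: integrable0.
Qed.

Lemma cintegrable_sum D (I : Type) (s : seq I) (F : I -> R -> C) :
  measurable (D : set (measurableTypeR R)) -> (forall i, cintegrable D (F i)) ->
  cintegrable D (fun t => \sum_(i <- s) F i t).
Proof.
move=> mD iF; elim: s => [|i s IH].
  under eq_fun do rewrite big_nil; exact: cintegrable0.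
by under eq_fun do rewrite big_cons; exact: cintegrableD.
Qed.

Lemma cintegralD D F G : measurable (D : set (measurableTypeR R)) -> cintegrable D F -> cintegrable D G ->
  cintegral D (fun t => F t + G t) = cintegral D F + cintegral D G.
Proof.
move=> mD [F1 F2] [G1 G2]; apply: complex_eq; rewrite ?cReD ?cImD/=.
- by under eq_Rintegral do rewrite cReD; rewrite RintegralD.
- by under eq_Rintegral do rewrite cImD; rewrite RintegralD.
Qed.

Lemma cintegralZ D c F : measurable (D : set (measurableTypeR R)) -> cintegrable D F ->
  cintegral D (fun t => c * F t) = c * cintegral D F.
Proof.
move=> mD [F1 F2]; apply: complex_eq; rewrite ?cReM ?cImM/=.
- under eq_Rintegral do rewrite cReM.
  rewrite RintegralB ?RintegralZl//.
      + exact: (RintegrableZl (Re c) mD F1).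
  + exact: (RintegrableZl (Im c) mD F2).
- under eq_Rintegral do rewrite cImM.
  rewrite RintegralD ?RintegralZl//.
  + exact: (RintegrableZl (Re c) mD F2).
  + exact: (RintegrableZl (Im c) mD F1).
Qed.

Lemma cintegralB D F G : measurable (D : set (measurableTypeR R)) -> cintegrable D F -> cintegrable D G ->
  cintegral D (fun t => F t - G t) = cintegral D F - cintegral D G.
Proof.
move=> mD iF iG.
under [X in cintegral _ X]eq_fun do rewrite -mulN1r.
rewrite cintegralD ?cintegralZ ?mulN1r//; exact: cintegrableZ.
Qed.

Lemma cintegral_sum D (I : Type) (s : seq I) (F : I -> R -> C) :
  measurable (D : set (measurableTypeR R)) -> (forall i, cintegrable D (F i)) ->
  cintegral D (fun t => \sum_(i <- s) F i t) = \sum_(i <- s) cintegral D (F i).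
Proof.
move=> mD iF; elim: s => [|i s IH].
  under [X in cintegral _ X]eq_fun do rewrite big_nil.
  rewrite big_nil; apply: complex_eq => /=; by rewrite /Rintegral integral0.
under [X in cintegral _ X]eq_fun do rewrite big_cons.
by rewrite big_cons cintegralD ?IH//; exact: cintegrable_sum.
Qed.

Lemma eq_cintegral D F G : (forall t, D t -> F t = G t) ->
  cintegral D F = cintegral D G.
Proof.
move=> FG; apply: complex_eq => /=; apply: eq_Rintegral => t /set_mem /FG ->//.
Qed.

(** The constant [2] comes from bounding the real and imaginary parts separately. *)
Lemma normc_cintegral_le D F (g : R -> R) : measurable (D : set (measurableTypeR R)) -> cintegrable D F ->
  mu.-integrable D (EFin \o g) -> (forall t, D t -> normc (F t) <= g t) ->
  normc (cintegral D F) <= 2 * \int[mu]_(t in D) g t.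
Proof.
move=> mD [F1 F2] ig Fg; apply: le_trans (normc_le_ReIm _) _.
rewrite mulr_natl mulr2n; apply: lerD => /=;
  (apply: le_trans (le_normr_Rintegral _ _) _ => //);
  apply: le_Rintegral => //.
- exact: integrable_norm.
- by move=> t /Fg; apply: le_trans; exact: Re_le_normc.
- exact: integrable_norm.
- by move=> t /Fg; apply: le_trans; exact: Im_le_normc.
Qed.

Lemma cintegral_conj D F : cintegral D (fun t => conjc (F t)) = conjc (cintegral D F).
Proof.
have cReJ z : Re (conjc z) = Re z by case: z.
have cImJ z : Im (conjc z) = - Im z by case: z.
apply: complex_eq => /=; first by under eq_Rintegral do rewrite cReJ.
under eq_Rintegral do rewrite cImJ.
rewrite /Rintegral [X in fine X = _]integralE [X in _ = - fine X]integralE.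
set A := (\int[mu]_(x in D) _)%E; set B := (\int[mu]_(x in D) _)%E.
set A' := (\int[mu]_(x in D) _)%E; set B' := (\int[mu]_(x in D) _)%E.
have -> : A = B'.
  by apply: eq_integral => t _; rewrite -funeposN.
have -> : B = A'.
  by apply: eq_integral => t _; rewrite -funenegN.
have : (0 <= A')%E by apply: integral_ge0.
have : (0 <= B')%E by apply: integral_ge0.
case: A' => [a| |]//; case: B' => [b| |]//= _ _; rewrite ?oppr0//.
by rewrite opprB.
Qed.

Lemma within_continuous_segment (a b : R) (f : R -> R) :
  (forall t, t \in `[a, b] -> f @ t --> f t) -> {within `[a, b], continuous f}.
Proof.
move=> cf; apply: continuous_in_subspaceT => t /set_mem; exact: cf.
Qed.

Lemma integrable_segment (a b : R) (f : R -> R) :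
  (forall t, t \in `[a, b] -> f @ t --> f t) ->
  mu.-integrable `[a, b] (EFin \o f).
Proof.
move=> cf; apply: continuous_compact_integrable.
  exact: segment_compact.
exact: within_continuous_segment.
Qed.

Lemma cintegrable_segment (a b : R) F :
  (forall t, t \in `[a, b] -> F @ t --> F t) -> cintegrable `[a, b] F.
Proof.
by move=> cF; split; apply: integrable_segment => t /cF /cvgC_ReIm[].
Qed.

Lemma Rintegral_segment_cst (a b c : R) : a <= b ->
  \int[mu]_(t in `[a, b]) c = c * (b - a).
Proof.
move=> ab; rewrite Rintegral_cst//= lebesgue_measure_itv/= lte_fin.
by case: ltgtP ab => [_|//|->] //= _; rewrite subrr.
Qed.

Lemma normc_cintegral_segment (a b M : R) F : a <= b ->
  (forall t, t \in `[a, b] -> F @ t --> F t) ->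
  (forall t, t \in `[a, b] -> normc (F t) <= M) ->
  normc (cintegral `[a, b] F) <= 2 * (M * (b - a)).
Proof.
move=> ab cF FM; rewrite -(Rintegral_segment_cst _ ab).
apply: normc_cintegral_le => //; first exact: cintegrable_segment.
by apply: integrable_segment => t _; exact: cvg_cst.
Qed.

Lemma cintegral_split (a b c : R) F : a <= b -> b <= c ->
  (forall t, t \in `[a, c] -> F @ t --> F t) ->
  cintegral `[a, c] F = cintegral `[a, b] F + cintegral `[b, c] F.
Proof.
move=> ab bc cF.
have H (f : R -> R) : (forall t, t \in `[a, c] -> f @ t --> f t) ->
  \int[mu]_(t in `[a, c]) f t =
  \int[mu]_(t in `[a, b]) f t + \int[mu]_(t in `[b, c]) f t.
  move=> cf; have := integrable_segment cf => icf.
  have E := @Rintegral_itvB R f (BLeft a) (BRight c) b icf.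
  rewrite -(@Rintegral_itv_obnd_cbnd _ b) -?E ?bnd_simp//.
    by rewrite addrC subrK.
  apply: integrableS icf => //=; apply: subset_itv; rewrite bnd_simp//.
by apply: complex_eq; rewrite ?cReD ?cImD /=; apply: H => t /cF /cvgC_ReIm[].
Qed.

End ComplexIntegral.

(** * Complex derivatives, and the fundamental theorem of calculus *)

Section Derivatives.
Variable R : realType.
Local Notation C := (cplx R).
Local Notation Re := (@complex.Re R).
Local Notation Im := (@complex.Im R).
Local Notation mu := (@lebesgue_measure R).
Implicit Types (z w : C) (r s t : R) (f g : C -> C) (F G : R -> C).

Lemma cplx_hausdorff : hausdorff_space C.
Proof. exact: norm_hausdorff. Qed.

(** Caratheodory's form of complex differentiability: the difference quotient
extends continuously to [z], with value [d] there. *)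
Definition has_cderiv f (d z : C) :=
  exists psi : C -> C, [/\ forall y, f y - f z = psi y * (y - z),
    psi z = d & psi @ z --> d].

Lemma has_cderiv_derivable f d z : has_cderiv f d z ->
  derivable f z 1 /\ derive1 f z = d.
Proof.
move=> [psi [H psiz cpsi]].
have E : (fun h : C => h^-1 *: ((f \o shift z) (h *: (1:C)) - f z)) @ 0^' --> d.
  have E1 : \forall h \near (0:C)^', psi (h + z) =
      h^-1 *: ((f \o shift z) (h *: (1:C)) - f z).
    near=> h.
    have h0 : h != 0 by near: h; exact: nbhs_dnbhs_neq.
    rewrite /= [h *: _]mulr1 H addrK /GRing.scale/= mulrCA mulVf// mulr1//.
  apply: cvg_trans (near_eq_cvg E1) _.
  have : (fun h : C => h + z) @ 0^' --> z.
    rewrite -{2}(add0r z); apply: cvgCD; last exact: cvgC_cst.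
    exact: nbhs_dnbhs.
  by move=> hz; exact: (cvg_comp _ _ hz cpsi).
have Dv : derivable f z 1 by apply/cvg_ex; exists d.
split; first exact: Dv.
rewrite derive1E; exact: (cvg_lim cplx_hausdorff E).
Unshelve. all: by end_near. Qed.

Lemma derivable_has_cderiv f z : derivable f z 1 ->
  has_cderiv f (derive1 f z) z.
Proof.
move=> Df.
exists (fun y => if y == z then derive1 f z else (f y - f z) / (y - z)).
split.
- move=> y; case: eqVneq => [->|yz]; first by rewrite !subrr mulr0.
  by rewrite divfK// subr_eq0.
- by rewrite eqxx.
- apply/(@cvgC_normP R _ _ (nbhs_filter z)) => e e0.
  have : (fun h : C => h^-1 *: ((f \o shift z) (h *: (1:C)) - f z)) @ 0^' -->
     derive1 f z by rewrite derive1E; exact: Df.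
  move=> /cvgC_normP/(_ _ e0) H.
  have cs := cvgC_sub z.
  apply: (@filterS _ _ (nbhs_filter z) _ _ _ (cs _ H)) => y /=.
  move=> Hy; case: (boolP (y == z)) => [/eqP E|yz].
    by rewrite subrr normc_0.
  have : y - z != 0 by rewrite subr_eq0.
  move: Hy => /[apply]; rewrite [(y - z) *: _]mulr1 /= subrK /GRing.scale/= mulrC//.
Qed.

(** The same notion for functions of a real variable. *)
Definition has_rderiv F (d : C) t :=
  exists psi : R -> C, [/\ forall s, F s - F t = psi s * (s - t)%:C,
    psi t = d & psi @ t --> d].

Lemma has_rderiv_ReIm F d t : has_rderiv F d t ->
  is_derive t (1:R) (Re \o F) (Re d) /\ is_derive t (1:R) (Im \o F) (Im d).
Proof.
move=> [psi [H psit cpsi]].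
have aux (f p : R -> R) l : (forall s, f s - f t = p s * (s - t)) -> p @ t --> l ->
    is_derive t (1:R) f l.
  move=> Hf cp.
  have E : (fun h : R => h^-1 *: ((f \o shift t) (h *: (1:R)) - f t)) @ 0^' --> l.
    have E1 : \forall h \near (0:R)^', p (h + t) =
        h^-1 *: ((f \o shift t) (h *: (1:R)) - f t).
      near=> h.
      have h0 : h != 0 by near: h; exact: nbhs_dnbhs_neq.
      rewrite /= [h *: _]mulr1 Hf addrK /GRing.scale/= mulrCA mulVf// mulr1//.
    apply: cvg_trans (near_eq_cvg E1) _.
    have : (fun h : R => h + t) @ 0^' --> t.
      rewrite -{2}(add0r t); apply: cvgD; last exact: cvg_cst.
      exact: nbhs_dnbhs.
    by move=> hz; exact: (cvg_comp _ _ hz cp).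
  apply: DeriveDef; first by apply/cvg_ex; exists l.
  exact: (cvg_lim _ E).
have [c1 c2] := (cvgC_ReIm _ _).1 cpsi.
split; [apply: (aux _ (Re \o psi))|apply: (aux _ (Im \o psi))] => //= s.
- by have := congr1 Re (H s); rewrite cReD cReN cReM /= mulr0 subr0.
- by have := congr1 Im (H s); rewrite cImD cImN cImM /= mulr0 add0r.
Unshelve. all: by end_near. Qed.

Lemma has_rderiv_cvg F d t : has_rderiv F d t -> F @ t --> F t.
Proof.
move=> [psi [H _ cpsi]].
have E : F = (fun s => psi s * (s - t)%:C + F t).
  by apply/funext => s; rewrite -H subrK.
rewrite {1}E -{2}(add0r (F t)) -{1}(mulr0 d).
exact: (cvgCD (cvgCM cpsi (cvgR_subC t)) (cvgC_cst _)).
Qed.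

Lemma has_cderiv_cvg f d z : has_cderiv f d z -> f @ z --> f z.
Proof.
move=> [psi [H _ cpsi]].
have E : f = (fun y => psi y * (y - z) + f z).
  by apply/funext => y; rewrite -H subrK.
rewrite {1}E -{2}(add0r (f z)) -{1}(mulr0 d).
exact: (cvgCD (cvgCM cpsi (cvgC_sub z)) (cvgC_cst _)).
Qed.

Lemma has_rderiv_comp f F d e t : has_cderiv f d (F t) -> has_rderiv F e t ->
  has_rderiv (f \o F) (d * e) t.
Proof.
move=> [psi [H1 psi1 cpsi]] HF; have cF := has_rderiv_cvg HF.
case: HF => phi [H2 phi2 cphi].
exists (fun s => psi (F s) * phi s); split=> [s||].
- by rewrite /= H1 H2 mulrA.
- by rewrite psi1 phi2.
- exact: (cvgCM (cvg_comp _ _ cF cpsi) cphi).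
Qed.

Lemma has_cderivM f g d e z : has_cderiv f d z -> has_cderiv g e z ->
  has_cderiv (fun y => f y * g y) (d * g z + f z * e) z.
Proof.
move=> [psi [H1 psi1 cpsi]] HG; have cG := has_cderiv_cvg HG.
case: HG => phi [H2 phi2 cphi].
exists (fun y => psi y * g y + f z * phi y); split=> [y||].
- by rewrite mulrDl -(mulrA (f z)) -H2 mulrAC -H1; ring.
- by rewrite psi1 phi2.
- exact: (cvgCD (cvgCM cpsi cG) (cvgCM (cvgC_cst _) cphi)).
Qed.

Lemma has_cderivD f g d e z : has_cderiv f d z -> has_cderiv g e z ->
  has_cderiv (fun y => f y + g y) (d + e) z.
Proof.
move=> [psi [H1 psi1 cpsi]] [phi [H2 phi2 cphi]].
exists (fun y => psi y + phi y); split=> [y||].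
- by rewrite mulrDl -H1 -H2; ring.
- by rewrite psi1 phi2.
- exact: (cvgCD cpsi cphi).
Qed.

Lemma has_cderiv_cst c z : has_cderiv (fun=> c) 0 z.
Proof.
by exists (fun=> 0); split=> [y||//]; rewrite ?subrr ?mul0r//; exact: cvgC_cst.
Qed.

Lemma has_cderiv_id z : has_cderiv id 1 z.
Proof.
by exists (fun=> 1); split=> [y||//]; rewrite ?mul1r//; exact: cvgC_cst.
Qed.

Lemma has_cderivV z : z != 0 -> has_cderiv (fun y => y^-1) (- (z ^+ 2)^-1) z.
Proof.
move=> z0.
exists (fun y => if y == 0 then (z ^+2)^-1 else - (y * z)^-1); split=> [y||].
- case: eqVneq => [->|y0]; first by rewrite invr0 !sub0r mulrN expr2 invfM mulfVK.
  by field; rewrite y0 z0.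
- by rewrite (negbTE z0) expr2.
- have nz : \forall y \near z, - (y * z)^-1 =
     if y == 0 then (z ^+2)^-1 else - (y * z)^-1.
    near=> y; have : y != 0 by near: y; exact: nearC_neq.
    by move=> /negbTE ->.
  apply: cvg_trans (near_eq_cvg nz) _.
  have zz : z * z != 0 by rewrite mulf_neq0.
  rewrite expr2; exact: (cvgCN (cvgCV zz (cvgCM (cvgC_id z) (cvgC_cst z)))).
Unshelve. all: by end_near. Qed.

Lemma has_cderivX n z : has_cderiv (fun y => y ^+ n) (n%:R * z ^+ n.-1) z.
Proof.
elim: n => [|n IH].
  by rewrite mul0r; under eq_fun do rewrite expr0; exact: has_cderiv_cst.
under eq_fun do rewrite exprS.
have := has_cderivM (has_cderiv_id z) IH; congr (has_cderiv _ _ _).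
case: n {IH} => [|n] /=; first by rewrite !(mul0r, mulr0, addr0, expr0).
by rewrite exprS -[in RHS]natr1; ring.
Qed.

Lemma cintegral_FTC (a b : R) F (d : R -> C) : a <= b ->
  (forall t, t \in `[a, b] -> has_rderiv F (d t) t) ->
  (forall t, t \in `[a, b] -> d @ t --> d t) ->
  cintegral `[a, b] d = F b - F a.
Proof.
rewrite le_eqVlt => /predU1P[<- _ _|ab dF cd].
  by rewrite set_itv1 subrr; apply: complex_eq; rewrite /= Rintegral_set1.
have H (f g : R -> R) : (forall t, t \in `[a, b] -> is_derive t (1:R) f (g t)) ->
  (forall t, t \in `[a, b] -> g @ t --> g t) ->
  \int[mu]_(t in `[a, b]) g t = f b - f a.
  move=> df cg.
  rewrite /Rintegral (@continuous_FTC2 R g f a b)//.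
  - exact: within_continuous_segment.
  - have cf t : t \in `[a, b] -> f @ t --> f t.
      move=> /df [dft _]; apply: differentiable_continuous; exact/derivable1_diffP.
    split.
    + move=> x xab; have /df [//] : x \in `[a, b] by exact: subset_itv_oo_cc.
    + apply: cvg_at_right_filter; apply: cf; by rewrite in_itv/= lexx ltW.
    + apply: cvg_at_left_filter; apply: cf; by rewrite in_itv/= lexx ltW.
  - move=> x xab; have /df [_ <-] : x \in `[a, b] by exact: subset_itv_oo_cc.
    by rewrite derive1E.
apply: complex_eq; rewrite ?cReD ?cImD ?cReN ?cImN /=.
- apply: (H (Re \o F) (Re \o d)) => t tab; first by case: (has_rderiv_ReIm (dF _ tab)).
  by case: ((cvgC_ReIm _ _).1 (cd _ tab)).
- apply: (H (Im \o F) (Im \o d)) => t tab; first by case: (has_rderiv_ReIm (dF _ tab)).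
  by case: ((cvgC_ReIm _ _).1 (cd _ tab)).
Qed.

End Derivatives.

(** * Polar coordinates *)

Section Circle.
Variable R : realType.
Local Notation C := (cplx R).
Local Notation Re := (@complex.Re R).
Local Notation Im := (@complex.Im R).
Local Notation mu := (@lebesgue_measure R).
Local Notation ii := ((0 +i* 1) : C).
Implicit Types (z w : C) (r s t : R).

Lemma polarE r t : polar r t = r%:C * polar 1 t :> C.
Proof. by rewrite /polar; apply: complex_eq; rewrite ?cReM ?cImM /=; ring. Qed.

Lemma polarM r s t u : polar r t * polar s u = polar (r * s) (t + u) :> C.
Proof.
rewrite /polar cosD sinD; apply: complex_eq; rewrite ?cReM ?cImM /=; ring.
Qed.

Lemma polar0 r : polar r 0 = r%:C.
Proof. by rewrite /polar cos0 sin0 mulr1 mulr0. Qed.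

Lemma polar2pi r : polar r (2 * pi) = r%:C.
Proof.
by rewrite /polar mulr_natl cos2pi sin2pi mulr1 mulr0.
Qed.

Lemma normc_polar r t : normc (polar r t) = `|r|.
Proof.
by rewrite /polar /normc /= !exprMn -mulrDr cos2Dsin2 mulr1 sqrtr_sqr.
Qed.

Lemma normc_i : normc ii = 1.
Proof. by rewrite /normc /= expr0n/= add0r expr1n sqrtr1. Qed.

Lemma has_rderiv_of_ReIm (F : R -> C) (d : C) t :
  is_derive t (1:R) (Re \o F) (Re d) -> is_derive t (1:R) (Im \o F) (Im d) ->
  has_rderiv F d t.
Proof.
have aux (f : R -> R) l : is_derive t (1:R) f l -> exists p : R -> R,
    [/\ forall s, f s - f t = p s * (s - t), p t = l & p @ t --> l].
  move=> [Df fl].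
  exists (fun s => if s == t then l else (f s - f t) / (s - t)); split.
  - move=> s; case: eqVneq => [->|yz]; first by rewrite !subrr mulr0.
    by rewrite divfK// subr_eq0.
  - by rewrite eqxx.
  - apply/cvgrPdist_lt => e e0.
    have : (fun h : R => h^-1 *: ((f \o shift t) (h *: (1:R)) - f t)) @ 0^' --> l.
      by rewrite -fl; exact: Df.
    move=> /cvgrPdist_lt/(_ _ e0) H.
    have cs : (fun s : R => s - t) @ t --> (0:R).
      rewrite -[X in _ --> X](subrr t); apply: cvgB; [exact: cvg_id|exact: cvg_cst].
    near=> s.
    have Hs : (s - t != 0 -> `|l - (s - t)^-1 *:
        ((f \o shift t) ((s - t) *: (1:R)) - f t)| < e).
      by near: s; exact: (cs _ H).
    case: (boolP (s == t)) => [_|st].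
      by rewrite subrr normr0.
    have : s - t != 0 by rewrite subr_eq0.
    move: Hs => /[apply]; rewrite [(s - t) *: _]mulr1 /= subrK.
    by rewrite /GRing.scale/= mulrC.
move=> /aux [p [p1 p2 p3]] /aux [q [q1 q2 q3]].
exists (fun s => (p s +i* q s) : C); split.
- move=> s; apply: complex_eq; rewrite ?cReM ?cImM ?cReD ?cImD ?cReN ?cImN /=.
  + by rewrite mulr0 subr0; exact: p1.
  + by rewrite mulr0 add0r; exact: q1.
- by rewrite p2 q2; case: (d).
- by apply/cvgC_ReIm; split.
Unshelve. all: by end_near. Qed.

Lemma has_rderiv_polar r t : has_rderiv (polar r : R -> C) (ii * polar r t) t.
Proof.
apply: has_rderiv_of_ReIm; rewrite /polar ?cReM ?cImM /=.
- have : is_derive t (1:R) (fun t => r * cos t) (r * - sin t).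
    have := is_deriveZ r (is_derive_cos t); exact.
  by congr is_derive; ring.
- have : is_derive t (1:R) (fun t => r * sin t) (r * cos t).
    have := is_deriveZ r (is_derive_sin t); exact.
  by congr is_derive; ring.
Qed.

Lemma has_rderiv_polar_radius t s :
  has_rderiv (fun r => polar r t : C) (polar 1 t) s.
Proof.
exists (fun=> polar 1 t); split => //; last exact: cvgC_cst.
move=> r; rewrite polarE (polarE s) rmorphB/=; ring.
Qed.

Lemma cvg_polar r t : (polar r : R -> C) @ t --> polar r t.
Proof. exact: has_rderiv_cvg (has_rderiv_polar r t). Qed.

Lemma cvg_polar_radius t r : (fun s => polar s t : C) @ r --> polar r t.
Proof. exact: has_rderiv_cvg (has_rderiv_polar_radius t r). Qed.

Arguments cvg_polar : clear implicits.
Arguments cvg_polar_radius : clear implicits.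

Lemma normc_polarB r s t u : 0 <= r <= 1 ->
  normc (polar r t - polar s u) <= `|r - s| + 2 * `|t - u|.
Proof.
have arc_le c d : c <= d -> normc (polar 1 d - polar 1 c : C) <= 2 * (d - c).
  move=> cd; rewrite -(@cintegral_FTC R c d (polar 1) (fun t => ii * polar 1 t))//.
  - rewrite -[d - c]mul1r; apply: normc_cintegral_segment => // x _.
    + exact: (cvgCM (cvgC_cst _) (cvg_polar 1 x)).
    + by rewrite normc_M normc_i normc_polar mul1r normr1.
  - by move=> x _; exact: has_rderiv_polar.
  - by move=> x _; exact: (cvgCM (cvgC_cst _) (cvg_polar 1 x)).
have arc_le' c d : normc (polar 1 d - polar 1 c : C) <= 2 * `|d - c|.
  case: (leP c d) => [cd|/ltW dc].
    by rewrite ger0_norm ?subr_ge0// arc_le.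
  by rewrite normcBC distrC ger0_norm ?subr_ge0// arc_le.
move=> /andP[r0 r1].
have -> : polar r t - polar s u =
   r%:C * (polar 1 t - polar 1 u) + (r - s)%:C * polar 1 u :> C.
  by rewrite polarE (polarE s) rmorphB/=; ring.
apply: le_trans (normc_D _ _) _.
rewrite !normc_M !normc_real normc_polar normr1 mulr1 addrC lerD2l ger0_norm//.
by apply: le_trans (arc_le' _ _); rewrite ler_piMl// normc_ge0.
Qed.

End Circle.
Arguments cvg_polar {R} r t.
Arguments cvg_polar_radius {R} t r.
Arguments has_rderiv_polar {R} r t.

(** * Integrals along the boundary of polar rectangles *)

Section Goursat.
Variable R : realType.
Local Notation C := (cplx R).
Local Notation ii := ((0 +i* 1) : C).
Implicit Types (z w : C) (r s t a b c d : R) (f g : C -> C).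

Definition continuous_on_disk f := forall z, 0 < normc z < 1 -> f @ z --> f z.

Definition ray_integral f t a b :=
  cintegral `[a, b] (fun s => f (polar s t) * polar 1 t).
Definition arc_integral f s c d :=
  cintegral `[c, d] (fun t => f (polar s t) * (ii * polar s t)).

(** The integral of [f dz] along the boundary of the polar rectangle
[a <= |z| <= b, c <= arg z <= d]. *)
Definition boundary_integral f a b c d :=
  ray_integral f c a b + arc_integral f b c d
  - ray_integral f d a b - arc_integral f a c d.

Lemma polar_in_disk a b s t : 0 < a -> b < 1 -> s \in `[a, b] ->
  0 < normc (polar s t) < 1.
Proof.
move=> a0 b1; rewrite in_itv/= => /andP[as_ sb].
have s0 : 0 < s by exact: lt_le_trans as_.
by rewrite normc_polar gtr0_norm// s0 (le_lt_trans sb).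
Qed.

Lemma cvg_ray f a b s t : 0 < a -> b < 1 -> continuous_on_disk f -> s \in `[a, b] ->
  (fun s => f (polar s t) * polar 1 t : C) @ s --> f (polar s t) * polar 1 t.
Proof.
move=> a0 b1 cf sab.
have cfp := cf _ (polar_in_disk t a0 b1 sab).
exact: (cvgCM (cvg_comp _ _ (cvg_polar_radius t s) cfp) (cvgC_cst _)).
Qed.

Lemma cvg_arc f s t : 0 < s < 1 -> continuous_on_disk f ->
  (fun t => f (polar s t) * (ii * polar s t) : C) @ t -->
  f (polar s t) * (ii * polar s t).
Proof.
move=> /andP[s0 s1] cf.
have cfp : f @ polar s t --> f (polar s t).
  by apply: cf; rewrite normc_polar gtr0_norm// s0.
exact: (cvgCM (cvg_comp _ _ (cvg_polar s t) cfp)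
  (cvgCM (cvgC_cst _) (cvg_polar s t))).
Qed.

Lemma boundary_integralD f g a b c d : 0 < a -> a <= b -> b < 1 ->
  continuous_on_disk f -> continuous_on_disk g ->
  boundary_integral (fun z => f z + g z) a b c d =
  boundary_integral f a b c d + boundary_integral g a b c d.
Proof.
move=> a0 ab b1 cf cg.
have b0 : 0 < b by exact: lt_le_trans ab.
have a1 : a < 1 by exact: le_lt_trans b1.
have rayD t : ray_integral (fun z => f z + g z) t a b =
    ray_integral f t a b + ray_integral g t a b.
  rewrite /ray_integral -cintegralD//.
  - by apply: eq_cintegral => s _; rewrite mulrDl.
  - by apply: cintegrable_segment => s sab; exact: cvg_ray sab.
  - by apply: cintegrable_segment => s sab; exact: cvg_ray sab.
have arcD s : 0 < s < 1 -> arc_integral (fun z => f z + g z) s c d =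
    arc_integral f s c d + arc_integral g s c d.
  move=> s01; rewrite /arc_integral -cintegralD//.
  - by apply: eq_cintegral => t _; rewrite mulrDl.
  - by apply: cintegrable_segment => t _; exact: cvg_arc.
  - by apply: cintegrable_segment => t _; exact: cvg_arc.
rewrite /boundary_integral !rayD !arcD ?a0 ?b0//; ring.
Qed.

(** The four sides telescope when the integrand has a primitive; the affine part of a
differentiable function has one. *)
Lemma boundary_integral_primitive f g a b c d : 0 < a -> a <= b -> b < 1 -> c <= d ->
  continuous_on_disk f -> (forall z, has_cderiv g (f z) z) ->
  boundary_integral f a b c d = 0.
Proof.
move=> a0 ab b1 cd cf gf.
have b0 : 0 < b by exact: lt_le_trans ab.
have a1 : a < 1 by exact: le_lt_trans b1.
have rayE t : ray_integral f t a b = g (polar b t) - g (polar a t).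
  rewrite /ray_integral.
  rewrite (@cintegral_FTC _ _ _ (fun s => g (polar s t)))//.
  - move=> s _; apply: has_rderiv_comp (gf _) _; exact: has_rderiv_polar_radius.
  - by move=> s sab; exact: cvg_ray sab.
have arcE s : 0 < s < 1 -> arc_integral f s c d = g (polar s d) - g (polar s c).
  move=> s01; rewrite /arc_integral.
  rewrite (@cintegral_FTC _ _ _ (fun t => g (polar s t)))//.
  - move=> t _; apply: has_rderiv_comp (gf _) _; exact: has_rderiv_polar.
  - by move=> t _; exact: cvg_arc.
rewrite /boundary_integral !rayE !arcE ?a0 ?b0//; ring.
Qed.

Lemma boundary_integral_le f a b c d M : 0 < a -> a <= b -> b < 1 -> c <= d ->
  continuous_on_disk f ->
  (forall s t, s \in `[a, b] -> t \in `[c, d] -> normc (f (polar s t)) <= M) ->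
  normc (boundary_integral f a b c d) <= 4 * M * ((b - a) + (d - c)).
Proof.
move=> a0 ab b1 cd cf fM.
have b0 : 0 < b by exact: lt_le_trans ab.
have a1 : a < 1 by exact: le_lt_trans b1.
have M0 : 0 <= M.
  by apply: le_trans (fM a c _ _); rewrite ?normc_ge0 ?in_itv/= ?lexx.
have rayB t : t \in `[c, d] -> normc (ray_integral f t a b) <= 2 * (M * (b - a)).
  move=> tcd; apply: normc_cintegral_segment => // s sab; first exact: cvg_ray sab.
  by rewrite normc_M normc_polar normr1 mulr1 fM.
have arcB s : s \in `[a, b] -> normc (arc_integral f s c d) <= 2 * (M * (d - c)).
  move=> sab; have s01 : 0 < s < 1.
    by move: sab (polar_in_disk 0 a0 b1 sab); rewrite normc_polar in_itv/=
      => /andP[as_ _]; rewrite ger0_norm// (le_trans (ltW a0)).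
  apply: normc_cintegral_segment => // t tcd; first exact: cvg_arc.
  rewrite !normc_M normc_i mul1r normc_polar.
  case/andP: s01 => s0 s1.
  by rewrite gtr0_norm// -[leRHS]mulr1 ler_pM ?normc_ge0 ?fM// ltW.
have tri (x y z u : C) : normc (x + y - z - u) <= normc x + normc y + normc z + normc u.
  apply: le_trans (normc_D _ _) _; rewrite normc_N lerD2r.
  apply: le_trans (normc_D _ _) _; rewrite normc_N lerD2r.
  exact: normc_D.
apply: le_trans (tri _ _ _ _) _.
have -> : 4 * M * ((b - a) + (d - c)) =
  2 * (M * (b - a)) + 2 * (M * (d - c)) + 2 * (M * (b - a)) + 2 * (M * (d - c)).
  by ring.
have := rayB c; rewrite in_itv/= lexx cd => /(_ isT) h1.
have := rayB d; rewrite in_itv/= lexx cd => /(_ isT) h2.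
have := arcB a; rewrite in_itv/= lexx ab => /(_ isT) h3.
have := arcB b; rewrite in_itv/= lexx ab => /(_ isT) h4.
by rewrite (lerD (lerD (lerD h1 h4) h2) h3).
Qed.

Lemma boundary_integral_split_radius f a e b c d : 0 < a -> a <= e -> e <= b ->
  b < 1 -> continuous_on_disk f ->
  boundary_integral f a b c d =
  boundary_integral f a e c d + boundary_integral f e b c d.
Proof.
move=> a0 ae eb b1 cf; rewrite /boundary_integral.
have E t : ray_integral f t a b = ray_integral f t a e + ray_integral f t e b.
  by apply: cintegral_split => // s sab; exact: cvg_ray sab.
rewrite !E; ring.
Qed.

Lemma boundary_integral_split_angle f a b c e d : 0 < a -> a <= b -> b < 1 ->
  c <= e -> e <= d -> continuous_on_disk f ->
  boundary_integral f a b c d =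
  boundary_integral f a b c e + boundary_integral f a b e d.
Proof.
move=> a0 ab b1 ce ed cf; rewrite /boundary_integral.
have b0 : 0 < b by exact: lt_le_trans ab.
have a1 : a < 1 by exact: le_lt_trans b1.
have E s : 0 < s < 1 ->
   arc_integral f s c d = arc_integral f s c e + arc_integral f s e d.
  by move=> s01; apply: cintegral_split => // t _; exact: cvg_arc.
rewrite !E ?a0 ?b0//; ring.
Qed.

End Goursat.

(** * Goursat's lemma, and circular means independent of the radius *)

Section GoursatLemma.
Variable R : realType.
Local Notation C := (cplx R).
Local Notation ii := ((0 +i* 1) : C).
Implicit Types (z w : C) (r s t a b c d : R) (f g : C -> C).

Lemma nested_segments (u v : nat -> R) : (forall n, u n <= u n.+1) ->
  (forall n, v n.+1 <= v n) -> (forall n, u n <= v n) ->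
  exists x, forall n, u n <= x <= v n.
Proof.
move=> ui vd uv.
have ui' m n : (m <= n)%N -> u m <= u n.
  by move=> mn; exact: ((nondecreasing_seqP u).1 ui _ _ mn).
have vd' m n : (m <= n)%N -> v n <= v m.
  by move=> mn; exact: ((nonincreasing_seqP v).1 vd _ _ mn).
have uv' m n : u m <= v n.
  apply: le_trans (ui' _ _ (leq_maxl m n)) _; apply: le_trans (uv _) _.
  exact: vd' (leq_maxr m n).
have hs : has_sup (range u).
  by split; [exists (u 0%N), 0%N|exists (v 0%N) => _ [m _ <-]].
exists (sup (range u)) => n; apply/andP; split.
  by apply: (sup_upper_bound hs); exists n.
by apply: ge_sup => [|_ [m _ <-]//]; exists (u 0%N), 0%N.
Qed.

(** Repeated bisection of a rectangle, always keeping a quarter that satisfies [P],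
encloses a single point. *)
Lemma bisection (P : R -> R -> R -> R -> bool) a b c d :
  (forall a b c d, P a b c d -> a <= b /\ c <= d) ->
  (forall a b c d, P a b c d -> let e := (a + b) / 2 in let g := (c + d) / 2 in
    [|| P a e c g, P a e g d, P e b c g | P e b g d]) ->
  P a b c d -> exists x y, forall n, exists a' b' c' d',
    [/\ a' <= x <= b', c' <= y <= d', b' - a' = (b - a) / 2 ^+ n,
        d' - c' = (d - c) / 2 ^+ n & P a' b' c' d'].
Proof.
move=> Ple Phalf P0.
pose step (q : R * R * (R * R)) :=
  let: ((a, b), (c, d)) := q in let e := (a + b) / 2 in let g := (c + d) / 2 in
  if P a e c g then ((a, e), (c, g)) else if P a e g d then ((a, e), (g, d))
  else if P e b c g then ((e, b), (c, g)) else ((e, b), (g, d)).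
pose PQ (q : R * R * (R * R)) := P q.1.1 q.1.2 q.2.1 q.2.2.
pose q n := iter n step ((a, b), (c, d)).
have PQs k : PQ k -> PQ (step k).
  case: k => -[a1 b1] [c1 d1]; rewrite /PQ /= => /Phalf /=.
  by do 3 case: ifP => //=.
have stepE k : PQ k ->
   [/\ k.1.1 <= (step k).1.1, (step k).1.2 <= k.1.2,
       k.2.1 <= (step k).2.1 & (step k).2.2 <= k.2.2] /\
   (step k).1.2 - (step k).1.1 = (k.1.2 - k.1.1) / 2 /\
   (step k).2.2 - (step k).2.1 = (k.2.2 - k.2.1) / 2.
  case: k => -[a1 b1] [c1 d1]; rewrite /PQ /= => /Ple /= [ab cd].
  by case: ifP => _ /=; [|case: ifP => _ /=; [|case: ifP => _ /=]];
    (split; [split|split]); lra.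
have PQq n : PQ (q n) by elim: n => //= n IH; exact: PQs.
have [x Hx] : exists x, forall n, (q n).1.1 <= x <= (q n).1.2.
  apply: nested_segments => n; first by case: (stepE _ (PQq n)) => -[].
    by case: (stepE _ (PQq n)) => -[].
  by case: (Ple _ _ _ _ (PQq n)).
have [y Hy] : exists y, forall n, (q n).2.1 <= y <= (q n).2.2.
  apply: nested_segments => n; first by case: (stepE _ (PQq n)) => -[].
    by case: (stepE _ (PQq n)) => -[].
  by case: (Ple _ _ _ _ (PQq n)).
have len n : (q n).1.2 - (q n).1.1 = (b - a) / 2 ^+ n /\
             (q n).2.2 - (q n).2.1 = (d - c) / 2 ^+ n.
  elim: n => [|n [IH1 IH2]]; first by rewrite expr0 !divr1.
  have [_ [E1 E2]] := stepE _ (PQq n).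
  by rewrite /= E1 E2 IH1 IH2 exprSr invfM !mulrA.
exists x, y => n; exists (q n).1.1, (q n).1.2, (q n).2.1, (q n).2.2.
by case: (len n) => l1 l2; split => //; exact: PQq.
Qed.

(** Goursat's lemma on a polar rectangle. Were the integral nonzero, bisection
would produce smaller and smaller rectangles, shrinking to a point, on which
the integral stays above a fixed multiple of the squared diameter; but the
affine part of [f] at that point has a primitive and the remainder is
negligible at that scale. *)
Lemma goursat f a b c d : 0 < a -> a <= b -> b < 1 -> c <= d ->
  (forall z, 0 < normc z < 1 -> derivable f z 1) ->
  boundary_integral f a b c d = 0.
Proof.
move=> a0 ab b1 cd Df.
have cf : continuous_on_disk f.
  by move=> z /Df /derivable_has_cderiv /has_cderiv_cvg.
apply/eqP; rewrite -normc_eq0; apply/eqP.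
set N := normc _; have N0 : 0 <= N by exact: normc_ge0.
apply/eqP; rewrite eq_le N0 andbT leNgt; apply/negP => Ngt0.
pose S := (b - a) + (d - c).
have S0 : 0 <= S by rewrite addr_ge0// subr_ge0.
pose e := N / (2 * (S ^+ 2 + 1)).
have S2 : 0 < S ^+ 2 + 1 by rewrite ltr_wpDl// sqr_ge0.
have e0 : 0 < e by rewrite divr_gt0// mulr_gt0.
pose P (a b c d : R) := [&& 0 < a, a <= b, b < 1, c <= d &
  e * ((b - a) + (d - c)) ^+ 2 < normc (boundary_integral f a b c d)].
have P0 : P a b c d.
  rewrite /P a0 ab b1 cd/= -/N -/S /e mulrAC ltr_pdivrMr ?mulr_gt0//.
  rewrite ltr_pM2l//; lra.
have Ple a1 b1' c1 d1 : P a1 b1' c1 d1 -> a1 <= b1' /\ c1 <= d1.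
  by move=> /and5P[].
have nP a1 b1' c1 d1 : ~~ P a1 b1' c1 d1 -> 0 < a1 -> a1 <= b1' -> b1' < 1 ->
    c1 <= d1 ->
    normc (boundary_integral f a1 b1' c1 d1) <= e * ((b1' - a1) + (d1 - c1)) ^+ 2.
  by move=> + h1 h2 h3 h4; rewrite /P h1 h2 h3 h4 /= -leNgt.
have Phalf a1 b1' c1 d1 : P a1 b1' c1 d1 ->
    let g := (a1 + b1') / 2 in let h := (c1 + d1) / 2 in
    [|| P a1 g c1 h, P a1 g h d1, P g b1' c1 h | P g b1' h d1].
  move=> /and5P[h1 h2 h3 h4 h5] /=.
  set g := (a1 + b1') / 2; set h := (c1 + d1) / 2.
  have [ag gb] : a1 <= g /\ g <= b1' by rewrite /g; lra.
  have [ch hd] : c1 <= h /\ h <= d1 by rewrite /h; lra.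
  apply/negP => /negP; rewrite !negb_or.
  have g1 : g < 1 by exact: le_lt_trans h3.
  have g0 : 0 < g by exact: lt_le_trans ag.
  move=> /and4P[/nP q1 /nP q2 /nP q3 /nP q4].
  have {}q1 := q1 h1 ag g1 ch.
  have {}q2 := q2 h1 ag g1 hd.
  have {}q3 := q3 g0 gb h3 ch.
  have {}q4 := q4 g0 gb h3 hd.
  move: h5; rewrite ltNge => /negP; apply.
  rewrite (@boundary_integral_split_radius _ _ _ g)//.
  rewrite (@boundary_integral_split_angle _ _ _ _ _ h)//.
  rewrite (@boundary_integral_split_angle _ _ g _ _ h)//.
  apply: le_trans (normc_D _ _) _.
  apply: le_trans (lerD (normc_D _ _) (normc_D _ _)) _.
  apply: le_trans (lerD (lerD q1 q2) (lerD q3 q4)) _.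
  rewrite le_eqVlt; apply/orP; left; apply/eqP.
  by rewrite /g /h; field.
have [x [y Hxy]] := bisection Ple Phalf P0.
have zin : 0 < normc (polar x y) < 1.
  have [a' [b' [c' [d' [xab _ _ _ /and5P[h1 h2 h3 _ _]]]]]] := Hxy 0%N.
  by apply: (@polar_in_disk R a' b'); rewrite // in_itv.
set z0 := polar x y in zin.
have [psi [Epsi psi0 cpsi]] := derivable_has_cderiv (Df _ zin).
set D := derive1 f z0 in psi0 cpsi.
have e8 : 0 < e / 8 by rewrite divr_gt0.
have /nearCP[del del0 Hdel] := (cvgC_normP (FF := nbhsC_filter z0) _ _).1 cpsi _ e8.
have [n Hn] : exists n, S / 2 ^+ n * 2 < del.
  have HK : S * 2 / del < 2 ^+ Num.bound (S * 2 / del).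
    apply: lt_trans (archi_boundP _) _.
      by rewrite divr_ge0 ?mulr_ge0// ltW.
    by rewrite -[X in _ < X ^+ _]natr1 natr1 -natrX ltr_nat ltn_expl.
  exists (Num.bound (S * 2 / del)).
  by rewrite mulrAC ltr_pdivrMr ?exprn_gt0// -ltr_pdivrMl// mulrC.
have [a' [b' [c' [d' [xab ycd lb ld /and5P[h1 h2 h3 h4 h5]]]]]] := Hxy n.
pose g (z : C) := f z0 + D * (z - z0).
pose G (z : C) := f z0 * z + D * ((z - z0) * (z - z0)) * (2^-1)%:C.
have dG z : has_cderiv G (g z) z.
  have dz : has_cderiv (fun y : C => y - z0) (1 + 0) z.
    exact: (has_cderivD (has_cderiv_id z) (has_cderiv_cst (- z0) z)).
  have := has_cderivD (has_cderivM (has_cderiv_cst (f z0) z) (has_cderiv_id z))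
    (has_cderivM (has_cderivM (has_cderiv_cst D z) (has_cderivM dz dz))
       (has_cderiv_cst (2^-1)%:C z)).
  have h2' : (2^-1)%:C + (2^-1)%:C = 1 :> C.
    by rewrite -rmorphD/= -[in RHS](rmorph1 (real_complex R)); congr (_%:C); lra.
  congr (has_cderiv _ _ _).
  have -> : g z = f z0 + D * (z - z0) * ((2^-1)%:C + (2^-1)%:C).
    by rewrite h2' mulr1.
  ring.
pose h (z : C) := f z - g z.
have cg : continuous_on_disk g.
  by move=> z _; exact: (cvgCD (cvgC_cst _) (cvgCM (cvgC_cst _)
     (cvgCB (cvgC_id z) (cvgC_cst _)))).
have ch : continuous_on_disk h by move=> z hz; exact: (cvgCB (cf z hz) (cg z hz)).
have bE : boundary_integral f a' b' c' d' = boundary_integral h a' b' c' d'.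
  have fE : f = (fun z => g z + h z).
    by apply/funext => z; rewrite /h addrC subrK.
  have E := boundary_integralD c' d' h1 h2 h3 cg ch.
  rewrite (boundary_integral_primitive h1 h2 h3 h4 cg dG) add0r -fE in E.
  exact: E.
move: h5; rewrite ltNge bE => /negP; apply.
set Sn := (b' - a') + (d' - c').
have SnE : Sn = S / 2 ^+ n by rewrite /Sn lb ld -mulrDl.
have Sn0 : 0 <= Sn by rewrite addr_ge0// subr_ge0.
apply: le_trans (@boundary_integral_le _ h a' b' c' d' (e / 8 * (2 * Sn)) _ _ _ _ _ _) _ => //.
  move=> s t; rewrite !in_itv/= => /andP[s1 s2] /andP[t1 t2].
  have zz : normc (polar s t - z0) <= 2 * Sn.
    apply: le_trans (normc_polarB _ _ _ _) _.
      by rewrite (le_trans (ltW h1))//= (le_trans s2)// ltW.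
    have : `|s - x| <= b' - a'.
      by case/andP: xab => x1 x2; rewrite ler_norml; apply/andP; split; lra.
    have : `|t - y| <= d' - c'.
      by case/andP: ycd => y1 y2; rewrite ler_norml; apply/andP; split; lra.
    rewrite /Sn; move: (h2); lra.
  have -> : h (polar s t) = (psi (polar s t) - D) * (polar s t - z0).
    rewrite /h /g mulrBl -Epsi; ring.
  rewrite normc_M ler_pM ?normc_ge0// normcBC ltW// Hdel//.
  by rewrite (le_lt_trans zz)// SnE mulrC.
rewrite le_eqVlt; apply/orP; left; apply/eqP; rewrite -/Sn.
clearbody e; by field.
Qed.

(** On the rectangle spanned by a full turn the two radial sides cancel, and Goursat's
lemma leaves the difference of the two circles. *)
Lemma arc_integral_const f r s : (forall z, 0 < normc z < 1 -> derivable f z 1) ->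
  0 < r < 1 -> 0 < s < 1 ->
  arc_integral f r 0 (2 * pi) = arc_integral f s 0 (2 * pi).
Proof.
move=> Df.
have le_case a b : 0 < a -> a <= b -> b < 1 ->
    arc_integral f a 0 (2 * pi) = arc_integral f b 0 (2 * pi).
  move=> a0 ab b1.
  have pi2 : 0 <= 2 * pi :> R by rewrite mulr_ge0// pi_ge0.
  have := goursat a0 ab b1 pi2 Df; rewrite /boundary_integral.
  have -> : ray_integral f (2 * pi) a b = ray_integral f 0 a b.
    by apply: eq_cintegral => u _; rewrite !polar2pi !polar0.
  move=> E; apply/esym/eqP; rewrite -subr_eq0 -E; apply/eqP; ring.
move=> /andP[r0 r1] /andP[s0 s1].
by case: (leP r s) => [|/ltW] rs; [exact: le_case|apply/esym; exact: le_case].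
Qed.

Lemma has_cderiv_exprz (n : int) z : z != 0 ->
  exists d : C, has_cderiv (fun y : C => y ^ n) d z.
Proof.
move=> z0; case: n => n.
  by exists (n%:R * z ^+ n.-1); exact: has_cderivX.
have : exists d : C, has_cderiv (fun y : C => (y^-1) ^+ n.+1) d z.
  elim: n.+1 => [|k [d IH]].
    by exists 0; exact: has_cderiv_cst.
  exists (- (z ^+ 2)^-1 * z^-1 ^+ k + z^-1 * d).
  have := has_cderivM (has_cderivV z0) IH.
  have -> : (fun s : C => s^-1 * s^-1 ^+ k) = (fun s : C => s^-1 ^+ k.+1).
    by apply/funext => s; rewrite exprS.
  exact.
move=> [d Hd]; exists d; move: Hd.
have -> // : (fun y : C => y^-1 ^+ n.+1) = (fun y : C => y ^ Negz n).
by apply/funext => y; rewrite exprVn.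
Qed.

End GoursatLemma.

(** * Means over the circle, and Bessel's inequality *)

Section CircleAverage.
Variable R : realType.
Local Notation C := (cplx R).
Local Notation Re := (@complex.Re R).
Local Notation Im := (@complex.Im R).
Local Notation mu := (@lebesgue_measure R).
Local Notation ii := ((0 +i* 1) : C).
Implicit Types (z w : C) (r s t : R) (F G : R -> C).

Lemma conjc_M z w : conjc (z * w) = conjc z * conjc w.
Proof. exact: rmorphM. Qed.

Lemma conjc_B z w : conjc (z - w) = conjc z - conjc w.
Proof. exact: rmorphB. Qed.

Lemma conjc_X z n : conjc (z ^+ n) = conjc z ^+ n.
Proof. exact: rmorphXn. Qed.

Lemma conjc_sum (I : Type) (s : seq I) (f : I -> C) :
  conjc (\sum_(i <- s) f i) = \sum_(i <- s) conjc (f i).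
Proof. exact: rmorph_sum. Qed.

Lemma conjc_K z : conjc (conjc z) = z.
Proof. exact: conjcK. Qed.

Lemma conjc_R r : conjc (r%:C) = r%:C :> C.
Proof. exact: conjc_real. Qed.

Definition cavg F : C := ((2 * pi)^-1)%:C * cintegral `[0, 2 * pi] F.

Definition rcont F := forall t, F @ t --> F t.

Lemma pi2_gt0 : 0 < 2 * pi :> R.
Proof. by rewrite mulr_gt0// pi_gt0. Qed.

Lemma pi2_ge0 : 0 <= 2 * pi :> R.
Proof. exact: ltW pi2_gt0. Qed.

Lemma rcont_cst c : rcont (fun=> c).
Proof. by move=> t; exact: cvgC_cst. Qed.
Arguments rcont_cst : clear implicits.

Lemma rcontD F G : rcont F -> rcont G -> rcont (fun t => F t + G t).
Proof. by move=> cF cG t; exact: (cvgCD (cF t) (cG t)). Qed.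

Lemma rcontB F G : rcont F -> rcont G -> rcont (fun t => F t - G t).
Proof. by move=> cF cG t; exact: (cvgCB (cF t) (cG t)). Qed.

Lemma rcontM F G : rcont F -> rcont G -> rcont (fun t => F t * G t).
Proof. by move=> cF cG t; exact: (cvgCM (cF t) (cG t)). Qed.

Lemma rcont_conj F : rcont F -> rcont (fun t => conjc (F t)).
Proof. by move=> cF t; exact: (cvgC_conj (cF t)). Qed.

Lemma rcont_sum (I : Type) (s : seq I) (F : I -> R -> C) :
  (forall i, rcont (F i)) -> rcont (fun t => \sum_(i <- s) F i t).
Proof. by move=> cF t; exact: (cvgC_sum (s:=s) (fun i => cF i t)). Qed.

Lemma rcont_polar r : rcont (polar r).
Proof. by move=> t; exact: cvg_polar. Qed.
Arguments rcont_polar : clear implicits.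

Lemma rcont_comp (f : C -> C) F : rcont F -> (forall t, f @ F t --> f (F t)) ->
  rcont (fun t => f (F t)).
Proof. by move=> cF cf t; exact: (cvg_comp _ _ (cF t) (cf t)). Qed.

Lemma rcont_cintegrable F a b : rcont F -> cintegrable `[a, b] F.
Proof. by move=> cF; apply: cintegrable_segment => t _; exact: cF. Qed.

Lemma cavgD F G : rcont F -> rcont G ->
  cavg (fun t => F t + G t) = cavg F + cavg G.
Proof.
by move=> cF cG; rewrite /cavg cintegralD ?mulrDr//; exact: rcont_cintegrable.
Qed.

Lemma cavgZ c F : rcont F -> cavg (fun t => c * F t) = c * cavg F.
Proof.
by move=> cF; rewrite /cavg cintegralZ 1?mulrCA//; exact: rcont_cintegrable.
Qed.

Lemma cavgB F G : rcont F -> rcont G ->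
  cavg (fun t => F t - G t) = cavg F - cavg G.
Proof.
by move=> cF cG; rewrite /cavg cintegralB ?mulrBr//; exact: rcont_cintegrable.
Qed.

Lemma cavg_sum (I : Type) (s : seq I) (F : I -> R -> C) :
  (forall i, rcont (F i)) ->
  cavg (fun t => \sum_(i <- s) F i t) = \sum_(i <- s) cavg (F i).
Proof.
move=> cF; rewrite /cavg cintegral_sum ?mulr_sumr// => i.
exact: rcont_cintegrable.
Qed.

Lemma cavg_conj F : cavg (fun t => conjc (F t)) = conjc (cavg F).
Proof. by rewrite /cavg cintegral_conj conjc_M conjc_R. Qed.

Lemma eq_cavg F G : (forall t, F t = G t) -> cavg F = cavg G.
Proof. by move=> FG; congr cavg; exact/funext. Qed.

Lemma cavg_cst c : cavg (fun=> c) = c.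
Proof.
have e c' : \int[mu]_(t in `[0, 2 * pi]) c' = c' * (2 * pi).
  by rewrite Rintegral_segment_cst ?subr0// ltW// pi2_gt0.
have pi0 : 2 * pi != 0 :> R by rewrite gt_eqF// pi2_gt0.
rewrite /cavg; apply: complex_eq; rewrite ?cReM ?cImM /= !e;
  by rewrite mul0r ?subr0 ?addr0 mulrC mulfK.
Qed.

Lemma normc_cavg F M : rcont F -> (forall t, normc (F t) <= M) ->
  normc (cavg F) <= 2 * M.
Proof.
move=> cF FM; rewrite /cavg normc_M normc_real.
rewrite ger0_norm ?invr_ge0 ?pi2_ge0//.
rewrite ler_pdivrMl ?pi2_gt0//.
apply: le_trans (normc_cintegral_segment _ _ _) _ => //.
  exact: pi2_ge0.
by rewrite le_eqVlt; apply/orP; left; apply/eqP; ring.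
Qed.

Lemma conjc_polar r t : conjc (polar r t) = polar r (- t).
Proof. by rewrite /polar /= cosN sinN mulrN. Qed.

Lemma polar1_neq0 t : polar 1 t != 0 :> C.
Proof. by rewrite -normc_eq0 normc_polar normr1 oner_eq0. Qed.

Lemma conjc_polar1 t : conjc (polar 1 t) = (polar 1 t)^-1.
Proof.
apply: (mulfI (polar1_neq0 t)); rewrite mul_conjc normc_polar normr1 expr1n.
by rewrite divff// polar1_neq0.
Qed.

Lemma rcont_polar_exp (n : int) : rcont (fun t => polar 1 t ^ n).
Proof.
move=> t; have [d /has_cderiv_cvg H] := has_cderiv_exprz n (polar1_neq0 t).
exact: (cvg_comp _ _ (cvg_polar 1 t) H).
Qed.
Arguments rcont_polar_exp : clear implicits.

Lemma polar1_exp (n : int) t : polar 1 t ^ n = polar 1 (n%:~R * t).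
Proof.
have nat_case (k : nat) u : polar 1 u ^+ k = polar 1 (k%:R * u) :> C.
  elim: k => [|k IH]; first by rewrite mul0r polar0 expr0.
  by rewrite exprS IH polarM mulr1 -natr1 mulrDl mul1r addrC.
case: n => n; first exact: nat_case.
rewrite NegzE mulrNz mulNr -conjc_polar -nat_case conjc_X conjc_polar1.
by rewrite exprVn.
Qed.

(** For [n != 0] the integrand is the derivative of a multiple of itself, which has
period [2 pi]. *)
Lemma cavg_polar_exp (n : int) : cavg (fun t => polar 1 t ^ n) = (n == 0)%:R.
Proof.
case: (boolP (n == 0)) => [/eqP ->|n0].
  by rewrite (eq_cavg (G := fun=> 1)) ?cavg_cst// => t; rewrite expr0z.
have dn t : has_rderiv (fun t => polar 1 t ^ n)
    (((n%:~R)%:C * ii) * polar 1 t ^ n) t.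
  have -> : (fun t => polar 1 t ^ n) = (fun t => polar 1 (n%:~R * t)).
    by apply/funext => u; rewrite polar1_exp.
  rewrite polar1_exp.
  have [psi [p1 p2 p3]] := has_rderiv_polar 1 (n%:~R * t).
  exists (fun s => (n%:~R)%:C * psi (n%:~R * s)); split.
  - by move=> s; rewrite p1 -mulrBr rmorphM/=; ring.
  - by rewrite p2 mulrA.
  - rewrite -mulrA; apply: cvgCM; first exact: cvgC_cst.
    have cc : (fun s : R => n%:~R * s) @ t --> (n%:~R * t : R).
      by apply: cvgM; [exact: cvg_cst|exact: cvg_id].
    exact: (cvg_comp _ _ cc p3).
have c0 : ((n%:~R)%:C * ii) != 0 :> C.
  by rewrite -normc_eq0 normc_M normc_i mulr1 normc_real normr_eq0 intr_eq0.
have cn := rcont_polar_exp n.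
have : ((n%:~R)%:C * ii) * cavg (fun t => polar 1 t ^ n) = 0.
  rewrite -cavgZ// /cavg (@cintegral_FTC _ _ _ (fun t => polar 1 t ^ n)).
  - by rewrite polar2pi polar0 subrr mulr0.
  - exact: pi2_ge0.
  - by move=> t _; exact: dn.
  - by move=> t _; exact: (rcontM (rcont_cst _) cn).
by move/eqP; rewrite mulf_eq0 (negbTE c0)/= => /eqP ->.
Qed.

Definition cip F G := cavg (fun t => F t * conjc (G t)).

Lemma cip_conj F G : cip G F = conjc (cip F G).
Proof.
rewrite /cip -cavg_conj; apply: eq_cavg => t.
by rewrite conjc_M conjc_K mulrC.
Qed.

Lemma cip_normE F : cip F F =
  ((2 * pi)^-1 * \int[mu]_(t in `[0, 2 * pi]) normc (F t) ^+ 2)%:C.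
Proof.
rewrite /cip /cavg rmorphM /=; congr (_ * _); apply: complex_eq => /=.
  by apply: eq_Rintegral => t _; rewrite mul_conjc.
rewrite (_ : (fun t => _) = cst 0) ?Rintegral_cst ?mul0r//.
by apply/funext => t; rewrite mul_conjc.
Qed.

(** The right-hand side exceeds the left-hand side by the squared distance of [F]
to its projection on the span of the [e i]. *)
Lemma cip_bessel F (e : nat -> R -> C) N : rcont F -> (forall i, rcont (e i)) ->
  (forall i j, cip (e i) (e j) = (i == j)%:R) ->
  \sum_(i < N) (normc (cip F (e i)) ^+ 2) <=
  (2 * pi)^-1 * \int[mu]_(t in `[0, 2 * pi]) normc (F t) ^+ 2.
Proof.
move=> cF ce eo.
pose S t := \sum_(i < N) cip F (e i) * e i t.
have cS : rcont S by apply: rcont_sum => i; exact: (rcontM (rcont_cst _) (ce i)).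
set A := \sum_(i < N) _.
have FS : cip F S = A%:C.
  rewrite /cip /S; under eq_cavg do rewrite conjc_sum mulr_sumr.
  rewrite cavg_sum; last first.
    by move=> i; exact: (rcontM cF (rcont_conj (rcontM (rcont_cst _) (ce i)))).
  rewrite /A (rmorph_sum (real_complex R)); apply: eq_bigr => i _.
  rewrite (eq_cavg (G := fun t => conjc (cip F (e i)) * (F t * conjc (e i t)))).
    rewrite cavgZ; last exact: (rcontM cF (rcont_conj (ce i))).
    by rewrite mulrC mul_conjc.
  by move=> t; rewrite conjc_M; ring.
have SS : cip S S = A%:C.
  rewrite {1}/cip {1}/S.
  under eq_cavg do rewrite mulr_suml.
  rewrite cavg_sum; last first.
    by move=> i; exact: (rcontM (rcontM (rcont_cst _) (ce i)) (rcont_conj cS)).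
  rewrite /A (rmorph_sum (real_complex R)); apply: eq_bigr => i _.
  under eq_cavg do rewrite -mulrA.
  rewrite cavgZ; last exact: (rcontM (ce i) (rcont_conj cS)).
  rewrite -[cavg _]/(cip (e i) S) (cip_conj S (e i)).
  have -> : cip S (e i) = cip F (e i).
    rewrite {1}/cip /S; under eq_cavg do rewrite mulr_suml.
    rewrite cavg_sum; last first.
      by move=> j; exact: (rcontM (rcontM (rcont_cst _) (ce j)) (rcont_conj (ce i))).
    rewrite (bigD1 i)//= big1 ?addr0.
      under eq_cavg do rewrite -mulrA.
      rewrite cavgZ; last exact: (rcontM (ce i) (rcont_conj (ce i))).
      by rewrite -[cavg _]/(cip (e i) (e i)) eo eqxx mulr1.
    move=> j ji; under eq_cavg do rewrite -mulrA.
    rewrite cavgZ; last exact: (rcontM (ce j) (rcont_conj (ce i))).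
    by rewrite -[cavg _]/(cip (e j) (e i)) eo val_eqE (negbTE ji) mulr0.
  by rewrite mul_conjc.
have : 0 <= Re (cip (fun t => F t - S t) (fun t => F t - S t)).
  rewrite cip_normE /= mulr_ge0 ?invr_ge0 ?pi2_ge0//.
  by apply: Rintegral_ge0 => t _; rewrite sqr_ge0.
have -> : cip (fun t => F t - S t) (fun t => F t - S t) =
    cip F F - cip F S - (cip S F - cip S S).
  rewrite /cip -!cavgB.
  - by apply: eq_cavg => t; rewrite conjc_B; ring.
  - exact: (rcontB (rcontM cF (rcont_conj cF)) (rcontM cF (rcont_conj cS))).
  - exact: (rcontB (rcontM cS (rcont_conj cF)) (rcontM cS (rcont_conj cS))).
  - exact: (rcontM cS (rcont_conj cF)).
  - exact: (rcontM cS (rcont_conj cS)).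
  - exact: (rcontM cF (rcont_conj cF)).
  - exact: (rcontM cF (rcont_conj cS)).
by rewrite SS (cip_conj F S) FS conjc_R subrr subr0 cip_normE -rmorphB /= subr_ge0.
Qed.

Lemma cip_cvg0 F (e : nat -> R -> C) : rcont F -> (forall i, rcont (e i)) ->
  (forall i j, cip (e i) (e j) = (i == j)%:R) ->
  (fun n => cip F (e n)) @ \oo --> (0 : C).
Proof.
move=> cF ce eo.
apply/cvgC_norm; under eq_cvg do rewrite sub0r normc_N.
have : (fun n => normc (cip F (e n)) ^+ 2) @ \oo --> (0 : R).
  apply: cvg_series_cvg_0; apply: nondecreasing_is_cvgn.
    apply/nondecreasing_seqP => n; rewrite /series/= big_nat_recr//=.
    by rewrite lerDl sqr_ge0.
  exists ((2 * pi)^-1 * \int[mu]_(t in `[0, 2 * pi]) normc (F t) ^+ 2).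
  move=> _ [n _ <-]; rewrite /series/= big_mkord; exact: cip_bessel.
move=> H; have := cvg_comp _ _ H (@sqrt_continuous R 0).
by rewrite sqrtr0; apply: cvg_trans; apply: near_eq_cvg; near=> n;
  rewrite /= sqrtr_sqr ger0_norm// normc_ge0.
Unshelve. all: by end_near. Qed.

End CircleAverage.
Arguments rcont_cst {R} c.
Arguments rcont_polar {R} r.
Arguments rcont_polar_exp {R} n.

(** * Laurent coefficients on the punctured disk *)

Section Laurent.
Variable R : realType.
Local Notation C := (cplx R).
Local Notation Re := (@complex.Re R).
Local Notation Im := (@complex.Im R).
Local Notation ii := ((0 +i* 1) : C).
Implicit Types (z w : C) (r s t : R) (f g : C -> C) (n : int).

Lemma cvgC0P {T : Type} {F : set_system T} {FF : Filter F} (f : T -> C) :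
  f @ F --> (0 : C) <-> (fun x => normc (f x)) @ F --> (0 : R).
Proof.
have E : (fun x => normc (0 - f x)) = (fun x => normc (f x)).
  by apply/funext => x; rewrite sub0r normc_N.
by rewrite cvgC_norm E.
Qed.

Definition hol f := forall z, 0 < normc z < 1 -> derivable f z 1.

Definition lcoef f n r := cavg (fun t => f (polar r t) * polar r t ^ (- n)).

(** The radius [1 / 2] is arbitrary, by [lcoef_radius]. *)
Definition laurent f n := lcoef f n 2^-1.

Lemma hol_cvg f z : hol f -> 0 < normc z < 1 -> f @ z --> f z.
Proof. by move=> hf /hf /derivable_has_cderiv /has_cderiv_cvg. Qed.

Lemma neq0_disk z : 0 < normc z < 1 -> z != 0.
Proof. by rewrite normc_gt0 => /andP[]. Qed.

Lemma disk_polar r t : 0 < r < 1 -> 0 < normc (polar r t) < 1.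
Proof. by move=> /andP[r0 r1]; rewrite normc_polar gtr0_norm// r0. Qed.

Lemma hol_exprz n : hol (fun z => z ^ n).
Proof.
move=> z /neq0_disk /(has_cderiv_exprz n) [d /has_cderiv_derivable[]//].
Qed.
Arguments hol_exprz : clear implicits.

Lemma hol_of_has_cderiv f (d : C -> C) :
  (forall z, 0 < normc z < 1 -> has_cderiv f (d z) z) -> hol f.
Proof. by move=> H z /H /has_cderiv_derivable[]. Qed.

Lemma hol_has_cderiv f z : hol f -> 0 < normc z < 1 -> has_cderiv f (derive1 f z) z.
Proof. by move=> hf /hf /derivable_has_cderiv. Qed.

Lemma holM f g : hol f -> hol g -> hol (fun z => f z * g z).
Proof.
move=> hf hg; apply: (@hol_of_has_cderiv _
  (fun z => derive1 f z * g z + f z * derive1 g z)) => z zd.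
by apply: has_cderivM; exact: hol_has_cderiv.
Qed.

Lemma rcont_hol f r : hol f -> 0 < r < 1 -> rcont (fun t => f (polar r t)).
Proof.
move=> hf r01; apply: rcont_comp; first exact: rcont_polar.
by move=> t; apply: hol_cvg => //; exact: disk_polar.
Qed.

Lemma rcont_lcoef f n r : hol f -> 0 < r < 1 ->
  rcont (fun t => f (polar r t) * polar r t ^ n).
Proof.
move=> hf r01; have hn := hol_exprz n; exact: (rcont_hol (holM hf hn) r01).
Qed.

Lemma exprz_succ z n : z != 0 -> z ^ (n + 1) = z ^ n * z.
Proof. by move=> z0; rewrite expfzDr. Qed.

(** Multiplied by [z ^ (- n - 1)], the function is still holomorphic on the punctured
disk, and its integral along a circle is the coefficient up to a constant. *)
Lemma lcoef_radius f n r s : hol f -> 0 < r < 1 -> 0 < s < 1 ->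
  lcoef f n r = lcoef f n s.
Proof.
move=> hf r01 s01.
pose g z := f z * z ^ (- n - 1).
have hg : hol g by exact: holM hf (hol_exprz _).
have E q : 0 < q < 1 ->
    arc_integral g q 0 (2 * pi) = ii * ((2 * pi)%:C * lcoef f n q).
  move=> q01; rewrite /lcoef /cavg mulrA -rmorphM/= mulfV ?gt_eqF ?pi2_gt0//.
  rewrite mul1r -cintegralZ//; last by apply: rcont_cintegrable; exact: rcont_lcoef.
  apply: eq_cintegral => t _; rewrite /g.
  have p0 := neq0_disk (disk_polar t q01).
  have -> : polar q t ^ (- n) = polar q t ^ (- n - 1) * polar q t.
    by rewrite -exprz_succ// subrK.
  ring.
have A := arc_integral_const hg r01 s01.
rewrite (E r r01) (E s s01) in A; move: A.
have i0 : ii != 0 by rewrite -normc_eq0 normc_i oner_eq0.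
move/(mulfI i0)/mulfI; apply.
by rewrite -normc_eq0 normc_real normr_eq0 gt_eqF// pi2_gt0.
Qed.

Lemma half01 : 0 < (2^-1 : R) < 1.
Proof. by rewrite invr_gt0 ltr0n invf_lt1 ?ltr0n// ltr1n. Qed.

Lemma laurentE f n r : hol f -> 0 < r < 1 -> laurent f n = lcoef f n r.
Proof. by move=> hf r01; apply: lcoef_radius => //; exact: half01. Qed.

Lemma normc_exprz z n : normc (z ^ n) = normc z ^ n.
Proof.
by case: n => n; rewrite /exprz ?normc_V normcX.
Qed.

Lemma conjc_exprz z n : conjc (z ^ n) = conjc z ^ n.
Proof.
case: n => n; rewrite /exprz ?conjc_X//.
by rewrite -[LHS]/(conjc _) -conjc_X; exact: fmorphV.
Qed.

Lemma polar_exprz r t n : polar r t ^ n = r%:C ^ n * polar 1 t ^ n :> C.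
Proof. by rewrite polarE expfzMl. Qed.

Lemma cip_polar (k l : int) :
  cip (fun t => polar 1 t ^ k) (fun t => polar 1 t ^ l) = (k == l)%:R :> C.
Proof.
rewrite /cip -(subr_eq0 k l) -(@cavg_polar_exp R); apply: eq_cavg => t.
rewrite expfzDr ?polar1_neq0// conjc_exprz conjc_polar1 exprz_inv//.
Qed.

Lemma fourier_cvg0 (F : R -> C) (phi : nat -> int) : rcont F -> injective phi ->
  (fun k => cip F (fun t => polar 1 t ^ phi k)) @ \oo --> (0 : C).
Proof.
move=> cF iphi; apply: (cip_cvg0 cF (fun k => rcont_polar_exp (phi k))) => i j.
by rewrite cip_polar (inj_eq iphi).
Qed.

(** With [psi] the difference quotient of [f] at [w], the coefficients of [f] on
the circle through [w] are differences of consecutive coefficients of [psi], so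
the Laurent series telescopes; its remainders are Fourier coefficients of the
continuous function [psi], hence tend to zero. *)
Lemma laurent_telescope f w : hol f -> 0 < normc w < 1 ->
  exists g : int -> C, [/\
    forall n, laurent f n * w ^ n = (n == 0)%:R * f w + g n - g (n + 1),
    (fun k : nat => g k%:Z) @ \oo --> (0 : C) &
    (fun k : nat => g (- k%:Z)) @ \oo --> (0 : C)].
Proof.
move=> hf wd; set r := normc w in wd; have w0 := neq0_disk wd.
have [psi [Epsi psiw cpsi]] := hol_has_cderiv hf wd.
have cpsiD z : 0 < normc z < 1 -> psi @ z --> psi z.
  move=> zd; case: (boolP (z == w)) => [/eqP->|zw].
    by rewrite psiw.
  have nz : \forall y \near z, (f y - f w) * (y - w)^-1 = psi y.
    near=> y; have yw : y != w by near: y; exact: nearC_neq.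
    by rewrite Epsi mulfK// subr_eq0.
  have -> : psi z = (f z - f w) * (z - w)^-1 by rewrite Epsi mulfK// subr_eq0.
  apply: cvg_trans (near_eq_cvg nz) _.
  have zw' : z - w != 0 by rewrite subr_eq0.
  have cz := hol_cvg hf zd.
  exact: (cvgCM (cvgCB cz (cvgC_cst _)) (cvgCV zw' (cvgCB (cvgC_id z) (cvgC_cst w)))).
pose F t := psi (polar r t).
have cF : rcont F.
  apply: rcont_comp; first exact: rcont_polar.
  by move=> t; apply: cpsiD; exact: disk_polar.
pose d n := cavg (fun t => F t * polar r t ^ (- n)).
have cFn n : rcont (fun t => F t * polar r t ^ n).
  exact: (rcontM cF (rcont_hol (hol_exprz n) wd)).
have dE n : laurent f n = (n == 0)%:R * f w + d (n - 1) - w * d n.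
  rewrite (laurentE _ hf wd) /lcoef.
  have -> : (n == 0)%:R * f w = cavg (fun t => (f w * r%:C ^ (- n)) * polar 1 t ^ (- n)).
    rewrite cavgZ; last exact: rcont_polar_exp.
    rewrite cavg_polar_exp oppr_eq0; case: (n =P 0) => [->|_].
      by rewrite oppr0 expr0z; ring.
    by rewrite !(mul0r, mulr0).
  have cT := rcontM (rcont_cst (f w * r%:C ^ (- n))) (rcont_polar_exp (- n)).
  have := cavgB (rcontD cT (cFn (- (n - 1)))) (rcontM (rcont_cst w) (cFn (- n))).
  rewrite (cavgD cT (cFn _)) (cavgZ w (cFn _)) => <-.
  apply: eq_cavg => t.
  have p0 := neq0_disk (disk_polar t wd).
  have -> : - (n - 1) = - n + 1 by rewrite opprB addrC.
  rewrite -mulrA -polar_exprz exprz_succ// /F.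
  have -> : f (polar r t) = f w + psi (polar r t) * (polar r t - w).
    by rewrite -Epsi addrC subrK.
  ring.
pose h n := cip F (fun t => polar 1 t ^ n).
have dh n : d n = r%:C ^ (- n) * h n.
  rewrite -cavgZ; last exact: (rcontM cF (rcont_conj (rcont_polar_exp n))).
  apply: eq_cavg => t.
  by rewrite polar_exprz conjc_exprz conjc_polar1 exprz_inv mulrCA.
have gcvg (phi : nat -> int) : injective (fun k => phi k - 1) ->
    (fun k => d (phi k - 1) * w ^ (phi k)) @ \oo --> (0 : C).
  move=> /(fourier_cvg0 cF) H.
  have r0 : r != 0 by case/andP: wd => /gt_eqF ->.
  have E k : normc (d (phi k - 1) * w ^ phi k) = r * normc (h (phi k - 1)).
    rewrite dh; move: (h _) => u; rewrite !normc_M !normc_exprz normc_real ger0_norm ?normc_ge0//.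
    rewrite -/r -[in X in _ * _ * X](subrK 1 (phi k)) expfzDr// expr1z.
    by rewrite mulrACA -expfzDr// addNr expr0z mul1r mulrC.
  have K : (fun k => r * normc (h (phi k - 1))) @ \oo --> (0 : R).
    have H' := (cvgC0P _).1 H.
    have K0 : (fun k => r * normc (h (phi k - 1))) @ \oo --> (r * 0 : R).
      by apply: cvgMl_tmp; exact: H'.
    by move: K0; rewrite mulr0.
  by apply/cvgC0P; rewrite (funext E).
exists (fun n => d (n - 1) * w ^ n); split.
- move=> n; rewrite dE addrK !mulrDl mulNr; congr (_ + _ - _).
    case: (n =P 0) => [->|_]; last by rewrite !mul0r.
    by rewrite expr0z mulr1.
  by rewrite exprz_succ//; ring.
- by apply: gcvg => i j /addIr [].
- by apply: gcvg => i j /addIr /oppr_inj [].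
Unshelve. all: by end_near. Qed.

End Laurent.
Arguments hol_exprz {R} n.

(** * Uniformly summable series *)

Section ComplexSeries.
Variable R : realType.
Local Notation C := (cplx R).
Local Notation Re := (@complex.Re R).
Local Notation Im := (@complex.Im R).
Implicit Types (z w : C) (r s t : R) (u : nat -> C) (b : nat -> R).

Lemma Re_sum (I : Type) (s : seq I) (f : I -> C) :
  Re (\sum_(i <- s) f i) = \sum_(i <- s) Re (f i).
Proof. by elim: s => [|i s IH]; rewrite ?big_nil// !big_cons cReD IH. Qed.

Lemma Im_sum (I : Type) (s : seq I) (f : I -> C) :
  Im (\sum_(i <- s) f i) = \sum_(i <- s) Im (f i).
Proof. by elim: s => [|i s IH]; rewrite ?big_nil// !big_cons cImD IH. Qed.

Lemma normc_sum (I : Type) (s : seq I) (f : I -> C) :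
  normc (\sum_(i <- s) f i) <= \sum_(i <- s) normc (f i).
Proof.
elim: s => [|i s IH]; first by rewrite !big_nil normc_0.
by rewrite !big_cons (le_trans (normc_D _ _))// lerD2l.
Qed.

Lemma cvg_series_normc u b : (forall n, normc (u n) <= b n) ->
  cvgn (series b) -> cvgn (series u).
Proof.
move=> ub cb.
have aux (v : nat -> R) : (forall n, `|v n| <= b n) -> cvgn (series v).
  move=> vb; apply: normed_cvg.
  apply: (series_le_cvg _ _ _ cb) => n //=; exact: le_trans (normr_ge0 _) (vb n).
have cRe : cvgn (series (Re \o u)).
  by apply: aux => n; apply: le_trans (ub n); exact: Re_le_normc.
have cIm : cvgn (series (Im \o u)).
  by apply: aux => n; apply: le_trans (ub n); exact: Im_le_normc.
apply/cvg_ex; exists ((limn (series (Re \o u))) +i* (limn (series (Im \o u)))).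
apply/cvgC_ReIm; split => /=.
- have -> : Re \o series u = series (Re \o u); last exact: cRe.
  by apply/funext => n; rewrite /series/= Re_sum.
- have -> : Im \o series u = series (Im \o u); last exact: cIm.
  by apply/funext => n; rewrite /series/= Im_sum.
Qed.

Lemma normc_series_tail u b N : (forall n, normc (u n) <= b n) ->
  cvgn (series b) ->
  normc (limn (series u) - series u N) <= limn (series b) - series b N.
Proof.
move=> ub cb; have cu := cvg_series_normc ub cb.
have b0 n : 0 <= b n by exact: le_trans (normc_ge0 _) (ub n).
have H : (fun n => normc (series u n - series u N)) @ \oo -->
    normc (limn (series u) - series u N).
  exact: (cvg_normc (cvgCB cu (cvgC_cst _))).
apply: (cvgr_to_le H); near=> n.
have Nn : (N <= n)%N by near: n; exact: nbhs_infty_ge.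
rewrite sub_series_geq//; apply: le_trans (normc_sum _ _) _.
apply: (@le_trans _ _ (\sum_(N <= k < n) b k)); first by apply: ler_sum.
rewrite -sub_series_geq// lerD2r; apply: nondecreasing_cvgn_le cb _.
by apply/nondecreasing_seqP => k; rewrite /series/= big_nat_recr//= lerDl.
Unshelve. all: by end_near. Qed.

Lemma series_tail_near b e : cvgn (series b) -> 0 < e ->
  \forall n \near \oo, `|limn (series b) - series b n| < e.
Proof. by move=> /cvgrPdist_lt H /H. Qed.

(** The Weierstrass M-test, along an arbitrary filter. *)
Lemma lim_series_cvg {T : Type} {F : set_system T} {FF : ProperFilter F}
    (u : nat -> T -> C) (l : nat -> C) b :
  (forall n, u n @ F --> l n) -> (\forall x \near F, forall n, normc (u n x) <= b n) ->
  cvgn (series b) ->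
  (fun x => limn (series (u^~ x))) @ F --> limn (series l).
Proof.
move=> ul ub cb.
have FF' : Filter F by exact: filter_filter.
have lb n : normc (l n) <= b n.
  have H : (fun x => normc (u n x)) @ F --> normc (l n) by exact: cvg_normc.
  by apply: (cvgr_to_le H); apply: filterS ub => x; exact.
apply/cvgC_normP => e e0.
have e3 : 0 < e / 3 by rewrite divr_gt0.
have [N HN] : exists N, limn (series b) - series b N < e / 3.
  have [N _ HN] : \forall n \near \oo, `|limn (series b) - series b n| < e / 3.
    exact: series_tail_near.
  by exists N; apply: le_lt_trans (HN N (leqnn N)); exact: ler_norm.
have sN : (fun x => series (u^~ x) N) @ F --> series l N.
  rewrite /series/=.
  exact: (cvgC_sum (s := index_iota 0 N) ul).
have sNe : \forall x \near F, normc (series l N - series (u^~ x) N) < e / 3.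
  by have := (cvgC_normP (FF := FF') _ _).1 sN _ e3.
apply: filterS2 ub sNe => x ubx sx.
have -> : limn (series l) - limn (series (u^~ x)) =
  (limn (series l) - series l N) + (series l N - series (u^~ x) N)
  + - (limn (series (u^~ x)) - series (u^~ x) N) by ring.
apply: le_lt_trans (normc_D _ _) _; rewrite normc_N.
apply: le_lt_trans (lerD (normc_D _ _) (lexx _)) _.
have t1 := normc_series_tail N lb cb.
have t2 := normc_series_tail N ubx cb.
lra.
Qed.

Lemma rcont_series (u : nat -> R -> C) b : (forall n, rcont (u n)) ->
  (forall n t, normc (u n t) <= b n) -> cvgn (series b) ->
  rcont (fun t => limn (series (u^~ t))).
Proof.
move=> cu ub cb t.
apply: (lim_series_cvg (fun n => cu n t) _ cb).
by apply: nearW => s n; exact: ub.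
Qed.

Lemma cavg_series (u : nat -> R -> C) b : (forall n, rcont (u n)) ->
  (forall n t, normc (u n t) <= b n) -> cvgn (series b) ->
  series (fun n => cavg (u n)) @ \oo --> cavg (fun t => limn (series (u^~ t))).
Proof.
move=> cu ub cb; have cS := rcont_series cu ub cb.
apply/cvgC_normP => e e0.
have e2 : 0 < e / 2 by rewrite divr_gt0.
have H : \forall n \near \oo, `|limn (series b) - series b n| < e / 2.
  exact: series_tail_near.
apply: filterS H => n Hn.
have cSn : rcont (fun t => series (u^~ t) n).
  by rewrite /series/=; exact: (rcont_sum (s := index_iota 0 n) cu).
have -> : series (fun n => cavg (u n)) n = cavg (fun t => series (u^~ t) n).
  by rewrite /series/= cavg_sum.
rewrite -cavgB//.
apply: (@le_lt_trans _ _ (2 * (limn (series b) - series b n))).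
  apply: normc_cavg; first exact: rcontB.
  by move=> t; apply: normc_series_tail => // k.
have := ler_norm (limn (series b) - series b n); lra.
Qed.

Lemma series_recl (V : zmodType) (c : nat -> V) n :
  series c n.+1 = c 0%N + series (fun k => c k.+1) n.
Proof. by rewrite /series/= big_nat_recl. Qed.

Lemma mul_geometric_le (q : R) n : 0 <= q < 1 -> n.+1%:R * q ^+ n <= (1 - q)^-1.
Proof.
move=> /andP[q0 q1]; have q1' : 0 < 1 - q by rewrite subr_gt0.
rewrite -[leRHS]mul1r ler_pdivlMr//.
have qn k : 0 <= q ^+ k by exact: exprn_ge0.
suff : n.+1%:R * q ^+ n * (1 - q) + q ^+ n.+1 <= 1.
  by apply: le_trans; rewrite lerDl.
elim: n => [|n IH]; first by rewrite expr0 expr1 !mul1r subrK.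
have -> : n.+2%:R * q ^+ n.+1 * (1 - q) + q ^+ n.+2 =
   q * (n.+1%:R * q ^+ n * (1 - q) + q ^+ n.+1) + (1 - q) * q ^+ n.+1.
  by rewrite -[n.+2%:R]natr1 !exprS; ring.
have h1 : q * (n.+1%:R * q ^+ n * (1 - q) + q ^+ n.+1) <= q by rewrite ler_piMr.
have h2 : (1 - q) * q ^+ n.+1 <= 1 - q.
  by rewrite ler_piMr ?(ltW q1')// exprn_ile1 ?(ltW q1).
by apply: le_trans (lerD h1 h2) _; rewrite addrC subrK.
Qed.

Definition pconv (a : nat -> C) :=
  forall z, normc z < 1 -> cvgn (series (fun k => a k * z ^+ k : C)).

Definition pser (a : nat -> C) z : C := limn (series (fun k => a k * z ^+ k : C)).

Definition pderiv (a : nat -> C) (k : nat) : C := k.+1%:R * a k.+1.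

Lemma pconv_bound a r : pconv a -> 0 <= r < 1 ->
  exists2 M, 0 <= M & forall k, normc (a k) * r ^+ k <= M.
Proof.
move=> ca /andP[r0 r1].
have c0 : normc (r%:C) < 1 by rewrite normc_real ger0_norm.
have H := cvg_series_cvg_0 (ca _ c0).
have Hc : cvgn (fun k => normc (a k * r%:C ^+ k)).
  by apply/cvg_ex; exists 0; exact/cvgC0P.
have [M [_ HM]] := cvg_seq_bounded Hc.
have := HM (`|M| + 1) (ltr_pwDr ltr01 (ler_norm _)) => HM1.
exists (`|M| + 1); first by rewrite addr_ge0.
move=> k; have := HM1 k I => /=; rewrite ger0_norm ?normc_ge0//.
by rewrite normc_M normcX normc_real ger0_norm.
Qed.

Lemma pconv_summable a r : pconv a -> 0 <= r < 1 ->
  cvgn (series (fun k => normc (a k) * r ^+ k)).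
Proof.
move=> ca /andP[r0 r1].
pose s := (r + 1) / 2.
have s1 : s < 1 by rewrite /s; lra.
have rs : r < s by rewrite /s; lra.
have s0 : 0 < s by exact: le_lt_trans rs.
have [|M M0 HM] := @pconv_bound a s ca; first by rewrite ltW.
have q0 : 0 <= r / s by rewrite divr_ge0// ltW.
have q1 : r / s < 1 by rewrite ltr_pdivrMr// mul1r.
apply: (@series_le_cvg _ _ (geometric M (r / s))).
- by move=> n; rewrite mulr_ge0 ?normc_ge0// exprn_ge0.
- by move=> n; rewrite /geometric/= mulr_ge0// exprn_ge0.
- move=> n; rewrite /geometric/= expr_div_n mulrA.
  rewrite ler_pdivlMr ?exprn_gt0// mulrAC ler_wpM2r// exprn_ge0//.
- by apply: is_cvg_geometric_series; rewrite ger0_norm.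
Qed.

Lemma pderiv_summable a r : pconv a -> 0 <= r < 1 ->
  cvgn (series (fun k => k.+1%:R * normc (a k.+1) * r ^+ k)).
Proof.
move=> ca /andP[r0 r1].
pose s := (r + 1) / 2.
have s1 : s < 1 by rewrite /s; lra.
have rs : r < s by rewrite /s; lra.
have s0 : 0 < s by exact: le_lt_trans rs.
have q0 : 0 <= r / s by rewrite divr_ge0// ltW.
have q1 : r / s < 1 by rewrite ltr_pdivrMr// mul1r.
have cs : cvgn (series (fun k => normc (a k) * s ^+ k)).
  by apply: pconv_summable => //; rewrite ltW.
have cs1 : cvgn (series (fun k => normc (a k.+1) * s ^+ k.+1)).
  have -> : series (fun k => normc (a k.+1) * s ^+ k.+1) =
      (fun n => series (fun k => normc (a k) * s ^+ k) n.+1 - normc (a 0%N) * s ^+ 0).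
    by apply/funext => n; rewrite series_recl addrC addKr.
  apply: is_cvgB; last exact: is_cvg_cst.
  by move/cvg_ex: cs => [l Hl]; apply/cvg_ex; exists l; rewrite cvg_shiftS.
pose K := (1 - r / s)^-1 / s.
have K0 : 0 <= K by rewrite divr_ge0 ?invr_ge0 ?subr_ge0// ltW.
apply: (@series_le_cvg _ _ (fun k => K * (normc (a k.+1) * s ^+ k.+1))).
- by move=> n; rewrite mulr_ge0 ?exprn_ge0// mulr_ge0// normc_ge0.
- by move=> n; rewrite mulr_ge0// mulr_ge0 ?normc_ge0// exprn_ge0// ltW.
- move=> n.
  have /= := @mul_geometric_le (r / s) n; rewrite q0 q1 => /(_ isT) H.
  have -> : K * (normc (a n.+1) * s ^+ n.+1) =
    (1 - r / s)^-1 * (normc (a n.+1) * s ^+ n).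
    by rewrite /K exprS; field; rewrite gt_eqF//= subr_eq0 gt_eqF// divr1.
  have -> : n.+1%:R * normc (a n.+1) * r ^+ n =
    (n.+1%:R * (r / s) ^+ n) * (normc (a n.+1) * s ^+ n).
    by rewrite expr_div_n; field; rewrite expf_neq0// gt_eqF.
  by rewrite ler_wpM2r// mulr_ge0 ?normc_ge0// exprn_ge0// ltW.
- have -> : series (fun k => K * (normc (a k.+1) * s ^+ k.+1)) =
    (fun n => K * series (fun k => normc (a k.+1) * s ^+ k.+1) n).
    by apply/funext => n; rewrite /series/= mulr_sumr.
  by apply: is_cvgMl_tmp.
Qed.

End ComplexSeries.

(** * Power series *)

Section PowerSeries.
Variable R : realType.
Local Notation C := (cplx R).
Implicit Types (z w : C) (r s t : R) (f g : C -> C) (n : int) (a : nat -> C).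

Lemma has_cderivI f (psi : C -> C) (d w : C) :
  (\forall y \near w, f y - f w = psi y * (y - w)) -> psi @ w --> d ->
  has_cderiv f d w.
Proof.
move=> fpsi cpsi.
exists (fun y => if y == w then d else (f y - f w) / (y - w)); split.
- move=> y; case: (boolP (y == w)) => [/eqP->|yw]; first by rewrite !subrr mulr0.
  by rewrite divfK// subr_eq0.
- by rewrite eqxx.
apply/(cvgC_normP (FF := nbhsC_filter w)) => e e0.
have := (cvgC_normP (FF := nbhsC_filter w) _ _).1 cpsi _ e0 => H.
near=> y.
case: (boolP (y == w)) => [_|yw]; first by rewrite subrr normc_0.
have -> : f y - f w = psi y * (y - w) by near: y.
rewrite mulfK ?subr_eq0//; near: y; exact: H.
Unshelve. all: by end_near. Qed.

Lemma has_cderiv_near f g (d w : C) : (\forall y \near w, f y = g y) ->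
  has_cderiv f d w -> has_cderiv g d w.
Proof.
move=> fg [psi [E psiw cpsi]]; apply: (has_cderivI _ cpsi).
have fgw : f w = g w by exact: nbhs_singleton fg.
near=> y; rewrite -fgw -E; congr (_ - _); apply/esym; near: y; exact: fg.
Unshelve. all: by end_near. Qed.

Lemma has_cderiv_comp f g (d e z : C) : has_cderiv f d (g z) -> has_cderiv g e z ->
  has_cderiv (fun y => f (g y)) (d * e) z.
Proof.
move=> [psi [H1 psi1 cpsi]] Hg; have cg := has_cderiv_cvg Hg.
case: Hg => phi [H2 phi2 cphi].
exists (fun y => psi (g y) * phi y); split=> [y||].
- by rewrite H1 H2 mulrA.
- by rewrite psi1 phi2.
- exact: (cvgCM (cvg_comp _ _ cg cpsi) cphi).
Qed.

Lemma cvgCS (u : nat -> C) (l : C) : u @ \oo --> l -> (fun m => u m.+1) @ \oo --> l.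
Proof. by move=> ul; rewrite (cvg_shiftS u). Qed.

Lemma pconv_pderiv a : pconv a -> pconv (pderiv a).
Proof.
move=> ca z z1.
have z01 : 0 <= normc z < 1 by rewrite normc_ge0.
apply: (cvg_series_normc _ (pderiv_summable ca z01)) => k.
by rewrite /pderiv !normc_M normc_nat normcX.
Qed.

Lemma cvg_pser a z : pconv a -> normc z < 1 ->
  series (fun k => a k * z ^+ k : C) @ \oo --> pser a z.
Proof. by move=> ca /ca. Qed.

Lemma cvgC_unique {T : Type} {F : set_system T} {FF : ProperFilter F} (h : T -> C) (x y : C) :
  h @ F --> x -> h @ F --> y -> x = y.
Proof. by move=> hx hy; exact: (cvg_unique (@cplx_hausdorff R) hx hy). Qed.

(** Divided by [y - w], the difference [y ^ k - w ^ k] is a sum of [k] monomials of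
degree [k - 1]; on a smaller disk the resulting series is dominated uniformly in
[y], so that [y] may tend to [w] term by term. *)
Lemma has_cderiv_pser a w : pconv a -> normc w < 1 ->
  has_cderiv (pser a) (pser (pderiv a) w) w.
Proof.
move=> ca w1.
pose r := (normc w + 1) / 2.
have w0 := normc_ge0 w.
have r1 : r < 1 by rewrite /r; lra.
have wr : normc w < r by rewrite /r; lra.
have r01 : 0 <= r < 1 by rewrite r1 andbT; lra.
pose v k (y : C) := a k.+1 * \sum_(i < k.+1) y ^+ (k - i) * w ^+ i.
have near_r : \forall y \near w, normc y < r.
  have e0 : 0 < r - normc w by rewrite subr_gt0.
  near=> y.
  have : normc (y - w) < r - normc w by near: y; exact: nearC_ball.
  by have := normc_D (y - w) w; rewrite subrK; lra.
have xr (x : C) j : normc x < r -> normc x ^+ j <= r ^+ j.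
  by move=> xr; apply: lerXn2r; rewrite ?nnegrE ?normc_ge0 ?(ltW xr)//; case/andP: r01.
have vb y : normc y < r -> forall k, normc (v k y) <= k.+1%:R * normc (a k.+1) * r ^+ k.
  move=> yr k; rewrite /v normc_M mulrC mulrAC ler_wpM2r ?normc_ge0//.
  apply: le_trans (normc_sum _ _) _.
  apply: (@le_trans _ _ (\sum_(i < k.+1) r ^+ k)); last first.
    by rewrite sumr_const card_ord mulr_natl.
  apply: ler_sum => i _; rewrite normc_M !normcX.
  rewrite -[in leRHS](subnK (ltn_ord i : (i <= k)%N)) exprD.
  by apply: ler_pM; rewrite ?exprn_ge0 ?normc_ge0 ?xr.
have vw k : v k w = pderiv a k * w ^+ k.
  rewrite /v /pderiv (eq_bigr (fun=> w ^+ k)).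
    by rewrite sumr_const card_ord mulr_natl mulrnAl mulrnAr.
  by move=> i _; rewrite -exprD subnK// -ltnS.
have cv k : v k @ w --> pderiv a k * w ^+ k.
  have H (i : 'I_k.+1) : (fun y : C => y ^+ (k - i) * w ^+ i) @ w -->
      (w ^+ (k - i) * w ^+ i : C).
    exact: (cvgCM (cvgCX (n := (k - i)%N) (cvgC_id w)) (cvgC_cst _)).
  rewrite -vw; exact: (cvgCM (cvgC_cst _) (cvgC_sum H)).
apply: (has_cderivI (psi := fun y => limn (series (v^~ y)))).
- near=> y; have yr : normc y < r by near: y.
  have y1 : normc y < 1 by exact: lt_trans r1.
  pose D m : C := series (fun k => a k * y ^+ k : C) m - series (fun k => a k * w ^+ k : C) m.
  have H1 : D @ \oo --> (pser a y - pser a w : C).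
    exact: (cvgCB (cvg_pser ca y1) (cvg_pser ca w1)).
  have cvy : cvgn (series (v^~ y)).
    by apply: (cvg_series_normc (vb y yr)); exact: pderiv_summable.
  have H2 : (fun m => (y - w) * series (v^~ y) m) @ \oo -->
    (y - w) * limn (series (v^~ y)) by exact: (cvgCM (cvgC_cst _) cvy).
  rewrite mulrC; apply: (cvgC_unique (cvgCS H1)).
  apply: cvg_trans H2; apply: near_eq_cvg; apply: nearW => m.
  rewrite /D !series_recl /=.
  rewrite !expr0 opprD addrACA subrr add0r.
  rewrite /series/= -sumrB mulr_sumr; apply: eq_bigr => k _.
  rewrite -mulrBr subrXX /v mulrCA; congr (_ * _).
- apply: (lim_series_cvg cv _ (pderiv_summable ca r01)).
  by near=> y; apply: vb; near: y.
Unshelve. all: by end_near. Qed.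

Definition hol0 f := forall z, normc z < 1 -> derivable f z 1.

Lemma hol0_hol f : hol0 f -> hol f.
Proof. by move=> hf z /andP[_ /hf]. Qed.

Lemma hol0_pser a : pconv a -> hol0 (pser a).
Proof. by move=> ca z /(has_cderiv_pser ca) /has_cderiv_derivable[]. Qed.

Lemma pser0 a : pser a 0 = a 0%N.
Proof.
rewrite /pser; have -> : series (fun k => a k * 0 ^+ k) = (fun m => if m is 0%N then 0 else a 0%N).
  apply/funext => -[|m]; first by rewrite /series/= big_nil.
  rewrite series_recl expr0 mulr1 /series/= big1 ?addr0// => k _.
  by rewrite exprS mul0r mulr0.
apply: (cvg_lim (@cplx_hausdorff R)).
rewrite -(cvg_shiftS (fun m => if m is 0%N then 0 else a 0%N)); exact: cvgC_cst.
Qed.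

(** If [f] is [O(|z| ^ - k)] at the origin, the coefficients of index below [- k]
vanish: compute them on circles of radius tending to zero. *)
Lemma laurent_vanish f (k : nat) M e (n : int) : hol f -> 0 < e ->
  (forall z, 0 < normc z < e -> normc z < 1 -> normc (f z) * normc z ^+ k <= M) ->
  (n < - k%:Z)%R -> laurent f n = 0.
Proof.
move=> hf e0 fM nk.
have [j nE] : exists j : nat, n = - (k + j.+1)%N%:Z.
  move: nk; case: n => [i|i]; first by move=> H; exfalso; lia.
  by move=> H; exists (i - k)%N; lia.
have M0 : 0 <= M.
  pose r := Num.min (e / 2) (1 / 2).
  have r0 : 0 < r by rewrite lt_min !divr_gt0.
  have rlt : r < e by rewrite gt_min; apply/orP; left; lra.
  have r1 : r < 1 by rewrite gt_min; apply/orP; right; lra.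
  have := fM r%:C; rewrite normc_real gtr0_norm// r0 rlt => /(_ isT r1).
  by apply: le_trans; rewrite mulr_ge0 ?normc_ge0// exprn_ge0// ltW.
have bnd r : 0 < r -> r < e -> r < 1 -> normc (laurent f n) <= 2 * M * r ^+ j.+1.
  move=> r0 re r1; have r01 : 0 < r < 1 by rewrite r0.
  rewrite (laurentE _ hf r01) -mulrA /lcoef.
  apply: normc_cavg; first exact: rcont_lcoef.
  move=> t; rewrite normc_M normc_exprz normc_polar gtr0_norm// nE opprK.
  rewrite -[r ^ _]/(r ^+ _) exprD mulrA ler_wpM2r ?exprn_ge0// ?(ltW r0)//.
  by have := fM (polar r t); rewrite normc_polar gtr0_norm// r0 re => /(_ isT r1).
apply/eqP; rewrite -normc_eq0 eq_le normc_ge0 andbT.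
apply/ler_addgt0Pl => d d0; rewrite addr0.
pose r := Num.min (Num.min (e / 2) (1 / 2)) (d / (2 * M + 1)).
have M1 : 0 < 2 * M + 1 by lra.
have r0 : 0 < r by rewrite !lt_min !divr_gt0.
have rlt : r < e by rewrite !gt_min; apply/orP; left; apply/orP; left; lra.
have r1 : r < 1 by rewrite !gt_min; apply/orP; left; apply/orP; right; lra.
apply: le_trans (bnd r r0 rlt r1) _.
have rd : r <= d / (2 * M + 1) by rewrite ge_min lexx orbT.
have rr : r ^+ j.+1 <= r by rewrite exprS ler_piMr ?(ltW r0)// exprn_ile1 ?ltW.
apply: (@le_trans _ _ ((2 * M + 1) * r)).
  apply: ler_pM => //; rewrite ?exprn_ge0 ?mulr_ge0 ?(ltW r0)//; lra.
by rewrite -ler_pdivlMl// mulrC.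
Qed.

End PowerSeries.

(** * Laurent and Taylor expansions *)

Section Holomorphic.
Variable R : realType.
Local Notation C := (cplx R).
Local Notation ii := ((0 +i* 1) : C).
Implicit Types (z w : C) (r s t : R) (f g : C -> C) (n : int) (a b : nat -> C).

(** Since the coefficients below [- N] vanish, the sequence along which the series
telescopes is constant there; it tends to zero, so it is zero there. *)
Lemma laurent_series f (N : nat) w : hol f ->
  (forall n, n < - N%:Z -> laurent f n = 0) -> 0 < normc w < 1 ->
  series (fun k : nat => laurent f (k%:Z - N%:Z) * w ^ (k%:Z - N%:Z)) @ \oo --> f w.
Proof.
move=> hf f0 wd; have [g [gE g1 g2]] := laurent_telescope hf wd.
have gc (j : nat) : g (- (j + N)%N%:Z) = g (- N%:Z).
  elim: j => [|j IH]; first by rewrite add0n.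
  have := gE (- (j.+1 + N)%N%:Z).
  rewrite f0; last by lia.
  have -> : (- (j.+1 + N)%N%:Z == 0) = false by apply/negP => /eqP; lia.
  have -> : - (j.+1 + N)%N%:Z + 1 = - (j + N)%N%:Z by lia.
  by rewrite IH !mul0r add0r => /esym/eqP; rewrite subr_eq0 => /eqP.
have gN : g (- N%:Z) = 0.
  have H : (fun j : nat => g (- (j + N)%N%:Z)) @ \oo --> (0 : C).
    by rewrite (cvg_shiftn N (fun k : nat => g (- k%:Z))).
  apply: (cvgC_unique _ H).
  have -> : (fun j : nat => g (- (j + N)%N%:Z)) = (fun=> g (- N%:Z)) by apply/funext.
  exact: cvgC_cst.
pose u k := laurent f (k%:Z - N%:Z) * w ^ (k%:Z - N%:Z).
have SE m : series u m = (N < m)%N%:R * f w - g (m%:Z - N%:Z).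
  elim: m => [|m IH].
    have -> : 0%:Z - N%:Z = - N%:Z by lia.
    have -> : series u 0%N = 0 by rewrite /series/= big_geq.
    by rewrite ltn0 mul0r sub0r gN oppr0.
  have -> : series u m.+1 = series u m + u m by rewrite /series/= big_nat_recr.
  rewrite IH /u gE subr_eq0.
  have -> : m%:Z - N%:Z + 1 = m.+1%:Z - N%:Z by lia.
  have -> : (m%:Z == N%:Z) = (m == N) by [].
  have -> : (N < m.+1)%N%:R = (N < m)%N%:R + (m == N)%:R :> C.
    by rewrite -natrD ltnS leq_eqVlt eq_sym; case: ltngtP.
  ring.
rewrite -/u -(cvg_shiftn N.+1).
have -> : (fun m => series u (m + N.+1)%N) = (fun m => f w - g m.+1%:Z).
  apply/funext => m; rewrite SE; have -> : (N < m + N.+1)%N by lia.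
  by rewrite mul1r; congr (_ - g _); lia.
have H : (fun m => f w - g m.+1%:Z) @ \oo --> f w - 0.
  exact: (cvgCB (cvgC_cst _) (cvgCS g1)).
by rewrite subr0 in H.
Qed.

Lemma disk_nonempty (e : R) : 0 < e -> exists2 r, 0 < r & r < e /\ r < 1.
Proof.
move=> e0; exists (Num.min (e / 2) (1 / 2)).
  by rewrite lt_min !divr_gt0.
by split; rewrite gt_min; apply/orP; [left|right]; lra.
Qed.

Lemma cvg_eq_at0 f g : f @ (0 : C) --> f 0 -> g @ (0 : C) --> g 0 ->
  (forall z, 0 < normc z < 1 -> f z = g z) -> f 0 = g 0.
Proof.
move=> cf cg fg; apply/eqP; rewrite -subr_eq0 -normc_eq0 eq_le normc_ge0 andbT.
apply/ler_addgt0Pl => e e0; rewrite addr0.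
have e2 : 0 < e / 2 by rewrite divr_gt0.
have /nearCP[r1 r10 H1] := (cvgC_normP (FF := nbhsC_filter 0) _ _).1 cf _ e2.
have /nearCP[r2 r20 H2] := (cvgC_normP (FF := nbhsC_filter 0) _ _).1 cg _ e2.
have m0 : 0 < Num.min r1 r2 by rewrite lt_min r10.
have [r r0 [rm r1']] := disk_nonempty m0.
have nr : normc (r%:C : C) = r by rewrite normc_real gtr0_norm.
move: rm; rewrite lt_min => /andP[rr1 rr2].
have h1 : normc (f 0 - f r%:C) < e / 2 by apply: H1; rewrite subr0 nr.
have h2 : normc (g 0 - g r%:C) < e / 2 by apply: H2; rewrite subr0 nr.
have fgr : f r%:C = g r%:C by apply: fg; rewrite nr r0.
have -> : f 0 - g 0 = (f 0 - f r%:C) - (g 0 - g r%:C) by rewrite fgr; ring.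
by have := normc_D (f 0 - f r%:C) (- (g 0 - g r%:C)); rewrite normc_N; lra.
Qed.

Definition taylor f (k : nat) : C := laurent f k%:Z.

Lemma hol0_cvg f z : hol0 f -> normc z < 1 -> f @ z --> f z.
Proof. by move=> hf /hf /derivable_has_cderiv /has_cderiv_cvg. Qed.

(** Near the origin the function is bounded, so its Laurent coefficients of negative
index vanish; at the origin itself both sides are continuous. *)
Lemma hol0_taylor f : hol0 f ->
  pconv (taylor f) /\ forall z, normc z < 1 -> f z = pser (taylor f) z.
Proof.
move=> hf; have hf' := hol0_hol hf.
have n01 : normc (0 : C) < 1 by rewrite normc_0.
have cf0 := hol0_cvg hf n01.
have /nearCP[e e0 He] := (cvgC_normP (FF := nbhsC_filter 0) _ _).1 cf0 _ ltr01.
have f0 n : n < 0 -> laurent f n = 0.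
  move=> n0; apply: (@laurent_vanish R f 0 (normc (f 0) + 1) e) => //.
  move=> z /andP[z0 ze] z1; rewrite expr0 mulr1.
  have := He z; rewrite subr0 => /(_ ze).
  by have := normc_D (f z - f 0) (f 0); rewrite subrK normcBC; lra.
have ser w : 0 < normc w < 1 ->
    series (fun k => taylor f k * w ^+ k : C) @ \oo --> f w.
  move=> wd; have := laurent_series (N := 0) hf' f0 wd.
  have -> // : (fun k : nat => laurent f (k%:Z - 0) * w ^ (k%:Z - 0)) =
    (fun k => taylor f k * w ^+ k : C).
  by apply/funext => k; rewrite subr0.
have cT : pconv (taylor f).
  move=> z z1; case: (boolP (z == 0)) => [/eqP ->|z0].
    apply/cvg_ex; exists (taylor f 0).
    suff H : (fun m => series (fun k => taylor f k * 0 ^+ k : C) m.+1) @ \oo --> taylor f 0.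
      by move: H; rewrite (cvg_shiftS (series (fun k => taylor f k * 0 ^+ k : C))).
    have -> : (fun m => series (fun k => taylor f k * 0 ^+ k : C) m.+1) = (fun=> taylor f 0).
      apply/funext => m; rewrite series_recl expr0 mulr1 /series/= big1 ?addr0// => k _.
      by rewrite exprS mul0r mulr0.
    exact: cvgC_cst.
  by apply/cvg_ex; exists (f z); apply: ser; rewrite normc_gt0 z0.
have E w : 0 < normc w < 1 -> f w = pser (taylor f) w.
  by move=> wd; case/andP: (wd) => w0 w1; apply: (cvgC_unique (ser w wd)); exact: cvg_pser.
split=> // z z1; case: (boolP (z == 0)) => [/eqP ->|z0]; last first.
  by apply: E; rewrite normc_gt0 z0.
exact: (cvg_eq_at0 cf0 (hol0_cvg (hol0_pser cT) n01) E).
Qed.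

Lemma disk_ball z : 0 < normc z < 1 -> exists2 e, 0 < e &
  forall y : C, normc (y - z) < e -> 0 < normc y < 1.
Proof.
move=> /andP[z0 z1]; exists (Num.min (normc z) (1 - normc z)).
  by rewrite lt_min z0 subr_gt0.
move=> y; rewrite lt_min => /andP[h1 h2].
have := normc_D (y - z) z; rewrite subrK => h3.
by have := normc_D (z - y) y; rewrite subrK normcBC => h4; apply/andP; split; lra.
Qed.

(** The derivative of a holomorphic function is holomorphic: near each point the
function is a power series. *)
Lemma hol_derive1 f : hol f -> hol (derive1 f).
Proof.
move=> hf z0 z0d; have [e e0 He] := disk_ball z0d.
pose E : C := e%:C.
have E0 : E != 0 by rewrite -normc_eq0 normc_real gtr0_norm// gt_eqF.
have daff y c : has_cderiv (fun u : C => z0 + c * u) (0 + (0 * y + c * 1)) y.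
  exact: (has_cderivD (has_cderiv_cst z0 y)
    (has_cderivM (has_cderiv_cst c y) (has_cderiv_id y))).
have hg : hol0 (fun u => f (z0 + E * u)).
  move=> u u1.
  have ud : 0 < normc (z0 + E * u) < 1.
    apply: He; rewrite addrC addKr normc_M normc_real gtr0_norm//.
    by rewrite -[ltRHS]mulr1 ltr_pM2l.
  have H := @has_cderiv_comp R f (fun u => z0 + E * u) _ _ u (hol_has_cderiv hf ud)
    (daff u E).
  by case: (has_cderiv_derivable H).
have [ca gE] := hol0_taylor hg; set a := taylor _ in ca gE.
pose h (y : C) := E^-1 * (y - z0).
have dh y : has_cderiv h (0 * (y - z0) + E^-1 * (1 + 0)) y.
  exact: (has_cderivM (has_cderiv_cst E^-1 y)
    (has_cderivD (has_cderiv_id y) (has_cderiv_cst (- z0) y))).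
have hlt y : normc (y - z0) < e -> normc (h y) < 1.
  move=> yz; rewrite normc_M normc_V normc_real gtr0_norm//.
  by rewrite mulrC ltr_pdivrMr// mul1r.
have fE y : normc (y - z0) < e -> f y = pser a (h y).
  by move=> /hlt yz; rewrite -gE// /h mulrA divff// mul1r addrC subrK.
have df y : normc (y - z0) < e ->
    has_cderiv f (pser (pderiv a) (h y) * (0 * (y - z0) + E^-1 * (1 + 0))) y.
  move=> yz; apply: (@has_cderiv_near _ (fun y => pser a (h y))).
    have e0' : 0 < e - normc (y - z0) by rewrite subr_gt0.
    near=> x; apply/esym; apply: fE.
    have : normc (x - y) < e - normc (y - z0) by near: x; exact: nearC_ball.
    have := normc_D (x - y) (y - z0).
    by rewrite addrA subrK; lra.
  exact: (@has_cderiv_comp R (pser a) h _ _ y (has_cderiv_pser ca (hlt _ yz)) (dh y)).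
have D1 y : normc (y - z0) < e -> derive1 f y = pser (pderiv a) (h y) * E^-1.
  move=> yz; rewrite (has_cderiv_derivable (df _ yz)).2.
  by rewrite mul0r add0r addr0 mulr1.
have zz : normc (z0 - z0) < e by rewrite subrr normc_0.
have H := has_cderivM (@has_cderiv_comp R (pser (pderiv a)) h _ _ z0
  (has_cderiv_pser (pconv_pderiv ca) (hlt _ zz)) (dh z0)) (has_cderiv_cst E^-1 z0).
apply: (has_cderiv_derivable (has_cderiv_near _ H)).1.
near=> y; apply/esym; apply: D1; near: y; exact: nearC_ball.
Unshelve. all: by end_near. Qed.

Lemma has_cderiv_exprzE n z : z != 0 ->
  has_cderiv (fun y : C => y ^ n) (n%:~R * z ^ (n - 1)) z.
Proof.
move=> z0; case: n => n.
  have := has_cderivX n z; congr has_cderiv; case: n => [|n]; first by rewrite !mul0r.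
  by have -> : n.+1%:Z - 1 = n%:Z by lia.
have H : has_cderiv (fun y : C => (y^-1) ^+ n.+1)
    (n.+1%:R * (z^-1) ^+ n * - (z ^+ 2)^-1) z.
  exact: (@has_cderiv_comp R (fun y => y ^+ n.+1) (fun y => y^-1) _ _ z
    (has_cderivX n.+1 z^-1) (has_cderivV z0)).
have -> : Negz n - 1 = Negz n.+1 by lia.
have -> : (Negz n)%:~R * z ^ Negz n.+1 = n.+1%:R * (z^-1) ^+ n * - (z ^+ 2)^-1.
  rewrite NegzE mulrNz -[z ^ _]/((z ^+ n.+2)^-1).
  rewrite exprVn mulNr mulrN -mulrA -invfM -exprD.
  by rewrite ?addn2 ?add2n.
move: H; have -> // : (fun y : C => y^-1 ^+ n.+1) = (fun y : C => y ^ Negz n).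
by apply/funext => y; rewrite exprVn.
Qed.

(** The difference of the two integrands is, up to the factor [i], the derivative of
[f z * z ^ (- n)] along the circle, which has period [2 pi]. *)
Lemma laurent_derive1 f n : hol f ->
  laurent (derive1 f) (n - 1) = n%:~R * laurent f n.
Proof.
move=> hf; have hf' := hol_derive1 hf.
have r01 := @half01 R; set r : R := 2^-1 in r01.
rewrite (laurentE _ hf r01) (laurentE _ hf' r01) /lcoef.
have opE : - (n - 1) = - n + 1 by lia.
have cA := rcont_lcoef (n := - (n - 1)) hf' r01.
have cB := rcont_lcoef (n := - n) hf r01.
have cBz := rcontM (rcont_cst n%:~R) cB.
rewrite -(cavgZ _ cB); apply/eqP; rewrite -subr_eq0 -(cavgB cA cBz); apply/eqP.
have i0 : ii != 0 by rewrite -normc_eq0 normc_i oner_eq0.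
apply: (mulfI i0); rewrite mulr0 -(cavgZ _ (rcontB cA cBz)) /cavg.
rewrite (@cintegral_FTC _ _ _ (fun t => f (polar r t) * polar r t ^ (- n))).
- by rewrite polar2pi polar0 subrr mulr0.
- exact: pi2_ge0.
- move=> t _; have pd := disk_polar t r01; have p0 := neq0_disk pd.
  have H := has_rderiv_comp
    (has_cderivM (hol_has_cderiv hf pd) (has_cderiv_exprzE (- n) p0))
    (has_rderiv_polar r t).
  move: H; congr has_rderiv.
  have -> : polar r t ^ (- n) = polar r t ^ (- n - 1) * polar r t.
    by rewrite -exprz_succ// subrK.
  have -> : polar r t ^ (- (n - 1)) = polar r t ^ (- n - 1) * polar r t * polar r t.
    by rewrite -!exprz_succ// subrK opE.
  rewrite mulrNz; ring.
- by move=> t _; exact: (rcontM (rcont_cst _) (rcontB cA cBz)).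
Qed.

(** A power series converges uniformly on circles, so its coefficients are those
found by integration. *)
Lemma laurent_pser f b (N : nat) : pconv b ->
  (forall z, 0 < normc z < 1 -> f z = pser b z * z ^ (- N%:Z)) ->
  [/\ hol f, (forall k : nat, laurent f (k%:Z - N%:Z) = b k) &
    forall n, n < - N%:Z -> laurent f n = 0].
Proof.
move=> cb fE.
have hf : hol f.
  have H := holM (hol0_hol (hol0_pser cb)) (hol_exprz (- N%:Z)).
  move=> z zd; have [e e0 He] := disk_ball zd.
  apply: (has_cderiv_derivable (has_cderiv_near _ (hol_has_cderiv H zd))).1.
  near=> y; rewrite fE//; apply: He; near: y; exact: nearC_ball.
have r01 := @half01 R; set r : R := 2^-1 in r01.
case/andP: (r01) => r0 r1.
have rr : 0 <= r < 1 by rewrite ltW.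
have key n : series (fun k => b k * (r%:C ^ (k%:Z - N%:Z - n) * (k%:Z - N%:Z - n == 0)%:R))
    @ \oo --> laurent f n.
  pose u (k : nat) t := (b k * polar r t ^+ k) * polar r t ^ (- N%:Z - n).
  have cu k : rcont (u k).
    have cp (m : int) := rcont_hol (hol_exprz m) r01.
    exact: (rcontM (rcontM (rcont_cst (b k)) (cp k%:Z)) (cp (- N%:Z - n))).
  have ub k t : normc (u k t) <= (normc (b k) * r ^+ k) * r ^ (- N%:Z - n).
    by rewrite /u !normc_M normc_exprz normcX normc_polar gtr0_norm.
  have cs : cvgn (series (fun k => (normc (b k) * r ^+ k) * r ^ (- N%:Z - n))).
    have -> : series (fun k => (normc (b k) * r ^+ k) * r ^ (- N%:Z - n)) =
      (fun m => series (fun k => normc (b k) * r ^+ k) m * r ^ (- N%:Z - n)).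
      by apply/funext => m; rewrite /series/= mulr_suml.
    by apply: is_cvgMr_tmp; exact: pconv_summable.
  have := cavg_series cu ub cs.
  have -> : (fun k => cavg (u k)) =
      (fun k => b k * (r%:C ^ (k%:Z - N%:Z - n) * (k%:Z - N%:Z - n == 0)%:R)).
    apply/funext => k; rewrite -cavg_polar_exp.
    rewrite -(cavgZ _ (rcont_polar_exp _)) -cavgZ; last first.
      exact: (rcontM (rcont_cst _) (rcont_polar_exp _)).
    apply: eq_cavg => t; rewrite /u -mulrA -polar_exprz.
    have p0 := neq0_disk (disk_polar t r01).
    by rewrite -[polar r t ^+ k]/(polar r t ^ k%:Z) -expfzDr// addrA.
  have -> // : cavg (fun t => limn (series (u^~ t))) = laurent f n.
  rewrite (laurentE _ hf r01); apply: eq_cavg => t.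
  have pd := disk_polar t r01; have p0 := neq0_disk pd.
  rewrite (fE _ pd) -mulrA -expfzDr//; apply: (cvg_lim (@cplx_hausdorff R)).
  have -> : series (u^~ t) = (fun m => series (fun k => b k * polar r t ^+ k) m *
     polar r t ^ (- N%:Z - n)) by apply/funext => m; rewrite /series/= mulr_suml.
  by case/andP: pd => _ p1; exact: (cvgCM (cvg_pser cb p1) (cvgC_cst _)).
split=> // [k|n nN].
  apply: (cvgC_unique (key _)).
  rewrite -(cvg_shiftn k.+1).
  have -> : (fun m => series (fun j : nat => b j * (r%:C ^ (j%:Z - N%:Z - (k%:Z - N%:Z)) *
     (j%:Z - N%:Z - (k%:Z - N%:Z) == 0)%:R)) (m + k.+1)%N) = (fun=> b k).
    apply/funext => m; rewrite /series/= big_mkord.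
    have km : (k < m + k.+1)%N by lia.
    rewrite (bigD1 (Ordinal km))//= subrr eqxx expr0z !mulr1 big1 ?addr0//.
    move=> j jk; have -> : (j%:Z - N%:Z - (k%:Z - N%:Z) == 0) = false.
      apply/negP => /eqP jk0; move/negP: jk; apply; apply/eqP/val_inj => /=; lia.
    by rewrite !mulr0.
  exact: cvgC_cst.
apply: (cvgC_unique (key n)).
have -> : series (fun k => b k * (r%:C ^ (k%:Z - N%:Z - n) * (k%:Z - N%:Z - n == 0)%:R)) =
   (fun=> 0).
  apply/funext => m; rewrite /series/= big1// => k _.
  have -> : (k%:Z - N%:Z - n == 0) = false by apply/negP => /eqP; lia.
  by rewrite !mulr0.
exact: cvgC_cst.
Unshelve. all: by end_near. Qed.

End Holomorphic.

(** * Poisson's formula *)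

Section Poisson.
Variable R : realType.
Local Notation C := (cplx R).
Local Notation Re := (@complex.Re R).
Local Notation Im := (@complex.Im R).
Local Notation mu := (@lebesgue_measure R).
Implicit Types (z w : C) (r s t : R) (f g : C -> C) (n : int).

Lemma realC_M r s : (r * s)%:C = r%:C * s%:C :> C. Proof. exact: rmorphM. Qed.
Lemma realC_B r s : (r - s)%:C = r%:C - s%:C :> C. Proof. exact: rmorphB. Qed.
Lemma realC_V r : (r^-1)%:C = (r%:C)^-1 :> C. Proof. exact: fmorphV. Qed.

Lemma cvg_geomC z : normc z < 1 -> series (fun k => z ^+ k : C) @ \oo --> (1 - z)^-1.
Proof.
move=> z1; have z0 : 1 - z != 0.
  by apply/negP => /eqP/subr0_eq E; move: z1; rewrite -E normc_1 ltxx.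
have -> : series (fun k => z ^+ k : C) = (fun m => (1 - z ^+ m) * (1 - z)^-1).
  apply/funext => m; apply: (mulIf z0); rewrite -mulrA mulVf// mulr1.
  rewrite /series/= big_mkord mulrC -[1 in RHS](expr1n _ m) subrXX.
  by congr (_ * _); apply: eq_bigr => i _; rewrite expr1n mul1r.
have H : (fun m => z ^+ m) @ \oo --> (0 : C).
  apply/cvgC0P; have -> : (fun m => normc (z ^+ m)) = (fun m => normc z ^+ m).
    by apply/funext => m; rewrite normcX.
  by apply: cvg_expr; rewrite ger0_norm ?normc_ge0.
have L : (fun m => (1 - z ^+ m) * (1 - z)^-1) @ \oo --> ((1 - 0) * (1 - z)^-1 : C).
  exact: (cvgCM (cvgCB (cvgC_cst 1) H) (cvgC_cst (1 - z)^-1)).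
by rewrite subr0 mul1r in L.
Qed.

(** The Poisson kernel of the disk. *)
Definition pois r s : R := (1 - r ^+ 2) / (1 - 2 * r * cos s + r ^+ 2).

Lemma pois_denom r s : 1 - 2 * r * cos s + r ^+ 2 = normc (1 - polar r s) ^+ 2.
Proof.
rewrite normc_sqrE cReD cImD cReN cImN /polar /=.
have -> : (0 - r * sin s) ^+ 2 = r ^+ 2 * sin s ^+ 2 by ring.
by rewrite sin2cos2; ring.
Qed.

Lemma polar_lt1 r s : 0 <= r < 1 -> normc (polar r s) < 1.
Proof. by move=> /andP[r0 r1]; rewrite normc_polar ger0_norm. Qed.

Lemma subr_neq0_lt1 z : normc z < 1 -> 1 - z != 0.
Proof.
by move=> z1; apply/negP => /eqP/subr0_eq E; move: z1; rewrite -E normc_1 ltxx.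
Qed.

Lemma poisE r s : 0 <= r < 1 ->
  (pois r s)%:C = (1 - polar r (- s))^-1 + polar r s * (1 - polar r s)^-1 :> C.
Proof.
move=> r01; have a0 := subr_neq0_lt1 (polar_lt1 s r01).
have b0 := subr_neq0_lt1 (polar_lt1 (- s) r01).
have ab : (1 - polar r (- s)) * (1 - polar r s) = (1 - 2 * r * cos s + r ^+ 2)%:C :> C.
  rewrite pois_denom -mul_conjc mulrC conjc_B conjc_polar; congr (_ * (_ - _)).
  by rewrite -[1]/(1%:C) conjc_R.
have pp : polar r (- s) * polar r s = (r ^+ 2)%:C :> C.
  by rewrite polarM addNr polar0 expr2.
rewrite /pois realC_M realC_V realC_B -ab -pp -[1%:C]/(1 : C).
by field; rewrite a0 b0.
Qed.

Lemma hol0_laurent_neg g n : hol0 g -> n < 0 -> laurent g n = 0.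
Proof.
move=> hg n0; have [ca gE] := hol0_taylor hg.
have H z : 0 < normc z < 1 -> g z = pser (taylor g) z * z ^ (- 0%:Z).
  by move=> /andP[_ z1]; rewrite expr0z mulr1 gE.
have [_ _ E] := laurent_pser ca H.
by apply: E; rewrite oppr0.
Qed.

Lemma hol0_bounded g r : hol0 g -> 0 <= r < 1 ->
  exists M, forall t, normc (g (polar r t)) <= M.
Proof.
move=> hg r01; have [ca gE] := hol0_taylor hg.
exists (limn (series (fun k => normc (taylor g k) * r ^+ k))) => t.
rewrite gE ?polar_lt1// /pser.
have := @normc_series_tail R (fun k => taylor g k * polar r t ^+ k) _ 0 _
  (pconv_summable ca r01).
have s0 (V : zmodType) (u : nat -> V) : series u 0%N = 0 by rewrite /series/= big_geq.
rewrite !s0 !subr0; apply => k.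
by rewrite normc_M normcX normc_polar ger0_norm//; case/andP: r01.
Qed.

Lemma rcont_hol0 g r : hol0 g -> 0 <= r < 1 -> rcont (fun t => g (polar r t)).
Proof.
move=> hg r01 t.
exact: (cvg_comp _ _ (cvg_polar r t) (hol0_cvg hg (polar_lt1 t r01))).
Qed.

(** Poisson's formula, at the point [r rho exp (i th)] from the circle of radius
[rho]. The kernel is a sum of two geometric series; the first one reproduces the
Taylor series and the second one only meets coefficients of negative index. *)
Lemma poisson_formula g rho r th : hol0 g -> 0 < rho < 1 -> 0 <= r < 1 ->
  g (polar (r * rho) th) =
  cavg (fun t => g (polar rho t) * (pois r (t - th))%:C).
Proof.
move=> hg rho01 r01; have [ca gE] := hol0_taylor hg.
case/andP: (rho01) => rho0 rho1; case/andP: (r01) => r0 r1.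
have rho01' : 0 <= rho < 1 by rewrite ltW.
have [M HM] := hol0_bounded hg rho01'.
have cg := rcont_hol0 hg rho01'.
have lc n : cavg (fun t => g (polar rho t) * polar 1 t ^ (- n)) =
    rho%:C ^ n * laurent g n.
  rewrite (laurentE _ (hol0_hol hg) rho01) /lcoef -cavgZ; last first.
    exact: (rcont_lcoef (n := - n) (hol0_hol hg) rho01).
  have rn : rho%:C ^ n * rho%:C ^ (- n) = 1 :> C.
    rewrite -expfzDr ?addrN ?expr0z//.
    by rewrite -normc_eq0 normc_real normr_eq0 gt_eqF.
  apply: eq_cavg => t.
  by rewrite (polar_exprz rho) mulrCA (mulrA (rho%:C ^ n)) rn mul1r.
have geoM : cvgn (series (fun k => M * r ^+ k)).
  by apply: is_cvg_geometric_series; rewrite ger0_norm.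
pose b t := polar r (- (t - th)) : C.
pose a t := polar r (t - th) : C.
have bE t : b t = polar r th * polar 1 t ^ (-1).
  rewrite -[_ ^ (-1)]/((polar 1 t)^-1) -conjc_polar1 conjc_polar polarM mulr1 /b.
  by rewrite opprB.
have aE t : a t = polar r (- th) * polar 1 t.
  by rewrite polarM mulr1 /a addrC.
have ca' : rcont a.
  have -> : a = (fun t => polar r (- th) * polar 1 t) by apply/funext.
  exact: (rcontM (rcont_cst _) (rcont_polar 1)).
have cb' : rcont b.
  have -> : b = (fun t => polar r th * polar 1 t ^ (-1)) by apply/funext.
  exact: (rcontM (rcont_cst _) (rcont_polar_exp _)).
have cX (h : R -> C) k : rcont h -> rcont (fun t => h t ^+ k).
  by move=> ch t; exact: (cvgCX (n := k) (ch t)).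
have nb t : normc (b t) = r by rewrite normc_polar ger0_norm.
have na t : normc (a t) = r by rewrite normc_polar ger0_norm.
have P1 := @cavg_series R (fun k t => g (polar rho t) * b t ^+ k) _
  (fun k => rcontM cg (cX _ k cb')) _ geoM.
have P2 := @cavg_series R (fun k t => g (polar rho t) * (a t * a t ^+ k)) _
  (fun k => rcontM cg (rcontM ca' (cX _ k ca'))) _ geoM.
have {}P1 : series (fun k => taylor g k * polar (r * rho) th ^+ k) @ \oo -->
    cavg (fun t => g (polar rho t) * (1 - b t)^-1).
  have H : forall k t, normc (g (polar rho t) * b t ^+ k) <= M * r ^+ k.
    by move=> k t; rewrite normc_M normcX nb ler_wpM2r ?exprn_ge0.
  move: (P1 H).
  have -> : (fun k => cavg (fun t => g (polar rho t) * b t ^+ k)) =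
      (fun k => taylor g k * polar (r * rho) th ^+ k).
    apply/funext => k.
    have -> : polar (r * rho) th = rho%:C * polar r th :> C.
      by rewrite polarE [in RHS]polarE realC_M; ring.
    have E t : g (polar rho t) * b t ^+ k =
        polar r th ^+ k * (g (polar rho t) * polar 1 t ^ (- k%:Z)).
      by rewrite bE exprMn -[polar 1 t ^ (-1)]/((polar 1 t)^-1) exprVn exprnN mulrCA.
    rewrite (eq_cavg E) cavgZ ?lc; last exact: (rcontM cg (rcont_polar_exp _)).
    rewrite exprMn -[rho%:C ^ k%:Z]/(rho%:C ^+ k) -[laurent g k%:Z]/(taylor g k); ring.
  have -> // : (fun t => limn (series ((fun k t => g (polar rho t) * b t ^+ k)^~ t))) =
     (fun t => g (polar rho t) * (1 - b t)^-1).
  apply/funext => t; apply: (cvg_lim (@cplx_hausdorff R)).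
  have -> : series (fun k => g (polar rho t) * b t ^+ k) =
      (fun m => g (polar rho t) * series (fun k => b t ^+ k) m).
    by apply/funext => m; rewrite /series/= mulr_sumr.
  by apply: (cvgCM (cvgC_cst _)); apply: cvg_geomC; rewrite nb.
have {}P2 : cavg (fun t => g (polar rho t) * (a t * (1 - a t)^-1)) = 0.
  have H : forall k t, normc (g (polar rho t) * (a t * a t ^+ k)) <= M * r ^+ k.
    move=> k t; rewrite !normc_M normcX na ler_pM ?normc_ge0//.
      by rewrite mulr_ge0// exprn_ge0.
    by rewrite ler_piMl ?exprn_ge0// ltW.
  apply: (cvgC_unique _ (cvgC_cst (T := nat) (F := \oo) 0)).
  move: (P2 H).
  have -> : series (fun k => cavg (fun t => g (polar rho t) * (a t * a t ^+ k))) =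
      (fun=> 0).
    apply/funext => m; rewrite /series/= big1// => k _.
    have E t : g (polar rho t) * (a t * a t ^+ k) =
        polar r (- th) ^+ k.+1 * (g (polar rho t) * polar 1 t ^ (- (- k.+1%:Z))).
      by rewrite -exprS aE exprMn opprK -[polar 1 t ^ k.+1%:Z]/(polar 1 t ^+ k.+1) mulrCA.
    rewrite (eq_cavg E) cavgZ ?lc; last exact: (rcontM cg (rcont_polar_exp _)).
    by rewrite hol0_laurent_neg// !mulr0.
  have -> : (fun t => limn (series ((fun k t => g (polar rho t) * (a t * a t ^+ k))^~ t))) =
     (fun t => g (polar rho t) * (a t * (1 - a t)^-1)).
    apply/funext => t; apply: (cvg_lim (@cplx_hausdorff R)).
    have -> : series (fun k => g (polar rho t) * (a t * a t ^+ k)) =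
        (fun m => g (polar rho t) * (a t * series (fun k => a t ^+ k) m)).
      by apply/funext => m; rewrite /series/= !mulr_sumr.
    have h1 : normc (a t) < 1 by rewrite na.
    exact: (cvgCM (cvgC_cst _) (cvgCM (cvgC_cst _) (cvg_geomC h1))).
  by move=> L; exact: L.
have rw1 : normc (polar (r * rho) th : C) < 1.
  rewrite normc_polar ger0_norm ?mulr_ge0// ?(ltW rho0)//.
  by rewrite mulr_ilt1// ltW.
have P1' := cvgC_unique P1 (cvg_pser ca rw1).
rewrite (gE _ rw1) -P1'.
have V (h : R -> C) : (forall t, normc (h t) < 1) -> rcont h ->
    rcont (fun t => (1 - h t)^-1).
  move=> h1 ch t.
  exact: (cvgCV (subr_neq0_lt1 (h1 t)) (cvgCB (cvgC_cst 1) (ch t))).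
have nb1 t : normc (b t) < 1 by rewrite nb.
have na1 t : normc (a t) < 1 by rewrite na.
rewrite -[LHS]addr0 -P2 -cavgD.
- by apply: eq_cavg => t; rewrite poisE// mulrDr.
- exact: (rcontM cg (V _ nb1 cb')).
- exact: (rcontM cg (rcontM ca' (V _ na1 ca'))).
Qed.

End Poisson.

(** * Domination of radial values by the maximal function *)

Section Maximal.
Variable R : realType.
Local Notation C := (cplx R).
Local Notation Re := (@complex.Re R).
Local Notation Im := (@complex.Im R).
Local Notation mu := (@lebesgue_measure R).
Implicit Types (z w : C) (r s t : R) (f g : C -> C) (n : int).

(** By the mean value theorem where the cosine is at least [1 / 4]; elsewhere the sine
is close to [1], and [x <= 2]. *)
Lemma sin_ge_quarter (x : R) : 0 <= x <= pi / 2 -> x / 4 <= sin x.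
Proof.
move=> /andP[x0 x2]; move: (@pihalf_02_cos_pihalf R) => [/andP[_ p2] _].
have c0 : 0 <= cos x by apply: cos_ge0_pihalf; rewrite x2 andbT (le_trans _ x0)// oppr_le0 (le_trans x0).
have [c4|c4] := leP (1 / 4) (cos x); last first.
  have s0 : 0 <= sin x by apply: sin_ge0_pi; rewrite x0/=; nra.
  have E := cos2Dsin2 x; have c1 : cos x ^+ 2 <= 1/16 by nra.
  have : (1/2) ^+ 2 <= sin x ^+ 2 by nra.
  by rewrite ler_sqr ?nnegrE//; lra.
move: x0; rewrite le_eqVlt => /orP[/eqP <-|x0]; first by rewrite mul0r sin0.
have [y /[!in_itv]/= /andP[y0 yx]] := @MVT R sin cos 0 x x0
  (fun y _ => is_derive_sin y) (continuous_subspaceT (@continuous_sin R)).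
rewrite sin0 !subr0 => ->; rewrite mulrC ler_pM2r//.
have : cos x <= cos y.
  have xI : x \in `[0, pi] by rewrite in_itv/=; apply/andP; split; nra.
  have yI : y \in `[0, pi] by rewrite in_itv/=; apply/andP; split; nra.
  by rewrite ltW// ltr_cos.
by move=> cxy; lra.
Qed.

Lemma cos_gap_pi s : `|s| <= pi -> s ^+ 2 / 32 <= 1 - cos s.
Proof.
move=> sp; have -> : cos s = cos (`|s| / 2 + `|s| / 2).
  by rewrite -splitr cos_norm.
rewrite cosD -!expr2; have := cos2Dsin2 (`|s| / 2).
have : `|s| / 2 / 4 <= sin (`|s| / 2).
  by apply: sin_ge_quarter; rewrite divr_ge0//= ler_pM2r.
have := normr_ge0 s; rewrite -[s ^+ 2]real_normK ?num_real//.
set a := `|s|; set b := sin _; nra.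
Qed.

(** The angle between two points of the arc [[e, 2 pi - e]] of the circle stays at
distance [e] from a full turn, which makes the chord comparable to the difference
of the arguments. *)
Lemma cos_gap e s : 0 < e <= 1 -> `|s| <= 2 * pi - e ->
  e ^+ 2 / (32 * 64) * s ^+ 2 <= 1 - cos s.
Proof.
move=> /andP[e0 e1] se; move: (@pihalf_02_cos_pihalf R) => [/andP[_ p2] _].
have s8 : `|s| <= 8 by lra.
rewrite -[s ^+ 2]real_normK ?num_real//.
have [sp|sp] := leP `|s| pi.
  apply: le_trans (cos_gap_pi sp); rewrite -[s ^+ 2]real_normK ?num_real//.
  have : e ^+ 2 <= 1 by rewrite expr_le1// ltW.
  have := sqr_ge0 `|s|; set b := _ ^+ 2; set c := e ^+ 2 => b0 c1; nra.
have -> : cos s = cos (2 * pi - `|s|).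
  rewrite cosB mulr_natl cos2pi sin2pi mul1r mul0r addr0.
  by rewrite cos_norm.
have H : e <= 2 * pi - `|s| by lra.
apply: le_trans (cos_gap_pi _); last by rewrite ger0_norm; lra.
have : e ^+ 2 <= (2 * pi - `|s|) ^+ 2 by rewrite ler_sqr ?nnegrE; lra.
have : `|s| ^+ 2 <= 64 by have := normr_ge0 s; nra.
have := sqr_ge0 `|s|; have := sqr_ge0 e; set b := _ ^+ 2; set c := _ ^+ 2; set d := _ ^+ 2.
nra.
Qed.

Lemma pois_denomE r s :
  1 - 2 * r * cos s + r ^+ 2 = (1 - r) ^+ 2 + 2 * r * (1 - cos s).
Proof. by ring. Qed.

Lemma pois_denom_gt0 r s : 0 <= r < 1 -> (1 - r) ^+ 2 <= 1 - 2 * r * cos s + r ^+ 2.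
Proof.
move=> /andP[r0 r1]; rewrite pois_denomE lerDl; apply: mulr_ge0; first lra.
by rewrite subr_ge0 cos_le1.
Qed.

Lemma pois_ge0 r s : 0 <= r < 1 -> 0 <= pois r s.
Proof.
move=> r01; have := pois_denom_gt0 s r01; case/andP: r01 => r0 r1 D.
by rewrite divr_ge0//; [nra|apply: le_trans D; exact: sqr_ge0].
Qed.

(** The Poisson kernel is dominated by a sum of multiples of indicators of
dyadic neighbourhoods of its peak; the averages of a function on these are what
the maximal function controls. *)
Lemma pois_majorant (c : R) r s K : 0 < c <= 1 -> 1 / 2 <= r < 1 ->
  c * s ^+ 2 <= 1 - cos s -> `|s| < 2 ^+ K * (1 - r) ->
  pois r s <= \sum_(k < K.+1)
    8 / c / (4 ^+ k * (1 - r)) * (`|s| < 2 ^+ k * (1 - r))%R%:R.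
Proof.
move=> /andP[c0 c1] /andP[r2 r1] cs.
have r01 : 0 <= r < 1 by apply/andP; split; lra.
have d0 : 0 < 1 - r by lra.
have D2 := pois_denom_gt0 s r01.
have D0 : 0 < 1 - 2 * r * cos s + r ^+ 2 by apply: lt_le_trans D2; rewrite exprn_gt0.
have Dc : c * s ^+ 2 <= 1 - 2 * r * cos s + r ^+ 2.
  rewrite pois_denomE (le_trans cs)// ler_wpDl ?sqr_ge0// ler_peMl ?subr_ge0 ?cos_le1//.
  lra.
elim: K => [|K IH] sK.
  rewrite big_ord_recl big_ord0 addr0 !expr0 !mul1r in sK *.
  have c8 : 8 <= 8 / c by rewrite ler_peMr// invf_ge1.
  rewrite sK mulr1 /pois ler_pdivrMr//; apply: le_trans (ler_wpM2l _ D2); last first.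
    by rewrite !mulr_ge0 ?invr_ge0// ltW.
  rewrite (_ : _ / (1 - r) * _ = 8 / c * (1 - r)); first by nra.
  by field; rewrite !gt_eqF.
have [sK'|sK'] := ltP `|s| (2 ^+ K * (1 - r)).
  rewrite big_ord_recr/=; apply: le_trans (IH sK') _; rewrite lerDl.
  by rewrite !mulr_ge0 ?invr_ge0 ?mulr_ge0 ?exprn_ge0// ltW.
rewrite big_ord_recr/= sK mulr1; apply: ler_wpDl.
  apply: sumr_ge0 => i _.
  by rewrite !mulr_ge0 ?invr_ge0 ?mulr_ge0 ?exprn_ge0// ltW.
have E : (4 : R) ^+ K = (2 ^+ K) ^+ 2 by rewrite exprAC; congr (_ ^+ _); rewrite -natrX.
rewrite /pois ler_pdivrMr// [4 ^+ _]exprS E.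
set q := 2 ^+ K in sK' *; have q0 : 0 < q by rewrite exprn_gt0.
have sq : (q * (1 - r)) ^+ 2 <= s ^+ 2.
  by rewrite -[s ^+ 2]real_normK ?num_real// ler_sqr ?nnegrE// mulr_ge0// ltW.
have H : c * (q * (1 - r)) ^+ 2 <= 1 - 2 * r * cos s + r ^+ 2.
  by apply: le_trans Dc; rewrite ler_pM2l.
apply: le_trans (ler_wpM2l _ H); last first.
  by rewrite !mulr_ge0 ?invr_ge0 ?mulr_ge0 ?sqr_ge0// ltW.
have -> : 8 / c / (4 * q ^+ 2 * (1 - r)) * (c * (q * (1 - r)) ^+ 2) = 2 * (1 - r).
  by field; rewrite !gt_eqF.
nra.
Qed.

Definition circle_mod g rho : R -> R :=
  (fun t => normc (g (polar rho t))) \_ `[0, 2 * pi].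

Lemma circle_mod_ge0 g rho t : 0 <= circle_mod g rho t.
Proof. by rewrite /circle_mod /patch; case: ifP => // _; exact: normc_ge0. Qed.

Lemma rcont_normc (F : R -> C) : rcont F -> forall t, normc (F s) @[s --> t] --> normc (F t).
Proof. by move=> cF t; exact: (cvg_normc (cF t)). Qed.

Lemma integrable_circle_mod g rho : hol0 g -> 0 <= rho < 1 ->
  mu.-integrable `[0, 2 * pi] (EFin \o (fun t => normc (g (polar rho t)))).
Proof.
by move=> hg r1; apply: integrable_segment => t _; exact: (rcont_normc (rcont_hol0 hg r1)).
Qed.

Lemma HL_maximal_ball g rho (th c r : R) : 0 < r ->
  (HL_maximal (circle_mod g rho) th <= c%:E)%E ->
  (\int[mu]_(t in ball th r) (circle_mod g rho t)%:E <= (c * (2 * r))%:E)%E.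
Proof.
move=> r0 H.
have /le_trans/(_ H) : (iavg (circle_mod g rho) (ball th r) <= HL_maximal (circle_mod g rho) th)%E.
  by apply: ereal_sup_ubound; exists r => //=; rewrite in_itv/= r0.
rewrite /iavg (lebesgue_measure_ball _ (ltW r0)) inver mulrn_eq0/= gt_eqF//.
have -> : (\int[mu]_(y in ball th r) `|circle_mod g rho y|%:E =
    \int[mu]_(y in ball th r) (circle_mod g rho y)%:E)%E.
  by apply: eq_integral => t _; rewrite ger0_norm// circle_mod_ge0.
rewrite muleC lee_pdivrMr ?mulrn_wgt0// -EFinM.
by rewrite -[r *+ 2]mulr_natl.
Qed.

Lemma cvg_pois r th t : 0 <= r < 1 -> pois r (s - th) @[s --> t] --> pois r (t - th).
Proof.
move=> r01; have D2 := pois_denom_gt0 (t - th) r01; case/andP: r01 => r0 r1.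
have D0 : 1 - 2 * r * cos (t - th) + r ^+ 2 != 0.
  by rewrite gt_eqF// (lt_le_trans _ D2)// exprn_gt0// subr_gt0.
have h1 : cos (s - th) @[s --> t] --> cos (t - th).
  exact: (cvg_comp _ _ (cvgB cvg_id (cvg_cst _)) (@continuous_cos R _)).
exact: (cvgM (cvg_cst _) (cvgV D0 (cvgD (cvgB (cvg_cst _) (cvgM (cvg_cst _) h1)) (cvg_cst _)))).
Qed.

(** Sum the bounds on the averages over the dyadic neighbourhoods of length
[2 ^ k (1 - r)]: their weights decrease geometrically in [k]. *)
Lemma poisson_maximal g rho r th (c e : R) : hol0 g -> 0 < rho < 1 -> 1 / 2 <= r < 1 ->
  0 < e <= 1 -> (forall t, t \in `[0, 2 * pi] -> e * (t - th) ^+ 2 <= 1 - cos (t - th)) ->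
  0 <= c -> (HL_maximal (circle_mod g rho) th <= c%:E)%E ->
  normc (g (polar (r * rho) th)) <= 32 / e * c.
Proof.
move=> hg rho01 r21 e01 he c0 H; case/andP: (r21) => r2 r1; case/andP: (e01) => e0 e1.
have r01 : 0 <= r < 1 by apply/andP; split; lra.
have rho01' : 0 <= rho < 1 by case/andP: rho01 => /ltW ->.
have d0 : 0 < 1 - r by lra.
rewrite poisson_formula// /cavg.
set S := `[0, 2 * pi]%classic.
pose v : R -> R := fun t => normc (g (polar rho t)).
have vE t : S t -> circle_mod g rho t = v t by move=> St; rewrite /circle_mod patchE mem_set.
have v0 t : 0 <= v t by exact: normc_ge0.
pose F t := g (polar rho t) * (pois r (t - th))%:C.
have cF : rcont F.
  apply: rcontM; first exact: rcont_hol0.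
  by move=> t; exact: (cvgC_real (@cvg_pois r th t r01)).
have vS t : t \in S -> normc (F t) = v t * pois r (t - th).
  by move=> _; rewrite /F normc_M normc_real ger0_norm// pois_ge0.
have mS : measurable (S : set (measurableTypeR R)) by exact: measurable_itv.
have cvF t : (v s * pois r (s - th)) @[s --> t] --> v t * pois r (t - th).
  exact: (cvgM (@rcont_normc _ (rcont_hol0 hg rho01') t) (@cvg_pois r th t r01)).
have iF : mu.-integrable S (EFin \o (fun t => v t * pois r (t - th))).
  by apply: integrable_segment => t _.
have [K HK] : exists K, forall t, S t -> `|t - th| < 2 ^+ K * (1 - r).
  pose N := Num.bound ((2 * pi + `|th|) / (1 - r)).
  exists N => t; rewrite /S/= in_itv/= => /andP[t0 t2].
  rewrite -ltr_pdivrMr//; apply: (@lt_le_trans _ _ N%:R); last first.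
    by rewrite -natrX ler_nat ltnW// ltn_expl.
  apply: le_lt_trans (archi_boundP _); last first.
    by apply: divr_ge0; [apply: addr_ge0 => //; exact: pi2_ge0|exact: ltW].
  rewrite ler_pM2r ?invr_gt0//; apply: le_trans (ler_normB _ _) _.
  by rewrite lerD2r ger0_norm.
suff B : \int[mu]_(t in S) (v t * pois r (t - th)) <= 32 / e * c.
  rewrite normc_M normc_real ger0_norm ?invr_ge0 ?pi2_ge0//.
  rewrite ler_pdivrMl ?pi2_gt0//.
  apply: le_trans (normc_cintegral_le mS _ iF _) _.
  - exact: rcont_cintegrable.
  - by move=> t St; rewrite vS// inE.
  rewrite -[leRHS]mulrA ler_pM2l//; apply: le_trans B _.
  rewrite ler_peMl//; first by rewrite mulr_ge0// divr_ge0// ltW.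
  by rewrite (le_trans _ (pi_ge2 R))// ler1n.
have Bk k : (\int[mu]_(t in S) (v t * (`|(t - th)%R| < 2 ^+ k * (1 - r))%R%:R)%:E <=
    (c * (2 * (2 ^+ k * (1 - r))))%:E)%E.
  have -> : (\int[mu]_(t in S) (v t * (`|(t - th)%R| < 2 ^+ k * (1 - r))%R%:R)%:E =
     \int[mu]_(t in ball th (2 ^+ k * (1 - r))) (circle_mod g rho t)%:E)%E.
    rewrite [LHS]integral_mkcond [RHS]integral_mkcond; apply: eq_integral => t _.
    have Eb : (t \in (ball th (2 ^+ k * (1 - r)) : set R)) = (`|t - th| < 2 ^+ k * (1 - r)).
      by rewrite distrC; apply/idP/idP => [/set_mem|H'] //; exact: mem_set.
    rewrite !patchE Eb /circle_mod patchE -/S -/(v t).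
    by case: ifP => _; case: ifP => _ //=; rewrite ?mulr1 ?mulr0.
  by apply: HL_maximal_ball H; rewrite mulr_gt0// exprn_gt0.
have mi k : measurable_fun (S : set (measurableTypeR R))
    (EFin \o (fun t : R => v t * (`|(t - th)%R| < 2 ^+ k * (1 - r))%R%:R)).
  apply/measurable_EFinP; apply: measurable_funTS; apply: measurable_funM.
    by apply: continuous_measurable_fun; exact: rcont_normc (rcont_hol0 hg rho01').
  have -> : (fun t : R => (`|(t - th)%R| < 2 ^+ k * (1 - r))%R%:R) =
      \1_(ball th (2 ^+ k * (1 - r)) : set (measurableTypeR R)) :> (R -> R).
    apply/funext => t; rewrite indicE distrC; congr (nat_of_bool _)%:R.
    by apply/idP/idP => [H'|/set_mem] //; exact: mem_set.
  by apply: measurable_indic; exact: measurable_ball.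
rewrite -lee_fin /Rintegral fineK; last exact: integrable_fin_num.
apply: (@le_trans _ _ (\int[mu]_(t in S) (\sum_(k < K.+1)
   ((8 / e / (4 ^+ k * (1 - r)))%:E *
   (v t * (`|(t - th)%R| < 2 ^+ k * (1 - r))%R%:R)%:E)))%E).
  apply: ge0_le_integral => //.
  - by move=> t _; rewrite lee_fin mulr_ge0// pois_ge0.
  - by case/integrableP : iF.
  - by apply: emeasurable_fun_sum => k; exact: (measurable_funeM _ (mi k)).
  - move=> t St; under eq_bigr do rewrite -EFinM.
    rewrite sumEFin lee_fin; under eq_bigr do rewrite mulrCA.
    rewrite -mulr_sumr ler_wpM2l//; apply: pois_majorant => //; last exact: HK.
    by apply: he; move: St; rewrite /S/= in_itv.
rewrite ge0_integral_sum//; last 2 first.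
- by move=> k; exact: (measurable_funeM _ (mi k)).
- move=> k t _; rewrite lee_fin !mulr_ge0 ?invr_ge0 ?mulr_ge0 ?exprn_ge0//; exact: ltW.
apply: (@le_trans _ _ (\sum_(k < K.+1) (16 / e * c * (2^-1) ^+ k)%:E)%E).
  apply: lee_sum => k _.
  have a0 : 0 <= 8 / e / (4 ^+ k * (1 - r)).
    by rewrite !mulr_ge0 ?invr_ge0 ?mulr_ge0 ?exprn_ge0//; exact: ltW.
  have v1 t : S t -> (0 <= (v t * (`|(t - th)%R| < 2 ^+ k * (1 - r))%R%:R)%:E)%E.
    by move=> _; rewrite lee_fin mulr_ge0.
  rewrite (ge0_integralZl_EFin mu mS v1 (mi k) a0).
  apply: le_trans (lee_wpmul2l _ (Bk k)) _; first by rewrite lee_fin.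
  rewrite -EFinM lee_fin le_eqVlt; apply/orP; left; apply/eqP.
  have -> : (4 : R) ^+ k = (2 ^+ k) ^+ 2 by rewrite exprAC; congr (_ ^+ _); rewrite -natrX.
  rewrite exprVn; have : (2 : R) ^+ k != 0 by rewrite expf_neq0.
  by move=> q0; field; rewrite q0 !gt_eqF.
rewrite sumEFin lee_fin -mulr_sumr.
have -> : 32 / e * c = 16 / e * c * 2 by field; rewrite gt_eqF.
apply: ler_wpM2l; first by rewrite !mulr_ge0 ?invr_ge0// ltW.
have E := subrXX (1 : R) 2^-1 K.+1.
have Es : \sum_(k < K.+1) (2 : R)^-1 ^+ k = 2 * (1 - 2^-1 ^+ K.+1).
  rewrite -[X in X - _](expr1n _ K.+1) E.
  under [in RHS]eq_bigr do rewrite expr1n mul1r.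
  by rewrite mulrA (_ : 2 * (1 - 2^-1) = 1 :> R) ?mul1r//; field.
rewrite Es; have : 0 <= (2 : R)^-1 ^+ K.+1 by exact: exprn_ge0.
by set q := _ ^+ _; lra.
Qed.

Definition large_radial g (e l rho : R) : set R :=
  [set th | e <= th <= 2 * pi - e /\
    exists2 s : R, 1 / 2 <= s < rho & l < normc (g (polar s th))].

(** The union over the uncountably many radii is an open set. *)
Lemma measurable_large_radial g (e l rho : R) : hol0 g -> rho <= 1 ->
  measurable (large_radial g e l rho : set (measurableTypeR R)).
Proof.
move=> hg rho1.
have -> : large_radial g e l rho = `[e, 2 * pi - e]%classic `&`
    \bigcup_(s in `[1 / 2, rho[%classic) ((fun t => normc (g (polar s t))) @^-1` [set x | l < x]).
  apply/seteqP; split => th /=; rewrite in_itv/=.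
    by move=> [-> [s sr H]]; split => //; exists s => //=; rewrite in_itv.
  by move=> [th2 [s /= /[!in_itv]/= sr H]]; split => //; exists s.
apply: measurableI; first exact: measurable_itv.
apply: open_measurable; apply: bigcup_open => s /= /[!in_itv]/= /andP[s2 sr].
apply: open_comp; last exact: open_gt.
move=> t _; apply: rcont_normc; apply: rcont_hol0 => //.
by apply/andP; split; [exact: le_trans s2|exact: lt_le_trans sr rho1].
Qed.

(** The Hardy-Littlewood inequality turns the bound by the maximal function into
a weak-type bound, on an arc away from the branch point [1] of the angle. *)
Lemma weak_type_radius g rho (e l : R) : hol0 g -> 0 < rho < 1 -> 0 < e <= 1 -> 0 < l ->
  (mu (large_radial g e l rho) <= (3 * (32 / (e ^+ 2 / (32 * 64))) / l)%:E *
   \int[mu]_(t in `[0%R, (2 * pi)%R]) (normc (g (polar rho t)))%:E)%E.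
Proof.
move=> hg rho01 e01 l0; case/andP: (e01) => e0 e1; case/andP: (rho01) => rho0 rho1.
have rho01' : 0 <= rho < 1 by rewrite ltW.
(* [e ^ 2 / (32 * 64)] is the constant of [cos_gap], and [32] that of [poisson_maximal]. *)
set A := 32 / (e ^+ 2 / (32 * 64)).
have A0 : 0 < A by rewrite divr_gt0 ?divr_gt0 ?exprn_gt0 ?mulr_gt0.
have lf : locally_integrable setT (circle_mod g rho).
  by apply: integrable_locally_restrict; [exact: measurable_itv|exact: integrable_circle_mod].
have sub : large_radial g e l rho `<=`
   [set th | (HL_maximal (circle_mod g rho) th > (l / A)%:E)%E].
  move=> th [/andP[th0 th1] [s /andP[s2 sr] gl]] /=; rewrite ltNge.
  apply: contraTN gl => H; rewrite -leNgt.
  have sE : s = s / rho * rho by rewrite divfK// gt_eqF.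
  have -> : l = 32 / (e ^+ 2 / (32 * 64)) * (l / A).
    by rewrite -/A mulrC divfK// gt_eqF.
  rewrite sE; apply: poisson_maximal => //.
  - apply/andP; split; last by rewrite ltr_pdivrMr// [ltRHS]mul1r.
    by rewrite ler_pdivlMr// (le_trans _ s2)//; lra.
  - have : e ^+ 2 <= 1 by rewrite expr_le1// ltW.
    by have : 0 < e ^+ 2 by [exact: exprn_gt0]; set q := _ ^+ 2 => ? ?; apply/andP; split; lra.
  - move=> t /[!in_itv]/= /andP[t0 t1]; apply: cos_gap => //.
    by rewrite ler_norml; apply/andP; split; lra.
  - by rewrite divr_ge0 ?ltW.
have mH : measurable ([set th | ((l / A)%:E < HL_maximal (circle_mod g rho) th)%E] :
    set (measurableTypeR R)).
  rewrite -[X in measurable X]setTI; apply: emeasurable_fun_o_infty => //.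
  exact: measurable_HL_maximal.
have mL := measurable_large_radial e l hg (ltW rho1).
have /le_trans : (mu (large_radial g e l rho) <=
    mu [set th | (l / A)%:E < HL_maximal (circle_mod g rho) th])%E.
  by apply: le_measure; rewrite ?inE.
apply.
apply: le_trans (maximal_inequality lf _) _; first by rewrite divr_gt0.
rewrite (_ : 3 / (l / A) = 3 * A / l); last by field; rewrite !gt_eqF.
rewrite le_eqVlt; apply/orP; left; apply/eqP; congr (_ * _)%E.
rewrite [RHS]integral_mkcond; apply: eq_integral => t _.
rewrite /circle_mod !patchE; case: ifP => _ //=; last by rewrite normr0.
by rewrite ger0_norm// normc_ge0.
Qed.

End Maximal.

(** * Integrals and null sets *)

Section NullSets.
Import HBNNSimple.
Context d (T : measurableType d) (R : realType) (nu : {measure set T -> \bar R}).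
Local Open Scope ereal_scope.

Let ge0_integral_setD_null (f : T -> \bar R) (D A : set T) : measurable D ->
  measurable A -> nu A = 0 -> (forall x, D x -> 0 <= f x) ->
  \int[nu]_(x in D) f x = \int[nu]_(x in D `\` A) f x.
Proof.
move=> mD mA A0 f0.
have f0' x : (D `\` A) x -> 0 <= f x by move=> [/f0].
rewrite !ge0_integralE//; apply/eqP; rewrite eq_le; apply/andP; split.
  apply: ge_ereal_sup => _ [h hf <-].
  have mDA : measurable (D `\` A) by exact: measurableD.
  suff -> : sintegral nu h = sintegral nu (proj_nnsfun h mDA).
    apply: ereal_sup_ubound; exists (proj_nnsfun h mDA) => // x.
    rewrite /= mindicE; have := hf x; rewrite !patchE in_setD.
    by case: (x \in D); case: (x \in A) => //=; rewrite ?mulr1 ?mulr0.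
  have h0 x : [set: T] x -> 0 <= (h x)%:E by rewrite lee_fin.
  have mh : measurable_fun [set: T] (EFin \o h) by exact/measurable_EFinP.
  have hD x : ~ D x -> h x = 0%R.
    move=> nD; apply/eqP; rewrite eq_le fun_ge0 andbT -lee_fin.
    by have := hf x; rewrite patchE memNset.
  have E : sintegral nu h = \int[nu]_(x in setT) (h x)%:E.
    by rewrite integral_nnsfun// patch_setT.
  rewrite E (ge0_negligible_integral mA measurableT mh h0 A0).
  rewrite (integral_nnsfun nu); last exact: measurableD.
  congr sintegral; apply/funext => x.
  rewrite /= mindicE patchE !in_setD in_setT/=.
  have [xD|xD] := boolP (x \in D); case: (x \in A) => //=; rewrite ?mulr1 ?mulr0//.
  by rewrite hD// => /mem_set; rewrite (negbTE xD).
apply: ge_ereal_sup => _ [h hf <-]; apply: ereal_sup_ubound; exists h => // x.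
 apply: le_trans (hf x) _; rewrite !patchE in_setD.
have [xD|xD] := boolP (x \in D); case: (x \in A) => //=.
by apply: f0; exact: set_mem.
Qed.

(** Null sets do not matter, even for functions that are not measurable: a
simple function below [f] may be cut down to the complement of a null set. *)
Lemma integral_setD_null (f : T -> \bar R) (D A : set T) : measurable D ->
  measurable A -> nu A = 0 -> \int[nu]_(x in D) f x = \int[nu]_(x in D `\` A) f x.
Proof.
move=> mD mA A0; rewrite [LHS]integralE [RHS]integralE.
by congr (_ - _); apply: ge0_integral_setD_null.
Qed.

End NullSets.

(** * Radial limits almost everywhere, and the boundary pairing *)

Section Boundary.
Variable R : realType.
Local Notation C := (cplx R).
Local Notation Re := (@complex.Re R).
Local Notation Im := (@complex.Im R).
Local Notation mu := (@lebesgue_measure R).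
Implicit Types (z w : C) (r s t : R) (f g : C -> C) (n : int).

Definition sqsum (a : nat -> C) := cvgn (series (fun k => normc (a k) ^+ 2)).

Definition tail {V : zmodType} (N : nat) (u : nat -> V) : nat -> V :=
  fun k => if (k < N)%N then 0 else u k.

Lemma series_tailE (V : zmodType) (u : nat -> V) (N m : nat) : (N <= m)%N ->
  series (tail N u) m = series u m - series u N.
Proof.
move=> /subnKC <-; elim: (m - N)%N => [|j IH].
  rewrite addn0 subrr /series/= big_nat big1// => k /andP[_ kN].
  by rewrite /tail kN.
rewrite addnS; move: IH; rewrite /series/= !(big_nat_recr (N + j))//= => ->.
by rewrite /tail ltnNge leq_addr/= addrAC.
Qed.

Lemma tail_sqE N (a : nat -> C) : (fun k => normc (tail N a k) ^+ 2) =
  tail N (fun k => normc (a k) ^+ 2).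
Proof. by apply/funext => k; rewrite /tail; case: ifP => //; rewrite normc_0 expr0n. Qed.

Lemma cvg_tailR (u : nat -> R) N l : series u @ \oo --> l ->
  series (tail N u) @ \oo --> l - series u N.
Proof.
move=> ul; have H : (fun m => series u m - series u N) @ \oo --> l - series u N.
  by apply: cvgB => //; exact: cvg_cst.
apply: cvg_trans H; apply: near_eq_cvg; near=> m.
by rewrite series_tailE//; near: m; exact: nbhs_infty_ge.
Unshelve. all: by end_near. Qed.

Lemma sqsum_tail a N : sqsum a -> sqsum (tail N a).
Proof.
by move=> ca; rewrite /sqsum tail_sqE; apply/cvg_ex; eexists; exact: cvg_tailR ca.
Qed.

Lemma sqsum_tail_small a (e : R) : sqsum a -> 0 < e ->
  exists N, limn (series (fun k => normc (tail N a k) ^+ 2)) < e.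
Proof.
move=> ca e0; have [N _ /(_ N (leqnn _)) /= H] := series_tail_near ca e0.
exists N; rewrite tail_sqE (cvg_lim _ (cvg_tailR (N := N) ca))//.
by rewrite (le_lt_trans _ H)// ler_norm.
Qed.

Lemma sqsum_pconv a : sqsum a -> pconv a.
Proof.
move=> ca z z1; apply: (cvg_series_normc (b := fun k => normc (a k) ^+ 2 + (normc z ^+ 2) ^+ k)).
  move=> k; rewrite normc_M normcX exprAC.
  have := sqr_ge0 (normc (a k) - normc z ^+ k).
  have := sqr_ge0 (normc (a k)); have := sqr_ge0 (normc z ^+ k).
  have := normc_ge0 (a k); have := exprn_ge0 k (normc_ge0 z).
  set x := normc (a k); set y := normc z ^+ k; nra.
have z2 : `|normc z ^+ 2| < 1 by rewrite normrX expr_lt1// ger0_norm ?normc_ge0.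
have -> : series (fun k => normc (a k) ^+ 2 + (normc z ^+ 2) ^+ k) =
    series (fun k => normc (a k) ^+ 2) \+ series (fun k => (normc z ^+ 2) ^+ k).
  by apply/funext => m; rewrite /series/= big_split.
apply: is_cvgD => //.
have H := cvg_geometric_series (a := 1) z2.
have -> : (fun k => (normc z ^+ 2) ^+ k) = geometric 1 (normc z ^+ 2).
  by apply/funext => k; rewrite /geometric/= mul1r.
by apply/cvg_ex; eexists; exact: H.
Qed.

Lemma pser_tail a N z : pconv a -> normc z < 1 ->
  pser (tail N a) z = pser a z - \sum_(k < N) a k * z ^+ k.
Proof.
move=> ca z1; have H := cvg_pser ca z1.
have E : (fun k => tail N a k * z ^+ k) = tail N (fun k => a k * z ^+ k).
  by apply/funext => k; rewrite /tail; case: ifP => //; rewrite mul0r.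
rewrite /pser E; apply: (cvg_lim (@cplx_hausdorff R)).
have H' : (fun m => series (fun k => a k * z ^+ k) m - series (fun k => a k * z ^+ k) N)
    @ \oo --> pser a z - \sum_(k < N) a k * z ^+ k.
  have -> : \sum_(k < N) a k * z ^+ k = series (fun k => a k * z ^+ k) N.
    by rewrite /series/= big_mkord.
  exact: (cvgCB H (cvgC_cst _)).
apply: cvg_trans H'; apply: near_eq_cvg; near=> m.
by rewrite series_tailE//; near: m; exact: nbhs_infty_ge.
Unshelve. all: by end_near. Qed.

(** Integrate the power series, term by term, against the conjugate of its sum: the
[k]-th term extracts the [k]-th coefficient. *)
Lemma parseval a r : pconv a -> 0 < r < 1 ->
  series (fun k => normc (a k) ^+ 2 * r ^+ (2 * k)) @ \oo -->
  (2 * pi)^-1 * \int[mu]_(t in `[0, 2 * pi]) normc (pser a (polar r t)) ^+ 2.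
Proof.
move=> ca r01; case/andP: (r01) => r0 r1; have r01' : 0 <= r < 1 by rewrite ltW.
pose F t := pser a (polar r t); have hg := hol0_pser ca.
have cF : rcont F by exact: rcont_hol0 hg r01'.
have [M HM] := hol0_bounded hg r01'.
pose u (k : nat) t := a k * polar r t ^+ k * conjc (F t).
have cu k : rcont (u k).
  apply: (rcontM _ (rcont_conj cF)); apply: rcontM; first exact: rcont_cst.
  by move=> t; exact: (cvgCX (n := k) (cvg_polar r t)).
have ub k t : normc (u k t) <= normc (a k) * r ^+ k * M.
  rewrite /u !normc_M normc_conj normcX normc_polar gtr0_norm//.
  by apply: (ler_wpM2l _ (HM t)); rewrite mulr_ge0 ?normc_ge0 ?exprn_ge0// ltW.
have cb : cvgn (series (fun k => normc (a k) * r ^+ k * M)).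
  have H := pconv_summable ca r01'.
  have -> : series (fun k => normc (a k) * r ^+ k * M) =
      (fun m => series (fun k => normc (a k) * r ^+ k) m * M).
    by apply/funext => m; rewrite /series/= mulr_suml.
  exact: (is_cvgM H (is_cvg_cst M)).
have := cavg_series cu ub cb.
have -> : cavg (fun t => limn (series (u^~ t))) = cip F F.
  apply: eq_cavg => t; apply: (cvg_lim (@cplx_hausdorff R)).
  have -> : series (u^~ t) = (fun m => series (fun k => a k * polar r t ^+ k) m * conjc (F t)).
    by apply/funext => m; rewrite /series/= mulr_suml.
  exact: (cvgCM (cvg_pser ca (polar_lt1 t r01')) (cvgC_cst _)).
have H z : 0 < normc z < 1 -> pser a z = pser a z * z ^ (- 0%:Z).
  by rewrite expr0z mulr1.
have [hga la _] := laurent_pser ca H.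
have ck k : cavg (u k) = (normc (a k) ^+ 2 * r ^+ (2 * k))%:C.
  have la' := la k; rewrite subr0 (laurentE _ hga r01) /lcoef in la'.
  have -> : cavg (u k) = conjc (cavg (fun t => conjc (a k) * ((r ^+ (2 * k))%:C *
      (F t * polar r t ^ (- k%:Z))))).
    rewrite -cavg_conj; apply: eq_cavg => t; rewrite /u !conjc_M conjc_K -mulrA; congr (_ * _).
    rewrite [RHS]mulrCA [LHS]mulrC; congr (_ * _); rewrite conjc_R conjc_exprz.
    have p0 : polar r t != 0 by rewrite -normc_gt0 normc_polar gtr0_norm.
    have q0 : conjc (polar r t) != 0 by rewrite -normc_gt0 normc_conj normc_gt0.
    rewrite -exprnN; apply: (mulIf (expf_neq0 k q0)); rewrite divfK ?expf_neq0//.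
    by rewrite -exprMn mul_conjc normc_polar gtr0_norm// -rmorphXn -exprM.
  rewrite cavgZ; last by apply: rcontM; [exact: rcont_cst|exact: rcont_lcoef].
  rewrite cavgZ; last exact: rcont_lcoef.
  by rewrite la' mulrCA conjc_M conjc_R (mulrC (conjc _)) mul_conjc conjc_R -realC_M mulrC.
rewrite cip_normE => /cvgC_ReIm[] /= + _.
have -> // : Re \o series (fun k => cavg (u k)) = series (fun k => normc (a k) ^+ 2 * r ^+ (2 * k)).
by apply/funext => m; rewrite /series/= Re_sum; apply: eq_bigr => k _; rewrite ck.
Qed.

Lemma pser_L2 a r : sqsum a -> 0 < r < 1 ->
  \int[mu]_(t in `[0, 2 * pi]) normc (pser a (polar r t)) ^+ 2 <=
  2 * pi * limn (series (fun k => normc (a k) ^+ 2)).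
Proof.
move=> sa r01; have ca := sqsum_pconv sa; case/andP: (r01) => r0 r1.
rewrite -ler_pdivrMl ?pi2_gt0//; have P := parseval ca r01.
rewrite -(cvg_lim _ P)//; apply: ler_lim => //; first by apply/cvg_ex; eexists; exact: P.
apply: nearW => m; apply: ler_sum => k _.
by rewrite ler_piMr ?sqr_ge0// exprn_ile1// ltW.
Qed.

(** [|x| <= e / 2 + |x| ^ 2 / (2 e)] passes from the square mean to the mean. *)
Lemma pser_L1 a (e r : R) : sqsum a -> 0 < r < 1 -> 0 < e ->
  limn (series (fun k => normc (a k) ^+ 2)) <= e ^+ 2 ->
  (\int[mu]_(t in `[0%R, (2 * pi)%R]) (normc (pser a (polar r t)))%:E <= (2 * pi * e)%:E)%E.
Proof.
move=> sa r01 e0 ae; have ca := sqsum_pconv sa; case/andP: (r01) => r0 r1.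
have r01' : 0 <= r < 1 by rewrite ltW.
pose v t := normc (pser a (polar r t)).
have cv t : v s @[s --> t] --> v t.
  by exact: (@rcont_normc R _ (rcont_hol0 (hol0_pser ca) r01') t).
have mS : measurable (`[0, 2 * pi]%classic : set (measurableTypeR R)) by exact: measurable_itv.
have i1 : mu.-integrable `[0, 2 * pi] (EFin \o v) by apply: integrable_segment => t _.
have i2 : mu.-integrable `[0, 2 * pi] (EFin \o (fun t => v t ^+ 2)).
  by apply: integrable_segment => t _; exact: (cvgM (cv t) (cv t)).
have ic (c : R) : mu.-integrable `[0, 2 * pi] (EFin \o (fun=> c)).
  by apply: integrable_segment => t _; exact: cvg_cst.
have P := le_trans (pser_L2 sa r01) (ler_wpM2l (pi2_ge0 R) ae).
have -> : (\int[mu]_(t in `[0%R, (2 * pi)%R]) (v t)%:E = (\int[mu]_(t in `[0, 2 * pi]) v t)%R%:E)%E.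
  by rewrite fineK//; exact: integrable_fin_num.
rewrite lee_fin.
have Q : \int[mu]_(t in `[0, 2 * pi]) v t <=
    \int[mu]_(t in `[0, 2 * pi]) (e / 2 + (2 * e)^-1 * v t ^+ 2).
  apply: le_Rintegral => //.
    apply: integrable_segment => t _.
    exact: (cvgD (cvg_cst _) (cvgM (cvg_cst _) (cvgM (cv t) (cv t)))).
  move=> t _; rewrite -(ler_pM2l (x := 2 * e)) ?mulr_gt0// mulrDr mulVKf; last by rewrite gt_eqF ?mulr_gt0.
  have := sqr_ge0 (e - v t); nra.
apply: le_trans Q _; rewrite RintegralD//; last first.
  by apply: integrable_segment => t _; exact: (cvgM (cvg_cst _) (cvgM (cv t) (cv t))).
rewrite [X in _ + X]RintegralZl// Rintegral_segment_cst ?pi2_ge0// subr0.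
have : (2 * e)^-1 * (\int[mu]_(t in `[0, 2 * pi]) v t ^+ 2) <= (2 * e)^-1 * (2 * pi * e ^+ 2).
  by rewrite ler_wpM2l// invr_ge0 mulr_ge0 ?ltW.
have -> : (2 * e)^-1 * (2 * pi * e ^+ 2) = e * pi :> R by field; rewrite gt_eqF.
lra.
Qed.

(** The sets for radii below [rho] increase with [rho] to the set for all radii, and
the bounds do not depend on [rho]. *)
Lemma weak_type g (e l M : R) : hol0 g -> 0 < e <= 1 -> 0 < l ->
  (forall rho : R, 0 < rho < 1 ->
    (\int[mu]_(t in `[0%R, (2 * pi)%R]) (normc (g (polar rho t)))%:E <= M%:E)%E) ->
  (mu (large_radial g e l 1) <= (3 * (32 / (e ^+ 2 / (32 * 64))) / l * M)%:E)%E.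
Proof.
move=> hg e01 l0 HM.
pose rho (i : nat) : R := 1 - i.+2%:R^-1.
have rho01 i : 0 < rho i < 1.
  by rewrite /rho subr_gt0 invf_lt1// ltr1n/= ltrBlDr ltrDl invr_gt0.
pose F i := large_radial g e l (rho i) : set (measurableTypeR R).
have mF i : measurable (F i).
  by apply: measurable_large_radial => //; case/andP: (rho01 i) => _ /ltW.
have E : \bigcup_i F i = large_radial g e l 1.
  apply/seteqP; split => th.
    move=> [i _ [th2 [s /andP[s2 sr] H]]]; split => //; exists s => //.
    by rewrite s2 (lt_trans sr)//; case/andP: (rho01 i).
  move=> [th2 [s /andP[s2 sr] H]].
  have [i si] : exists i, s < rho i.
    exists (Num.bound (1 - s)^-1); rewrite /rho ltrBrDr -ltrBrDl.
    have s0 : 0 < 1 - s by rewrite subr_gt0.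
    rewrite -[ltRHS]invrK ltf_pV2 ?posrE ?invr_gt0//.
    apply: lt_le_trans (archi_boundP _) _; first by rewrite invr_ge0 ltW.
    by rewrite ler_nat -addn2 leq_addr.
  by exists i => //; split => //; exists s => //; rewrite s2.
have mE : measurable (\bigcup_i F i) by exact: bigcupT_measurable.
have nF : nondecreasing_seq F.
  move=> i j ij; apply/subsetPset => th [th2 [s /andP[s2 sr] H]]; split => //.
  exists s => //; rewrite s2 (lt_le_trans sr)// /rho lerD2l lerN2 lef_pV2 ?posrE//.
  by rewrite ler_nat ltnS ltnS.
have Hc := nondecreasing_cvg_mu (mu := mu) mF mE nF.
rewrite -E -(cvg_lim _ Hc)//; apply: lime_le; first by apply/cvg_ex; eexists; exact: Hc.
apply: nearW => i; case/andP: (e01) => e0 _.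
apply: le_trans (weak_type_radius hg (rho01 i) e01 l0) _.
rewrite [leRHS]EFinM; apply: lee_wpmul2l; last exact: HM.
rewrite lee_fin; apply: divr_ge0; last exact: ltW.
by apply: mulr_ge0 => //; rewrite !divr_ge0 ?sqr_ge0 ?mulr_ge0.
Qed.

Lemma cvgC_cauchy_ex {T : Type} {F : set_system T} {FF : ProperFilter F} (f : T -> C) :
  (forall e : R, 0 < e -> exists x, \forall t \near F, normc (f t - x) < e) ->
  cvg (f @ F).
Proof.
move=> H.
have aux (h : C -> R) : (forall x y, `|h x - h y| <= normc (x - y)) -> cvg ((h \o f) @ F).
  move=> hx; apply: cauchy_cvg; apply: cauchy_exP => e e0.
  have [x Hx] := H e e0; exists (h x); apply: filterS Hx => t Ht.
  by rewrite /ball/= distrC (le_lt_trans _ Ht)// hx.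
have cRe : cvg ((Re \o f) @ F).
  by apply: aux => x y; apply: le_trans (Re_le_normc _); rewrite cReD cReN.
have cIm : cvg ((Im \o f) @ F).
  by apply: aux => x y; apply: le_trans (Im_le_normc _); rewrite cImD cImN.
apply/cvg_ex; exists (lim ((Re \o f) @ F) +i* lim ((Im \o f) @ F)).
by apply/cvgC_ReIm; split.
Qed.

Definition radial_cvg (f : C -> C) t := cvg (f (polar r t) @[r --> (1 : R)^'-]).

(** The partial sums of the series are continuous up to the circle, so that the
oscillation of the sum along the radius is at most that of a tail. *)
Lemma radial_cvg_tails a t : sqsum a ->
  (forall e : R, 0 < e -> exists N, forall r, 1 / 2 <= r < 1 ->
    normc (pser (tail N a) (polar r t)) <= e) ->
  radial_cvg (pser a) t.
Proof.
move=> sa H; have ca := sqsum_pconv sa; apply: cvgC_cauchy_ex => e e0.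
have e2 : 0 < e / 2 by rewrite divr_gt0.
have [N HN] := H _ e2; pose S z := \sum_(k < N) a k * z ^+ k.
exists (S (polar 1 t)).
have cS : S (polar r t) @[r --> (1 : R)^'-] --> S (polar 1 t).
  apply: cvgC_sum => k; apply: (cvgCM (cvgC_cst _)).
  apply: (cvgCX (n := k)).
  exact: (cvg_at_left_filter (cvg_polar_radius t 1)).
have {}cS : \forall r \near (1 : R)^'-, normc (S (polar 1 t) - S (polar r t)) < e / 2.
  by move/cvgC_normP : cS => /(_ _ e2).
have r2 : \forall r \near (1 : R)^'-, 1 / 2 <= r.
  by apply: nbhs_left_ge; rewrite ltr_pdivrMr ?mul1r ?ltr1n.
near=> r.
have r1 : r < 1 by near: r; exact: nbhs_left_lt.
have rh : 1 / 2 <= r by near: r.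
have r0 : 0 <= r by apply: le_trans rh.
have z1 : normc (polar r t : C) < 1 by rewrite polar_lt1// r0.
have -> : pser a (polar r t) - S (polar 1 t) =
    pser (tail N a) (polar r t) - (S (polar 1 t) - S (polar r t)).
  by rewrite pser_tail// /S opprB addrA subrK.
rewrite (le_lt_trans (normc_D _ _))// normc_N [ltRHS]splitr ler_ltD//.
  by apply: HN; rewrite rh.
by near: r.
Unshelve. all: by end_near. Qed.

(** Fatou's theorem for square summable coefficients: the set where the radial limit
fails to exist is contained in the sets where the tails of the series are large
somewhere on the radius, and the latter have arbitrarily small measure. *)
Lemma radial_cvg_ae a : sqsum a ->
  exists A : set R, [/\ measurable (A : set (measurableTypeR R)), mu A = 0%E &
    forall t, t \in `[0, 2 * pi] -> ~ A t -> radial_cvg (pser a) t].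
Proof.
move=> sa; have ca := sqsum_pconv sa.
pose e_ (i : nat) : R := i.+1%:R^-1.
have e01 i : 0 < e_ i <= 1 by rewrite invr_gt0 ltr0Sn/= invf_le1// ler1n.
pose B i j N := large_radial (pser (tail N a)) (e_ i) (e_ j) 1 : set (measurableTypeR R).
have hT N : hol0 (pser (tail N a)) by apply: hol0_pser; apply: sqsum_pconv; exact: sqsum_tail.
have mB i j N : measurable (B i j N).
  exact: (measurable_large_radial (e_ i) (e_ j) (hT N) (lexx 1)).
have mI i j : measurable (\bigcap_N B i j N) by exact: bigcapT_measurable.
have nI i j : mu.-negligible (\bigcap_N B i j N).
  apply/negligibleP => //; apply/eqP; rewrite eq_le measure_ge0 andbT.
  set c := 3 * (32 / (e_ i ^+ 2 / (32 * 64))) / e_ j.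
  case/andP: (e01 i) => ei0 _; case/andP: (e01 j) => ej0 _.
  have c0 : 0 < c.
    rewrite /c divr_gt0// mulr_gt0// divr_gt0// divr_gt0 ?exprn_gt0// mulr_gt0//.
  apply/lee_addgt0Pr => d d0; rewrite add0e.
  have p0 := pi2_gt0 R.
  pose h := d / (c * (2 * pi)).
  have h0 : 0 < h by rewrite divr_gt0// mulr_gt0.
  have [N /ltW HN] := sqsum_tail_small sa (exprn_gt0 2 h0).
  apply: (@le_trans _ _ (mu (B i j N))).
    by apply: le_measure; rewrite ?inE// => t; apply.
  apply: le_trans (weak_type (M := 2 * pi * h) (hT N) (e01 i) ej0 _) _.
    by move=> rho r01; apply: pser_L1 => //; exact: sqsum_tail.
  rewrite lee_fin -/c /h le_eqVlt; apply/orP; left; apply/eqP.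
  by rewrite [LHS]mulrA mulrC divfK// gt_eqF// mulr_gt0.
have n1 (x : R) : mu.-negligible [set x].
  by apply/negligibleP; [exact: measurable_set1|exact: lebesgue_measure_set1].
have nA : mu.-negligible (([set 0 : R] `|` [set 2 * pi]) `|`
    \bigcup_i \bigcup_j \bigcap_N B i j N).
  apply: negligibleU; last by do 2!apply: negligible_bigcup => ?.
  by apply: negligibleU; exact: n1.
have [A [mA A0 sA]] := nA; exists A; split => // t /[!in_itv]/= /andP[t0 t1] nAt.
have {nAt} nt : ~ (([set 0 : R] `|` [set 2 * pi]) `|` \bigcup_i \bigcup_j \bigcap_N B i j N) t.
  by move=> /sA.
have t0' : 0 < t by rewrite lt_neqAle t0 andbT; apply/negP => /eqP E; apply: nt; left; left.
have t1' : 0 < 2 * pi - t.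
  by rewrite subr_gt0 lt_neqAle t1 andbT; apply/negP => /eqP E; apply: nt; left; right.
have sm (x : R) : 0 < x -> exists i, e_ i <= x.
  move=> x0; exists (Num.bound x^-1); rewrite /e_ -[leRHS]invrK lef_pV2 ?posrE ?invr_gt0//.
  apply: ltW; apply: lt_le_trans (archi_boundP _) _; first by rewrite invr_ge0 ltW.
  by rewrite ler_nat.
have [i1 Hi1] := sm _ t0'; have [i2 Hi2] := sm _ t1'.
pose i := maxn i1 i2.
have em k : (k <= i)%N -> e_ i <= e_ k.
  by move=> ki; rewrite /e_ lef_pV2 ?posrE// ler_nat ltnS.
apply: radial_cvg_tails => // e e0; have [j Hj] := sm _ e0.
have [N HN] : exists N, ~ B i j N t.
  apply: contrapT => /forallNP H; apply: nt; right; exists i => //; exists j => // N _.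
  exact: contrapT (H N).
exists N => r r21; rewrite leNgt; apply/negP => gr; apply: HN; split.
  have := em _ (leq_maxl i1 i2); have := em _ (leq_maxr i1 i2) => H1 H2.
  by apply/andP; split; [exact: le_trans Hi1|rewrite lerBrDl -lerBrDr; exact: le_trans Hi2].
by exists r => //; exact: le_lt_trans gr.
Qed.

Lemma radial_seq (i : nat) : 0 < (1 - i.+2%:R^-1 : R) < 1.
Proof. by rewrite subr_gt0 invf_lt1// ltr1n/= ltrBlDr ltrDl invr_gt0. Qed.

Lemma cvg_radial_seq : (fun i : nat => 1 - i.+2%:R^-1 : R) @ \oo --> (1 : R)^'-.
Proof.
move=> A [e /= e0 HA].
have := near_infty_natSinv_lt (PosNum e0); apply: filterS => i /= ie; apply: HA.
  rewrite /= opprB addrCA subrr addr0 ger0_norm ?invr_ge0//; apply: le_lt_trans ie.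
  by rewrite lef_pV2 ?posrE// ler_nat.
by case/andP: (radial_seq i).
Qed.

Lemma cintegral_setD_null (D A : set (measurableTypeR R)) F : measurable D -> measurable A ->
  mu A = 0%E -> cintegral D F = cintegral (D `\` A) F.
Proof.
by move=> mD mA A0; rewrite /cintegral /Rintegral !(integral_setD_null _ mD mA A0).
Qed.

(** Fatou's lemma for the moduli gives the integrability of the limit, together with
the bound. *)
Lemma fatou_cintegral (F : nat -> R -> C) (W : R -> C) (D : set (measurableTypeR R)) (M : R) :
  measurable D -> (forall i, rcont (F i)) -> (forall t, D t -> F^~ t @ \oo --> W t) ->
  (forall i, (\int[mu]_(t in D) (normc (F i t))%:E <= M%:E)%E) ->
  cintegrable D W /\ normc (cintegral D W) <= 2 * M.
Proof.
move=> mD cF FW FM.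
have mF (h : C -> R) : (forall i t, h (F i s) @[s --> t] --> h (F i t)) ->
    (forall t, D t -> (fun i => h (F i t)) @ \oo --> h (W t)) ->
    measurable_fun D (h \o W).
  move=> hF hW; apply: (measurable_fun_cvg (h := fun i t => h (F i t))) => // i.
  by apply: measurable_funTS; apply: continuous_measurable_fun; exact: hF.
have cRI i t : (Re \o F i) @ t --> Re (F i t) /\ (Im \o F i) @ t --> Im (F i t).
  by apply/cvgC_ReIm; exact: cF.
have wRI t : D t -> (fun i => Re (F i t)) @ \oo --> Re (W t) /\
    (fun i => Im (F i t)) @ \oo --> Im (W t).
  by move=> Dt; apply/(cvgC_ReIm (F^~ t) (W t)); exact: FW.
have mRe : measurable_fun D (Re \o W).
  by apply: mF => [i t|t Dt]; [case: (cRI i t)|case: (wRI t Dt)].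
have mIm : measurable_fun D (Im \o W).
  by apply: mF => [i t|t Dt]; [case: (cRI i t)|case: (wRI t Dt)].
have mN : measurable_fun D (fun t => normc (W t)).
  apply: mF => [i t|t Dt]; first exact: (cvg_normc (cF i t)).
  exact: (cvg_normc (FW t Dt)).
have mNF i : measurable_fun D (fun t => (normc (F i t))%:E).
  apply/measurable_EFinP; apply: measurable_funTS; apply: continuous_measurable_fun => t.
  exact: (cvg_normc (cF i t)).
have WM : (\int[mu]_(t in D) (normc (W t))%:E <= M%:E)%E.
  have := fatou mu mD mNF (fun i t _ => normc_ge0 (F i t)).
  have -> : (\int[mu]_(t in D) limn_einf (fun i => (normc (F i t))%:E) =
      \int[mu]_(t in D) (normc (W t))%:E)%E.
    apply: eq_integral => t /set_mem Dt.
    have H : (fun i => (normc (F i t))%:E) @ \oo --> (normc (W t))%:E.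
      by apply: cvg_EFin; [exact: nearW|exact: (cvg_normc (FW t Dt))].
    by have [-> _] := cvg_limn_einf_sup H.
  move=> /le_trans; apply; rewrite limn_einf_lim; apply: lime_le; first exact: is_cvg_einfs.
  apply: nearW => i; apply: le_trans (FM i).
  by apply: ereal_inf_lbound; exists i => //=.
have iN : mu.-integrable D (EFin \o (fun t => normc (W t))).
  apply/integrableP; split; first exact/measurable_EFinP.
  under eq_integral => t _ do rewrite /= ger0_norm ?normc_ge0//.
  by apply: le_lt_trans WM _; rewrite ltry.
have cW : cintegrable D W.
  split; apply: le_integrable iN => //; try exact/measurable_EFinP.
    by move=> t _; rewrite lee_fin [leRHS]ger0_norm ?normc_ge0// Re_le_normc.
  by move=> t _; rewrite lee_fin [leRHS]ger0_norm ?normc_ge0// Im_le_normc.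
split => //; apply: le_trans (normc_cintegral_le mD cW iN (fun t _ => lexx _)) _.
rewrite ler_pM2l// -lee_fin /Rintegral fineK//; exact: integrable_fin_num.
Qed.

Definition abssum (b : nat -> C) := cvgn (series (fun k => normc (b k))).

Lemma summable_circle b r t : abssum b -> 0 <= r <= 1 ->
  forall k, normc (b k * polar r t ^+ k) <= normc (b k).
Proof.
move=> sb /andP[r0 r1] k; rewrite normc_M normcX normc_polar ger0_norm//.
by rewrite ler_piMr ?normc_ge0// exprn_ile1.
Qed.

Lemma summable_radial b t : abssum b ->
  pser b (polar r t) @[r --> (1 : R)^'-] --> pser b (polar 1 t).
Proof.
move=> sb; apply: (lim_series_cvg (u := fun k r => b k * polar r t ^+ k) _ _ sb).
  move=> k; apply: (cvgCM (cvgC_cst _)); apply: (cvgCX (n := k)).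
  exact: (cvg_at_left_filter (cvg_polar_radius t 1)).
near=> r; apply: summable_circle => //; apply/andP; split.
  by near: r; apply: nbhs_left_ge.
by near: r; exact: nbhs_left_le.
Unshelve. all: by end_near. Qed.

Lemma rcont_summable b : abssum b -> rcont (fun t => pser b (polar 1 t)).
Proof.
move=> sb; apply: (rcont_series (b := fun k => normc (b k))) => // [k|k t].
  by apply: (rcontM (rcont_cst _)) => t; exact: (cvgCX (n := k) (cvg_polar 1 t)).
by apply: summable_circle => //; rewrite ler01 lexx.
Qed.

Lemma summable_bound b t : abssum b ->
  normc (pser b (polar 1 t)) <= limn (series (fun k => normc (b k))).
Proof.
move=> sb.
have H := @normc_series_tail R (fun k => b k * polar 1 t ^+ k) _ 0
  (summable_circle (r := 1) t sb _) sb.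
have s0 (V : zmodType) (u : nat -> V) : series u 0%N = 0 by rewrite /series/= big_geq.
by rewrite !s0 !subr0 in H; apply: H; rewrite ler01 lexx.
Qed.

Lemma cip_summable b k : abssum b ->
  cavg (fun t => polar 1 t ^+ k * conjc (pser b (polar 1 t))) = conjc (b k).
Proof.
move=> sb; pose u (j : nat) t := b j * polar 1 t ^+ j * conjc (polar 1 t ^+ k).
have ce j : rcont (fun t => polar 1 t ^+ j : C).
  by move=> t; exact: (cvgCX (n := j) (cvg_polar 1 t)).
have cu j : rcont (u j) by apply: (rcontM (rcontM (rcont_cst _) (ce j)) (rcont_conj (ce k))).
have ub j t : normc (u j t) <= normc (b j).
  rewrite /u normc_M normc_conj normcX normc_polar normr1 expr1n mulr1.
  by apply: summable_circle => //; rewrite ler01 lexx.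
have H := cavg_series cu ub sb.
have E : cavg (fun t => limn (series (u^~ t))) =
    conjc (cavg (fun t => polar 1 t ^+ k * conjc (pser b (polar 1 t)))).
  rewrite -cavg_conj; apply: eq_cavg => t; rewrite conjc_M conjc_K mulrC.
  apply: (cvg_lim (@cplx_hausdorff R)).
  have -> : series (u^~ t) = (fun m => series (fun j => b j * polar 1 t ^+ j) m * conjc (polar 1 t ^+ k)).
    by apply/funext => m; rewrite /series/= mulr_suml.
  have cb := cvg_series_normc (summable_circle (r := 1) t sb _) sb.
  have {}cb := cb (introT andP (conj ler01 (lexx 1))).
  exact: (cvgCM cb (cvgC_cst _)).
rewrite E in H.
have ck j : cavg (u j) = b j * (j == k)%:R.
  rewrite /u; under eq_cavg do rewrite -mulrA.
  rewrite cavgZ; last exact: (rcontM (ce j) (rcont_conj (ce k))).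
  by congr (_ * _); have := @cip_polar R j%:Z k%:Z; rewrite eqz_nat.
have H' : series (fun j => cavg (u j)) @ \oo --> b k.
  have : (fun=> b k) @ \oo --> b k by exact: cvgC_cst.
  apply: cvg_trans; apply: near_eq_cvg; near=> m.
  have km : (k < m)%N by near: m; exact: nbhs_infty_gt.
  rewrite /series/= big_mkord (bigD1 (Ordinal km))//= ck eqxx mulr1 big1 ?addr0// => j jk.
  by rewrite ck (negbTE (_ : val j != k)) ?mulr0.
by rewrite -(cvgC_unique H H') conjc_K.
Unshelve. all: by end_near. Qed.

(** The pairing of boundary values is the pairing of coefficients. The tails of
the first series are controlled, uniformly on the circles approaching the unit
circle, by their square sums, and Fatou's lemma passes this to the boundary. *)
Lemma boundary_pairing a b (H : R -> C) : sqsum a -> abssum b ->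
  (forall t, radial_cvg (pser a) t -> H t =
    lim (pser a (polar r t) @[r --> (1 : R)^'-]) * conjc (pser b (polar 1 t))) ->
  series (fun k => a k * conjc (b k)) @ \oo --> cavg H.
Proof.
move=> sa sb HE; have ca := sqsum_pconv sa.
have [A [mA A0 cA]] := radial_cvg_ae sa.
pose S : set (measurableTypeR R) := `[0, 2 * pi]%classic; pose D := S `\` A.
have mS : measurable S by exact: measurable_itv.
have mD : measurable D by exact: measurableD.
pose B t := pser b (polar 1 t); pose L := limn (series (fun k => normc (b k))).
have cB : rcont B by exact: rcont_summable.
have BL t : normc (B t) <= L by exact: summable_bound.
have L0 : 0 <= L by exact: le_trans (normc_ge0 _) (BL 0).
pose gs t : C := lim (pser a (polar r t) @[r --> (1 : R)^'-]).
pose P N t : C := \sum_(k < N) a k * polar 1 t ^+ k.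
have cp k : rcont (fun t => polar 1 t ^+ k : C).
  by move=> t; exact: (cvgCX (n := k) (cvg_polar 1 t)).
have cP N : rcont (P N).
  by apply: rcont_sum => k; exact: (rcontM (rcont_cst _) (cp k)).
have cPB N : rcont (fun t => P N t * conjc (B t)) by exact: (rcontM (cP N) (rcont_conj cB)).
have tailD N t : D t -> pser (tail N a) (polar r t) @[r --> (1 : R)^'-] --> gs t - P N t.
  move=> [St nAt].
  have c1 : pser a (polar r t) @[r --> (1 : R)^'-] --> gs t by exact: cA.
  have c2 : \sum_(k < N) a k * polar r t ^+ k @[r --> (1 : R)^'-] --> P N t.
    apply: cvgC_sum => k; apply: (cvgCM (cvgC_cst _)); apply: (cvgCX (n := k)).
    exact: (cvg_at_left_filter (cvg_polar_radius t 1)).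
  apply: cvg_trans (cvgCB c1 c2); apply: near_eq_cvg; near=> r.
  rewrite pser_tail// polar_lt1//; apply/andP; split.
    by near: r; apply: nbhs_left_ge.
  by near: r; exact: nbhs_left_lt.
have key N (e : R) : 0 < e -> limn (series (fun k => normc (tail N a k) ^+ 2)) <= e ^+ 2 ->
    cintegrable D (fun t => (gs t - P N t) * conjc (B t)) /\
    normc (cintegral D (fun t => (gs t - P N t) * conjc (B t))) <= 2 * (2 * pi * e * L).
  move=> e0 He; pose rho (i : nat) : R := 1 - i.+2%:R^-1.
  have r01 i : 0 <= rho i < 1 by case/andP: (radial_seq i) => /ltW -> ->.
  have sT := sqsum_tail (N := N) sa; have hT := hol0_pser (sqsum_pconv sT).
  pose F (i : nat) t := pser (tail N a) (polar (rho i) t) * conjc (B t).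
  refine (@fatou_cintegral F _ D (2 * pi * e * L) mD _ _ _).
  - by move=> i; exact: (rcontM (rcont_hol0 hT (r01 i)) (rcont_conj cB)).
  - move=> t Dt; apply: (cvgCM _ (cvgC_cst _)).
    exact: (cvg_comp _ _ cvg_radial_seq (tailD N t Dt)).
  - move=> i.
    have mv : measurable_fun S (fun t => (normc (pser (tail N a) (polar (rho i) t)))%:E).
      apply/measurable_EFinP; apply: measurable_funTS; apply: continuous_measurable_fun.
      exact: rcont_normc (rcont_hol0 hT (r01 i)).
    have v0 t : S t -> (0 <= (normc (pser (tail N a) (polar (rho i) t)))%:E)%E.
      by rewrite lee_fin normc_ge0.
    have DS : D `<=` S by exact: subDsetl.
    apply: (@le_trans _ _ (\int[mu]_(t in S) (L%:E * (normc (pser (tail N a) (polar (rho i) t)))%:E))%E).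
      rewrite (integral_setD_null _ mS mA A0); apply: ge0_le_integral => //.
      + by move=> t _; rewrite lee_fin normc_ge0.
      + apply/measurable_EFinP; apply: measurable_funTS; apply: continuous_measurable_fun.
        exact: rcont_normc (rcontM (rcont_hol0 hT (r01 i)) (rcont_conj cB)).
      + apply: measurable_funeM; exact: (measurable_funS mS DS).
      + move=> t _; rewrite -EFinM lee_fin normc_M normc_conj mulrC.
        by apply: ler_wpM2r; [exact: normc_ge0|exact: BL].
    rewrite (ge0_integralZl_EFin mu mS v0 mv L0) [leRHS]EFinM muleC.
    apply: lee_wpmul2r; first by rewrite lee_fin.
    by apply: pser_L1 => //; exact: radial_seq.
have HD : cavg H = ((2 * pi)^-1)%:C * cintegral D (fun t => gs t * conjc (B t)).
  rewrite /cavg (cintegral_setD_null _ mS mA A0); congr (_ * _); apply: eq_cintegral.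
  by move=> t [St nAt]; apply: HE; exact: cA.
have partial N : series (fun k => a k * conjc (b k)) N =
    ((2 * pi)^-1)%:C * cintegral D (fun t => P N t * conjc (B t)).
  rewrite -(cintegral_setD_null _ mS mA A0) -[RHS]/(cavg _).
  have -> : cavg (fun t => P N t * conjc (B t)) =
      cavg (fun t => \sum_(k < N) a k * (polar 1 t ^+ k * conjc (B t))).
    by apply: eq_cavg => t; rewrite mulr_suml; apply: eq_bigr => k _; rewrite mulrA.
  have cpB k := rcontM (cp k) (rcont_conj cB).
  rewrite cavg_sum; last by move=> k; exact: (rcontM (rcont_cst _) (cpB k)).
  rewrite /series/= big_mkord; apply: eq_bigr => k _; rewrite cavgZ; last exact: cpB.
  by rewrite cip_summable.
apply/cvgC_normP => e e0.
pose h := e / (4 * (L + 1)).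
have h0 : 0 < h by rewrite divr_gt0// mulr_gt0// ltr_wpDl.
have := series_tail_near sa (exprn_gt0 2 h0); apply: filterS => N HN.
have [] := key N h h0.
  rewrite tail_sqE (cvg_lim _ (cvg_tailR (N := N) sa))//.
  by apply: le_trans (ltW HN); exact: ler_norm.
move=> iW bW.
have iP : cintegrable D (fun t => P N t * conjc (B t)).
  have [iP1 iP2] := rcont_cintegrable 0 (2 * pi) (cPB N).
  by split; apply: integrableS mS mD _ _ => //; exact: subDsetl.
have -> : cavg H - series (fun k => a k * conjc (b k)) N =
    ((2 * pi)^-1)%:C * cintegral D (fun t => (gs t - P N t) * conjc (B t)).
  rewrite HD partial -mulrBr; congr (_ * _).
  have -> : cintegral D (fun t => gs t * conjc (B t)) =
      cintegral D (fun t => (gs t - P N t) * conjc (B t) + P N t * conjc (B t)).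
    by apply: eq_cintegral => t _; rewrite -mulrDl subrK.
  by rewrite cintegralD// addrK.
rewrite normc_M normc_real ger0_norm ?invr_ge0 ?pi2_ge0// ltr_pdivrMl ?pi2_gt0//.
apply: le_lt_trans bW _.
have eE : e = h * (4 * (L + 1)) by rewrite divfK// gt_eqF// mulr_gt0// ltr_wpDl.
have -> : 2 * (2 * pi * h * L) = 2 * pi * (2 * h * L) by ring.
rewrite ltr_pM2l ?pi2_gt0// eE; have : 0 <= h * L by rewrite mulr_ge0// ltW.
have -> : h * (4 * (L + 1)) = 4 * (h * L) + 4 * h by ring.
by rewrite -mulrA; move: (h * L) => x; lra.
Unshelve. all: by end_near. Qed.

End Boundary.

(** * The modified Hardy space *)

Section HardySpace.
Variable R : realType.
Local Notation C := (cplx R).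
Local Notation Re := (@complex.Re R).
Local Notation Im := (@complex.Im R).
Local Notation mu := (@lebesgue_measure R).
Implicit Types (z w : C) (r s t : R) (f g h : C -> C) (n : int).

Lemma punctured_diskE z : punctured_disk z = (0 < normc z < 1).
Proof. by rewrite /punctured_disk /= ltc0r. Qed.

Lemma unit_diskE z : unit_disk z = (normc z < 1).
Proof. by rewrite /unit_disk /= ltc1. Qed.

Lemma holomorphic_punctured f : holomorphic_on punctured_disk f <-> hol f.
Proof. by split => H z; have := H z; rewrite punctured_diskE. Qed.

Lemma holomorphic_unit f : holomorphic_on unit_disk f <-> hol0 f.
Proof. by split => H z; have := H z; rewrite unit_diskE. Qed.

Lemma sing_order_form h (k : nat) : sing_order h k ->
  exists2 g, hol0 g & forall z, 0 < normc z < 1 -> h z = g z * z ^ (- k%:Z).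
Proof.
case: k => [|k] [g].
  move=> /holomorphic_unit hg hE; exists g => // z zd.
  by rewrite expr0z mulr1 hE// punctured_diskE.
move=> [/holomorphic_unit hg _] hE; exists g => // z zd.
by rewrite hE ?punctured_diskE// -exprnN.
Qed.

(** [h] is a holomorphic function divided by [z ^ k], which shifts the indices of its
Taylor series by [k]. *)
Lemma sing_order_vanish h (k : nat) n : sing_order h k -> n < - k%:Z -> laurent h n = 0.
Proof.
move=> /sing_order_form[g hg hE]; have [ca gE] := hol0_taylor hg.
have hE' z : 0 < normc z < 1 -> h z = pser (taylor g) z * z ^ (- k%:Z).
  by move=> zd; rewrite hE// gE//; case/andP: zd.
by have [_ _] := laurent_pser ca hE'; exact.
Qed.

Lemma fourier_laurent f r n : hol f -> 0 < r < 1 ->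
  cip (fun t => f (polar r t)) (fun t => polar 1 t ^ n) = r%:C ^ n * laurent f n.
Proof.
move=> hf r01; have r0 : r%:C != 0 :> C.
  by rewrite -normc_eq0 normc_real gtr0_norm ?gt_eqF//; case/andP: r01.
rewrite (laurentE _ hf r01) /lcoef -cavgZ; last exact: rcont_lcoef.
apply: eq_cavg => t; rewrite conjc_exprz conjc_polar1 exprz_inv polar_exprz.
by rewrite [RHS]mulrCA; congr (_ * _); rewrite mulrA -(expfzDr _ _ r0) subrr expr0z mul1r.
Qed.

Lemma hardy_sqnorm_bound h : hol h -> (hardy_sqnorm h < +oo)%E ->
  exists M : R, forall r, 0 < r < 1 -> r ^+ (2 * Defs.eta h) *
    ((2 * pi)^-1 * \int[mu]_(t in `[0, 2 * pi]) normc (h (polar r t)) ^+ 2) <= M.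
Proof.
move=> hh; case E : (hardy_sqnorm h) => [M| |] // _.
  exists M => r r01; rewrite -lee_fin -E; apply: ereal_sup_ubound; exists r => //=.
  rewrite [in RHS]mulrA [RHS]EFinM; congr (_ * _)%E; rewrite /Rintegral fineK//.
  apply: integrable_fin_num; first exact: measurable_itv.
  have H t := @rcont_normc R _ (rcont_hol hh r01) t.
  by apply: integrable_segment => t _; exact: (cvgM (H t) (H t)).
exists 0 => r r01; suff : (hardy_sqnorm h >= (0 : R)%:E)%E by rewrite E.
apply: le_trans (ereal_sup_ubound _); last by exists r => //=.
rewrite mule_ge0// ?lee_fin ?divr_ge0 ?exprn_ge0 ?pi2_ge0//; first by case/andP: r01 => /ltW.
by apply: integral_ge0 => t _; rewrite lee_fin sqr_ge0.
Qed.

(** A function of Hardy type has square summable Laurent coefficients, by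
Bessel's inequality on the circles that approach the unit circle. *)
Lemma hardy_laurent p h : hardy p h ->
  [/\ hol h, forall n, n < - p%:Z -> laurent h n = 0 &
    sqsum (fun k : nat => laurent h (k%:Z - p%:Z))].
Proof.
move=> [/holomorphic_punctured hh [k kp hk] /(hardy_sqnorm_bound hh)[M HM]]; split => //.
  by move=> n np; apply: (sing_order_vanish hk); apply: lt_le_trans np _; lia.
pose l (i : nat) := laurent h (i%:Z - p%:Z); pose ee := Defs.eta h.
have key N r : 0 < r < 1 -> \sum_(i < N) r ^+ (2 * i + 2 * ee) * normc (l i) ^+ 2 <= M.
  move=> r01; case/andP: (r01) => r0 r1.
  have B := @cip_bessel R (fun t => h (polar r t)) (fun (i : nat) t => polar 1 t ^ (i%:Z - p%:Z)) N
    (rcont_hol hh r01) (fun i => rcont_polar_exp (i%:Z - p%:Z)).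
  have M0 : 0 <= M.
    apply: le_trans (HM r r01); rewrite !mulr_ge0 ?exprn_ge0 ?invr_ge0 ?pi2_ge0 ?(ltW r0)//.
    by apply: Rintegral_ge0 => t _; exact: sqr_ge0.
  have H : r ^+ (2 * ee) * \sum_(i < N) normc (cip (fun t => h (polar r t))
      (fun t => polar 1 t ^ (i%:Z - p%:Z))) ^+ 2 <= M.
    apply: le_trans (HM r r01); rewrite ler_wpM2l ?exprn_ge0 ?(ltW r0)//.
    apply: B => i j; rewrite cip_polar; congr (nat_of_bool _)%:R.
    by rewrite (inj_eq (addIr _)) eqz_nat.
  have -> : \sum_(i < N) r ^+ (2 * i + 2 * ee) * normc (l i) ^+ 2 =
      r ^+ (2 * p) * (r ^+ (2 * ee) * \sum_(i < N) normc (cip (fun t => h (polar r t))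
      (fun t => polar 1 t ^ (i%:Z - p%:Z))) ^+ 2).
    rewrite !mulr_sumr; apply: eq_bigr => i _.
    have -> : normc (cip (fun t => h (polar r t)) (fun t => polar 1 t ^ (i%:Z - p%:Z))) =
        r ^ (i%:Z - p%:Z) * normc (l i).
      by rewrite fourier_laurent// [LHS]normc_M normc_exprz normc_real gtr0_norm.
    have Ex : r ^+ i = r ^ (i%:Z - p%:Z) * r ^+ p.
      by rewrite -[r ^+ p]/(r ^ p%:Z) -(expfzDr _ _ (lt0r_neq0 r0)) subrK.
    rewrite exprD ![(2 * _)%N]mulnC !exprM Ex.
    by move: (r ^ _) (r ^+ p) (r ^+ ee) (normc _) => x y u v; ring.
  apply: le_trans H; rewrite ler_piMl// ?exprn_ile1 ?(ltW r0) ?(ltW r1)//.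
  rewrite mulr_ge0 ?exprn_ge0 ?(ltW r0)//; apply: sumr_ge0 => i _; exact: sqr_ge0.
apply: nondecreasing_is_cvgn.
  apply/nondecreasing_seqP => n; rewrite /series/= big_nat_recr//=.
  by rewrite lerDl sqr_ge0.
exists M => _ [N _ <-].
have c1 : \sum_(i < N) r ^+ (2 * i + 2 * ee) * normc (l i) ^+ 2 @[r --> (1 : R)^'-] -->
    \sum_(i < N) 1 ^+ (2 * i + 2 * ee) * normc (l i) ^+ 2.
  elim: N => [|N IH]; first by under eq_fun do rewrite big_ord0; rewrite big_ord0; exact: cvg_cst.
  under eq_fun do rewrite big_ord_recr/=; rewrite big_ord_recr/=.
  exact: (cvgD IH (cvgM (cvg_at_left_filter (@exprn_continuous R _ 1)) (cvg_cst _))).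
rewrite /series/= big_mkord.
have -> : \sum_(i < N) normc (laurent h (i%:Z - p%:Z)) ^+ 2 =
    \sum_(i < N) 1 ^+ (2 * i + 2 * ee) * normc (l i) ^+ 2.
  by apply: eq_bigr => i _; rewrite expr1n mul1r.
apply: (cvgr_to_le c1); near=> r; apply: key; apply/andP; split.
  by near: r; apply: nbhs_left_gt.
by near: r; exact: nbhs_left_lt.
Unshelve. all: by end_near. Qed.

Lemma pser_laurent f (N : nat) z : hol f -> (forall n, n < - N%:Z -> laurent f n = 0) ->
  0 < normc z < 1 ->
  f z = pser (fun k : nat => laurent f (k%:Z - N%:Z)) z * z ^ (- N%:Z).
Proof.
move=> hf f0 zd; have z0 := neq0_disk zd.
have S := laurent_series hf f0 zd.
have H : series (fun k : nat => laurent f (k%:Z - N%:Z) * z ^+ k) @ \oo --> f z * z ^ N%:Z.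
  have -> : series (fun k : nat => laurent f (k%:Z - N%:Z) * z ^+ k) =
      (fun m => series (fun k : nat => laurent f (k%:Z - N%:Z) * z ^ (k%:Z - N%:Z)) m * z ^ N%:Z).
    apply/funext => m; rewrite /series/= mulr_suml; apply: eq_bigr => k _.
    by rewrite -[RHS]mulrA -(expfzDr _ _ z0) subrK.
  exact: (cvgCM S (cvgC_cst _)).
have -> : pser (fun k : nat => laurent f (k%:Z - N%:Z)) z = f z * z ^ N%:Z.
  exact: (cvg_lim (@cplx_hausdorff R) H).
by rewrite -[RHS]mulrA -(expfzDr _ _ z0) subrr expr0z mulr1.
Qed.

(** The powers of [z] that carry the poles have modulus one on the unit circle
and cancel from the product. *)
Lemma hardy_inner_pser (c d : nat -> C) (N : nat) f g : sqsum c -> abssum d ->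
  (forall z, 0 < normc z < 1 -> f z = pser c z * z ^ (- N%:Z)) ->
  (forall z, 0 < normc z < 1 -> g z = pser d z * z ^ (- N%:Z)) ->
  series (fun k => c k * conjc (d k)) @ \oo --> hardy_inner f g.
Proof.
move=> sc sd fE gE; apply: boundary_pairing => // t ct.
have cpow : polar r t ^ (- N%:Z) @[r --> (1 : R)^'-] --> polar 1 t ^ (- N%:Z).
  have [d' /has_cderiv_cvg H] := has_cderiv_exprz (- N%:Z) (polar1_neq0 t).
  exact: (cvg_comp _ _ (cvg_at_left_filter (cvg_polar_radius t 1)) H).
have lift (h : C -> C) (b : nat -> C) (l : C) :
    (forall z, 0 < normc z < 1 -> h z = pser b z * z ^ (- N%:Z)) ->
    pser b (polar r t) @[r --> (1 : R)^'-] --> l ->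
    radial_lim h t = l * polar 1 t ^ (- N%:Z).
  move=> hE hl; apply: (cvg_lim (@cplx_hausdorff R)).
  apply: cvg_trans (cvgCM hl cpow); apply: near_eq_cvg; near=> r.
  rewrite hE//; apply: disk_polar; apply/andP; split.
    by near: r; apply: nbhs_left_gt.
  by near: r; exact: nbhs_left_lt.
rewrite (lift f c _ fE ct) (lift g d _ gE (summable_radial (t := t) sd)).
rewrite conjc_M mulrACA conjc_exprz conjc_polar1 exprz_inv -(expfzDr _ _ (polar1_neq0 t)).
by rewrite subrr expr0z mulr1.
Unshelve. all: by end_near. Qed.

Lemma hardy_inner_conj f g : hardy_inner g f = conjc (hardy_inner f g).
Proof.
rewrite -[RHS]/(conjc (cavg _)) -cavg_conj; apply: eq_cavg => t.
by rewrite conjc_M conjc_K mulrC.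
Qed.

Lemma eta_spec h (k : nat) : sing_order h k -> sing_order h (Defs.eta h).
Proof. by move=> hk; apply: (@xgetPex _ 0%N [set j | sing_order h j]); exists k. Qed.

Lemma summable_pconv (d : nat -> C) : abssum d -> pconv d.
Proof.
move=> sd z z1; apply: (cvg_series_normc (b := fun k => normc (d k))) => // k.
rewrite normc_M normcX ler_piMr ?normc_ge0// exprn_ile1 ?normc_ge0//; exact: ltW.
Qed.

(** The factor [pser d] is bounded by the sum of the moduli of its coefficients, so
that only the weight [r ^ (2 eta)] in the norm has to be compared with the growth
of [z ^ (- N)]. It compensates when [N <= eta h], which is trivial for [N = 0] and
otherwise holds because the coefficient of [z ^ (- N)] does not vanish. *)
Lemma hardy_pser p (d : nat -> C) (N : nat) h : abssum d -> (N <= p)%N ->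
  (N = 0%N \/ d 0%N != 0) ->
  (forall z, 0 < normc z < 1 -> h z = pser d z * z ^ (- N%:Z)) -> hardy p h.
Proof.
move=> sd Np d0 hE; have cd := summable_pconv sd.
have [hh lh _] := laurent_pser cd hE.
have so : sing_order h N.
  case: N Np d0 hE lh => [|N] Np d0 hE lh.
    exists (pser d); first by apply/holomorphic_unit; exact: hol0_pser.
    by move=> z; rewrite punctured_diskE => zd; rewrite hE// expr0z mulr1.
  exists (pser d).
    split; first by apply/holomorphic_unit; exact: hol0_pser.
    by rewrite pser0; case: d0.
  by move=> z; rewrite punctured_diskE => zd; rewrite hE// -exprnN.
have eN : (N <= Defs.eta h)%N.
  case: d0 => [->//|d0]; rewrite leqNgt; apply/negP => eN.
  have := sing_order_vanish (n := 0%:Z - N%:Z) (eta_spec so).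
  by rewrite lh => H; move/eqP: d0; apply; apply: H; lia.
split; first exact/holomorphic_punctured.
  by exists N.
pose L := limn (series (fun k => normc (d k))).
have L0 : 0 <= L.
  by apply: limr_ge => //; apply: nearW => m; apply: sumr_ge0 => k _; exact: normc_ge0.
have dL z : normc z < 1 -> normc (pser d z) <= L.
  move=> z1; have s0 (V : zmodType) (u : nat -> V) : series u 0%N = 0 by rewrite /series/= big_geq.
  have := @normc_series_tail R (fun k => d k * z ^+ k) (fun k => normc (d k)) 0.
  rewrite !s0 !subr0; apply => // k.
  rewrite normc_M normcX ler_piMr ?normc_ge0// exprn_ile1 ?normc_ge0//; exact: ltW.
apply: (@le_lt_trans _ _ (L ^+ 2)%:E); last by rewrite ltry.
apply: ge_ereal_sup => _ [r /= /[!in_itv]/= r01 <-]; case/andP: (r01) => r0 r1.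
have hb t : normc (h (polar r t)) <= L * (r ^+ N)^-1.
  rewrite hE ?disk_polar// normc_M normc_exprz normc_polar gtr0_norm//.
  rewrite -exprnN ler_wpM2r ?invr_ge0 ?exprn_ge0 ?(ltW r0)//.
  by apply: dL; rewrite normc_polar gtr0_norm.
have mS : measurable (`[0, 2 * pi]%classic : set (measurableTypeR R)) by exact: measurable_itv.
apply: (@le_trans _ _ ((r ^+ (2 * Defs.eta h) / (2 * pi))%:E *
   \int[mu]_(t in `[0%R, (2 * pi)%R]) ((L * (r ^+ N)^-1) ^+ 2)%:E)%E).
  apply: lee_wpmul2l; first by rewrite lee_fin divr_ge0 ?pi2_ge0// exprn_ge0// ltW.
  apply: ge0_le_integral => //.
  - by move=> t _; rewrite lee_fin sqr_ge0.
  - apply/measurable_EFinP; apply: measurable_funTS; apply: continuous_measurable_fun => t.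
    have H := @rcont_normc R _ (rcont_hol hh r01) t.
    exact: (cvgM H H).
  - move=> t _; rewrite lee_fin ler_sqr ?nnegrE ?normc_ge0//.
    by apply: le_trans (hb t); exact: normc_ge0.
rewrite integral_cst//= lebesgue_measure_itv/= lte_fin pi2_gt0 -EFinD subr0 -!EFinM lee_fin.
have -> : r ^+ (2 * Defs.eta h) / (2 * pi) * ((L * (r ^+ N)^-1) ^+ 2 * (2 * pi)) =
    L ^+ 2 * r ^+ (2 * (Defs.eta h - N)).
  rewrite -{1}(subnKC eN) mulnDr exprD exprMn -exprVn -!exprM ![(N * 2)%N]mulnC exprVn.
  have q0 : r ^+ (2 * N) != 0 by rewrite expf_neq0// gt_eqF.
  move: (r ^+ _) (r ^+ _) (2 * pi) (L ^+ 2) (pi2_gt0 R) q0 => x y u v u0 q0.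
  by field; rewrite q0 (gt_eqF u0).
by rewrite ler_piMr ?sqr_ge0// exprn_ile1// ltW.
Qed.

End HardySpace.

(** * The two components of a function of the Hardy-Dirichlet space *)

Section HardyDirichlet.
Variable R : realType.
Local Notation C := (cplx R).
Local Notation Re := (@complex.Re R).
Local Notation Im := (@complex.Im R).
Local Notation mu := (@lebesgue_measure R).
Implicit Types (z w : C) (r s t : R) (f g h : C -> C) (n : int).

Lemma laurentB f g n : hol f -> hol g ->
  laurent (fun z => f z - g z) n = laurent f n - laurent g n.
Proof.
move=> hf hg; have cf := rcont_lcoef (n := - n) hf (@half01 R); have cg := rcont_lcoef (n := - n) hg (@half01 R).
rewrite /laurent /lcoef -(cavgB cf cg).
by apply: eq_cavg => t; rewrite mulrBl.
Qed.

(** The factor by which the derivative of order [m] multiplies [z ^ n]; it vanishes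
exactly when [0 <= n < m]. *)
Definition ffall (m : nat) n : C := \prod_(i < m) (n - i%:Z)%:~R.

Lemma hol_derive1n m f : hol f -> hol (derive1n m f).
Proof. by move=> hf; elim: m => [|m IH]; [exact: hf|exact: (hol_derive1 IH)]. Qed.

Lemma laurent_derive1n m f n : hol f ->
  laurent (derive1n m f) (n - m%:Z) = ffall m n * laurent f n.
Proof.
move=> hf; elim: m => [|m IH]; first by rewrite subr0 /ffall big_ord0 mul1r.
rewrite /ffall big_ord_recr/= -/(ffall m n) mulrAC -IH.
have -> : n - m.+1%:Z = (n - m%:Z) - 1 by lia.
by rewrite [LHS](laurent_derive1 _ (hol_derive1n (m := m) hf)) mulrC.
Qed.

Lemma ffall_eq0 m n : (ffall m n == 0) = (0 <= n < m%:Z).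
Proof.
rewrite /ffall; apply/idP/idP.
  move=> /eqP/eqP; rewrite prodf_seq_eq0 => /hasP[i _ /=].
  by rewrite intr_eq0 => /eqP H; have := ltn_ord i; lia.
case: n => // n; rewrite ltz_nat => /= nm.
by rewrite (bigD1 (Ordinal nm))//= subrr mul0r.
Qed.

Lemma laurent_expansion_laurent f (N : nat) : hol f ->
  (forall n, n < - N%:Z -> laurent f n = 0) -> laurent_expansion N f (laurent f).
Proof.
move=> hf f0; split => // z; rewrite punctured_diskE => zd.
exact: (laurent_series hf f0 zd).
Qed.

Definition low_coefs (m : nat) (b : nat -> C) : nat -> C := fun k => if (k < m)%N then b k else 0.

Lemma series_cut m (b u : nat -> C) : (forall k, (m <= k)%N -> b k = 0) ->
  series (fun k => b k * u k) @ \oo --> (\sum_(k < m) b k * u k : C).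
Proof.
move=> b0; have : (fun=> \sum_(k < m) b k * u k : C) @ \oo --> (\sum_(k < m) b k * u k : C).
  exact: cvgC_cst.
apply: cvg_trans; apply: near_eq_cvg; near=> j.
have mj : (m <= j)%N by near: j; exact: nbhs_infty_ge.
rewrite /series/= -(subnKC mj); elim: (j - m)%N => [|i IH]; first by rewrite addn0 big_mkord.
by rewrite addnS big_nat_recr//= -IH b0 ?leq_addr// mul0r addr0.
Unshelve. all: by end_near. Qed.

(** On the punctured disk the sum of the series is a power series times
[z ^ (- N)], and integration recovers its coefficients. *)
Lemma laurent_expansion_unique f (N : nat) (a : int -> C) :
  laurent_expansion N f a -> a = laurent f.
Proof.
move=> [a0 aS].
have H z : 0 < normc z < 1 ->
    series (fun k : nat => a (k%:Z - N%:Z) * z ^+ k) @ \oo --> f z * z ^ N%:Z.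
  move=> zd; have z0 := neq0_disk zd.
  have S := aS z; rewrite punctured_diskE in S; have {}S := S zd.
  have -> : series (fun k : nat => a (k%:Z - N%:Z) * z ^+ k) =
      (fun m => series (fun k : nat => a (k%:Z - N%:Z) * z ^ (k%:Z - N%:Z)) m * z ^ N%:Z).
    apply/funext => m; rewrite /series/= mulr_suml; apply: eq_bigr => k _.
    by rewrite -[RHS]mulrA -(expfzDr _ _ z0) subrK.
  exact: (cvgCM S (cvgC_cst _)).
have ca : pconv (fun k : nat => a (k%:Z - N%:Z)).
  move=> z z1; case: (boolP (z == 0)) => [/eqP ->|z0]; last first.
    by apply/cvg_ex; exists (f z * z ^ N%:Z); apply: H; rewrite z1 andbT normc_gt0.
  apply/cvg_ex; exists (\sum_(k < 1) low_coefs 1 (fun k : nat => a (k%:Z - N%:Z)) k * 0 ^+ k).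
  have -> : (fun k : nat => a (k%:Z - N%:Z) * 0 ^+ k) =
      (fun k => low_coefs 1 (fun k : nat => a (k%:Z - N%:Z)) k * 0 ^+ k).
    by apply/funext => -[|k]; rewrite /low_coefs// exprS mul0r !mulr0.
  by apply: series_cut => -[].
have fE z : 0 < normc z < 1 -> f z = pser (fun k : nat => a (k%:Z - N%:Z)) z * z ^ (- N%:Z).
  move=> zd; rewrite /pser (cvg_lim (@cplx_hausdorff R) (H z zd)) -[RHS]mulrA.
  by rewrite -(expfzDr _ _ (neq0_disk zd)) subrr expr0z mulr1.
have [_ l1 l2] := laurent_pser ca fE.
apply/funext => n; case: (ltP n (- N%:Z)) => nN; first by rewrite a0// l2.
have -> : n = (`|(n + N%:Z)%R|%N)%:Z - N%:Z by lia.
by rewrite l1.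
Qed.

Lemma laurent_coefE m p f : hol f ->
  (forall n, n < - (p - m)%N%:Z -> laurent f n = 0) -> laurent_coef m p f = laurent f.
Proof.
move=> hf f0; apply: (@laurent_expansion_unique f (p - m)).
apply: (@xgetPex _ (fun=> 0) [set a | laurent_expansion (p - m) f a]).
by exists (laurent f); exact: laurent_expansion_laurent.
Qed.

(** A derivative of order [m] kills no negative power of [z], so that its pole of
order at most [p] leaves [f] a pole of order at most [p - m]. *)
Lemma hardy_dirichlet_vanish m p f n : hardy_dirichlet m p f ->
  n < - (p - m)%N%:Z -> laurent f n = 0.
Proof.
move=> [/holomorphic_punctured hf /hardy_laurent[_ h0 _]] np.
have := laurent_derive1n m n hf; rewrite h0; last by lia.
move/esym/eqP; rewrite mulf_eq0 ffall_eq0 => /orP[|/eqP//].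
by move=> /andP[]; lia.
Qed.

Lemma low_partE m p f z : hardy_dirichlet m p f ->
  low_part m p f z = \sum_(k < m) laurent f k%:Z * z ^+ k.
Proof.
move=> hf; have [/holomorphic_punctured hol_f _] := hf.
by rewrite /low_part laurent_coefE// => n; exact: (hardy_dirichlet_vanish hf).
Qed.

Lemma pser_cut m (b : nat -> C) z : pser (low_coefs m b) z = \sum_(k < m) b k * z ^+ k.
Proof.
have -> : \sum_(k < m) b k * z ^+ k = \sum_(k < m) low_coefs m b k * z ^+ k.
  by apply: eq_bigr => k _; rewrite /low_coefs ltn_ord.
apply: (cvg_lim (@cplx_hausdorff R)); apply: series_cut => k mk.
by rewrite /low_coefs ltnNge mk.
Qed.

Lemma abssum_cut m (b : nat -> C) : abssum (low_coefs m b).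
Proof.
apply/cvg_ex; exists (\sum_(k < m) normc (low_coefs m b k)).
have : (fun=> \sum_(k < m) normc (low_coefs m b k)) @ \oo --> (\sum_(k < m) normc (low_coefs m b k)).
  exact: cvg_cst.
apply: cvg_trans; apply: near_eq_cvg; near=> j.
have mj : (m <= j)%N by near: j; exact: nbhs_infty_ge.
rewrite /series/= -(subnKC mj); elim: (j - m)%N => [|i IH]; first by rewrite addn0 big_mkord.
by rewrite addnS big_nat_recr//= -IH /low_coefs ltnNge leq_addr/= normc_0 addr0.
Unshelve. all: by end_near. Qed.

Lemma sqsum_cut m (b : nat -> C) : sqsum (low_coefs m b).
Proof.
have E : (fun k => normc (low_coefs m b k) ^+ 2) =
    (fun k => normc (low_coefs m (fun k => b k * conjc (b k)) k)).
  apply/funext => k; rewrite /low_coefs; case: ifP => _; last by rewrite normc_0 expr0n.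
  by rewrite normc_M normc_conj.
rewrite /sqsum E; exact: (@abssum_cut m (fun k => b k * conjc (b k))).
Qed.

Lemma hol_poly m (b : nat -> C) : hol (fun z => \sum_(k < m) b k * z ^+ k).
Proof.
move=> z zd; have E : (fun z => \sum_(k < m) b k * z ^+ k) = pser (low_coefs m b).
  by apply/funext => y; rewrite pser_cut.
have H := hol0_pser (summable_pconv (@abssum_cut m b)).
by rewrite E; apply: H; case/andP: zd.
Qed.

Lemma laurent_poly m (b : nat -> C) n : laurent (fun z => \sum_(k < m) b k * z ^+ k) n =
  if 0 <= n < m%:Z then b `|n|%N else 0.
Proof.
have fE z : 0 < normc z < 1 -> \sum_(k < m) b k * z ^+ k = pser (low_coefs m b) z * z ^ (- 0%:Z).
  by move=> zd; rewrite pser_cut expr0z mulr1.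
have [_ l1 l2] := laurent_pser (summable_pconv (@abssum_cut m b)) fE.
 case: n => n.
  by have := l1 n; rewrite subr0 => ->; rewrite /low_coefs ltz_nat.
by rewrite l2.
Qed.

Section HighPart.
Variables (m p : nat) (f : C -> C).
Hypothesis fHD : hardy_dirichlet m p f.

Let hf : hol f. Proof. by case: fHD => /holomorphic_punctured. Qed.

Definition high_part z := f z - low_part m p f z.

Let highE : high_part = (fun z => f z - \sum_(k < m) laurent f k%:Z * z ^+ k).
Proof. by apply/funext => z; rewrite /high_part low_partE. Qed.

Let hol_high : hol high_part.
Proof.
have hp := hol_poly (m := m) (b := fun k => laurent f k%:Z).
move=> z zd; rewrite highE; exact: (derivableB (hf zd) (hp z zd)).
Qed.

Let laurent_high n : laurent high_part n = if 0 <= n < m%:Z then 0 else laurent f n.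
Proof.
have hp := hol_poly (m := m) (b := fun k => laurent f k%:Z).
rewrite highE (laurentB _ hf hp) (laurent_poly _ (fun k => laurent f k%:Z)); case: ifP => [/andP[n0 _]|_]; last by rewrite subr0.
by rewrite gez0_abs// subrr.
Qed.

(** The powers removed from [f] are those that the derivative of order [m] kills. *)
Lemma laurent_high_derive n : laurent (derive1n m high_part) n = laurent (derive1n m f) n.
Proof.
have -> : n = (n + m%:Z) - m%:Z by rewrite addrK.
rewrite (laurent_derive1n _ _ hol_high) (laurent_derive1n _ _ hf) laurent_high; case: ifP => // H.
by move: H; rewrite -ffall_eq0 => /eqP ->; rewrite !mul0r.
Qed.

Lemma high_derive_pser z : 0 < normc z < 1 ->
  derive1n m high_part z =
  pser (fun k : nat => laurent (derive1n m f) (k%:Z - p%:Z)) z * z ^ (- p%:Z).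
Proof.
move=> zd; have [_ /hardy_laurent[_ h0 _]] := fHD.
rewrite (pser_laurent (N := p) (hol_derive1n (m := m) hol_high) _ zd).
  have -> // : (fun k : nat => laurent (derive1n m high_part) (k%:Z - p%:Z)) =
      (fun k : nat => laurent (derive1n m f) (k%:Z - p%:Z)).
  by apply/funext => k; rewrite laurent_high_derive.
by move=> n np; rewrite laurent_high_derive h0.
Qed.

(** The series may be indexed from [m - p] on, which aligns its terms with the
coefficients, indexed from [- p] on, of the derivative of order [m]. When [p < m]
the powers that are left out are among those that the high part lacks. *)
Lemma high_part_series z : 0 < normc z < 1 ->
  series (fun k : nat => laurent high_part (k%:Z - p%:Z + m%:Z) * z ^ (k%:Z - p%:Z + m%:Z))
    @ \oo --> high_part z.
Proof.
move=> zd.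
have v n : n < - p%:Z + m%:Z -> laurent high_part n = 0.
  move=> np; rewrite laurent_high; case: ifP => // /negbT H.
  apply: (hardy_dirichlet_vanish fHD); lia.
have v' n : n < - p%:Z -> laurent high_part n = 0 by move=> np; apply: v; lia.
have S := laurent_series hol_high v' zd.
have {}S := cvg_comp _ _ (cvg_addnr m) S.
have E : series (fun k : nat => laurent high_part (k%:Z - p%:Z + m%:Z) * z ^ (k%:Z - p%:Z + m%:Z)) =
    series (fun k : nat => laurent high_part (k%:Z - p%:Z) * z ^ (k%:Z - p%:Z)) \o (addn^~ m).
  apply/funext => j /=; elim: j => [|j IH].
    rewrite add0n /series/= big_geq// big_nat big1// => k /andP[_ km].
    by rewrite v ?mul0r//; lia.
  rewrite addSn; move: IH; rewrite /series/= !big_nat_recr//= => ->.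
  by rewrite PoszD (addrAC j%:Z m%:Z).
by rewrite E.
Qed.

Lemma high_laurentE n : laurent high_part n = if 0 <= n < m%:Z then 0 else laurent f n.
Proof. exact: laurent_high. Qed.

End HighPart.

End HardyDirichlet.

(** * The Laurent coefficients of the kernel *)

Section Kernel.
Variable R : realType.
Local Notation C := (cplx R).
Local Notation Re := (@complex.Re R).
Local Notation Im := (@complex.Im R).
Implicit Types (z w xi : C) (r s t : R) (f g h : C -> C) (n : int).

(** The coefficients of the kernel as a series in [z (conj w)], one for each
integer power: [1] from [0] to [m - 1], and otherwise the inverse square of the
factor by which the derivative of order [m] multiplies that power. *)
Definition kcoef (m p : nat) n : R :=
  match n with
  | Posz j => if (j < m)%N then 1 else ((j - m)`!%:R / j`!%:R) ^+ 2
  | Negz k => if (k < p - m)%N then (k`!%:R / (m + k)`!%:R) ^+ 2 else 0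
  end.

Lemma fact_ratio_bound (i j : nat) : (i <= j)%N ->
  0 <= (i`!%:R / j`!%:R : R) <= 1.
Proof.
move=> ij; rewrite divr_ge0//= ler_pdivrMr ?ltr0n ?fact_gt0// mul1r ler_nat.
by rewrite leq_fact.
Qed.

Lemma kcoef_bound m p n : 0 <= kcoef m p n <= 1.
Proof.
case: n => k /=; case: ifP => _; rewrite ?ler01 ?lexx//.
- have /andP[a b] := fact_ratio_bound (leq_subr m k).
  by rewrite exprn_ge0//= exprn_ile1.
- have /andP[a b] := fact_ratio_bound (leq_addl m k).
  by rewrite exprn_ge0//= exprn_ile1.
Qed.

Lemma realC_nat (k : nat) : (k%:R)%:C = k%:R :> C.
Proof. exact: rmorph_nat. Qed.

Lemma realC_N r : (- r)%:C = - r%:C :> C.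
Proof. exact: rmorphN. Qed.

Lemma fact_ffall (m j : nat) : (m <= j)%N ->
  ffall R m j%:Z = ((j`!%:R / (j - m)`!%:R : R))%:C.
Proof.
elim: m => [|m IH] mj; first by rewrite subn0 divff ?pnatr_eq0 -?lt0n ?fact_gt0// /ffall big_ord0.
rewrite /ffall big_ord_recr/= -/(ffall _ _ _) IH ?(ltnW mj)//.
have -> : j%:Z - m%:Z = (j - m)%N%:Z by lia.
rewrite -pmulrn -realC_nat -realC_M; congr (_%:C).
have -> : (j - m)%N = (j - m.+1).+1 by lia.
rewrite factS natrM.
have : ((j - m.+1).+1%:R : R) != 0 by rewrite pnatr_eq0.
have : ((j - m.+1)`!%:R : R) != 0 by rewrite pnatr_eq0 -lt0n fact_gt0.
by move: (_.+1%:R) (_`!%:R) (j`!%:R) => u v q u0 v0; field; rewrite u0 v0.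
Qed.

Lemma ffall_neg (m k : nat) : ffall R m (Negz k) =
  ((-1) ^+ m * ((m + k)`!%:R / k`!%:R) : R)%:C.
Proof.
elim: m => [|m IH].
  by rewrite /ffall big_ord0 expr0 mul1r add0n divff// pnatr_eq0 -lt0n fact_gt0.
rewrite /ffall big_ord_recr/= -/(ffall _ _ _) IH.
have -> : Negz k - m%:Z = - (m + k).+1%:Z by lia.
rewrite mulrNz -pmulrn -realC_nat -realC_N -realC_M; congr (_%:C).
rewrite exprS addSn factS natrM.
by field; rewrite pnatr_eq0 -lt0n fact_gt0.
Qed.

(** This is what makes the kernel reproduce: in the inner product of two high parts
the coefficients of [z ^ n] meet with the weight [|ffall m n| ^ 2], and the kernel
carries the inverse of that weight. *)
Lemma ffall_sq_kcoef m p n : ~~ (0 <= n < m%:Z) -> - (p - m)%N%:Z <= n ->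
  ffall R m n * conjc (ffall R m n) * (kcoef m p n)%:C = 1.
Proof.
case: n => k; last first.
  move=> _ pk; rewrite ffall_neg conjc_R -!realC_M /=.
  have -> : (k < p - m)%N by lia.
  rewrite -[RHS]/(1%:C); congr (_%:C).
  rewrite -!expr2 exprMn -exprM mulnC exprM sqrrN !expr1n mul1r -exprMn.
  have e1 : (k`!%:R : R) != 0 by rewrite pnatr_eq0 -lt0n fact_gt0.
  have e2 : ((m + k)`!%:R : R) != 0 by rewrite pnatr_eq0 -lt0n fact_gt0.
  by field; rewrite e1 e2.
rewrite ltz_nat /= -leqNgt => mk _; rewrite fact_ffall// conjc_R ltnNge mk/= -!realC_M.
rewrite -[RHS]/(1%:C); congr (_%:C).
have e1 : (k`!%:R : R) != 0 by rewrite pnatr_eq0 -lt0n fact_gt0.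
have e2 : ((k - m)`!%:R : R) != 0 by rewrite pnatr_eq0 -lt0n fact_gt0.
by field; rewrite e1 e2.
Qed.

Lemma ffall_kcoef_le m p n : normc (ffall R m n) * kcoef m p n <= 1.
Proof.
have [H|H] := boolP (0 <= n < m%:Z).
  by move: H; rewrite -(ffall_eq0 R) => /eqP ->; rewrite normc_0 mul0r.
have [pn|pn] := leP (- (p - m)%N%:Z) n; last first.
  have -> : kcoef m p n = 0; last by rewrite mulr0.
  by case: n pn {H} => k /=; [lia|move=> pk; case: ifP => //; lia].
have := ffall_sq_kcoef H pn; rewrite mul_conjc -realC_M => /(congr1 Re)/=.
have /andP[k0 k1] := kcoef_bound m p n; have := normc_ge0 (ffall R m n).
move: k0 k1; set x := normc _; set y := kcoef _ _ _ => y0 y1 x0 E.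
have : (x * y) ^+ 2 <= 1 by rewrite exprMn [y ^+ 2]expr2 mulrA E mul1r.
by rewrite expr_le1// mulr_ge0.
Qed.

Lemma bounded_pconv (b : nat -> C) : (forall k, normc (b k) <= 1) -> pconv b.
Proof.
move=> b1 z z1; apply: (cvg_series_normc (b := fun k => normc z ^+ k)).
  by move=> k; rewrite normc_M normcX ler_piMl// exprn_ge0// normc_ge0.
have z2 : `|normc z| < 1 by rewrite ger0_norm ?normc_ge0.
have -> : (fun k => normc z ^+ k) = geometric 1 (normc z).
  by apply/funext => k; rewrite /geometric/= mul1r.
by apply/cvg_ex; eexists; exact: (cvg_geometric_series (a := 1) z2).
Qed.

(** The hypothesis [z != 0] allows division by [z ^ M] in the partial sums. *)
Lemma pser_split (b : nat -> C) (M : nat) z : pconv b -> z != 0 -> normc z < 1 ->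
  pser b z = \sum_(k < M) b k * z ^+ k + z ^+ M * pser (fun k => b (k + M)%N) z.
Proof.
move=> cb z0 z1; have H := cvg_pser cb z1.
have {}H := cvg_comp _ _ (cvg_addnr M) H.
have E : series (fun k => b k * z ^+ k) \o (addn^~ M) =
   (fun j => \sum_(k < M) b k * z ^+ k + z ^+ M * series (fun k => b (k + M)%N * z ^+ k) j).
  apply/funext; elim => [|j IH] /=.
    by rewrite add0n /series/= [X in _ * X]big_geq// mulr0 addr0 big_mkord.
  rewrite addSn; move: IH; rewrite /series/= !big_nat_recr//= => ->.
  rewrite [in RHS]mulrDr [RHS]addrA; congr (_ + _).
  by rewrite exprD [RHS]mulrCA; congr (_ * _); exact: mulrC.
have G : series (fun k => b (k + M)%N * z ^+ k) @ \oo -->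
    (pser b z - \sum_(k < M) b k * z ^+ k) / z ^+ M.
  have -> : series (fun k => b (k + M)%N * z ^+ k) =
      (fun j => ((series (fun k => b k * z ^+ k) \o (addn^~ M)) j - \sum_(k < M) b k * z ^+ k) / z ^+ M).
    by rewrite E; apply/funext => j; rewrite [X in X - _]addrC addrK mulrC mulKf ?expf_neq0.
  exact: (cvgCM (cvgCB H (cvgC_cst _)) (cvgC_cst _)).
rewrite [in RHS]/pser (cvg_lim (@cplx_hausdorff R) G) mulrC divfK ?expf_neq0//.
by rewrite addrC subrK.
Qed.

Lemma pochhammer1 (k : nat) : pochhammer (1 : R) k = k`!%:R.
Proof.
rewrite /pochhammer; elim: k => [|k IH]; first by rewrite big_ord0.
by rewrite big_ord_recr/= IH factS natrM mulrC nat1r.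
Qed.

Lemma pochhammerS (m k : nat) : pochhammer (m.+1%:R : R) k = (m + k)`!%:R / m`!%:R.
Proof.
have m0 : (m`!%:R : R) != 0 by rewrite pnatr_eq0 -lt0n fact_gt0.
rewrite /pochhammer; elim: k => [|k IH]; first by rewrite big_ord0 addn0 divff.
by rewrite big_ord_recr/= IH -natrD addSn addnS factS natrM mulrAC [_%:R * _]mulrC.
Qed.

Definition fact_ratio (m k : nat) : R := (k`!%:R / (m + k)`!%:R) ^+ 2.

Lemma fact_ratio_le m k : 0 <= fact_ratio m k <= 1.
Proof.
have /andP[a b] := fact_ratio_bound (leq_addl m k).
by rewrite exprn_ge0//= exprn_ile1.
Qed.

(** Abstracts what the two hypergeometric series of the statement share: the squared
ratios of factorials, and a further factor [c]. *)
Lemma hypergeometric_scale (a b : seq R) (c : nat -> R) m xi :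
  (forall k, ((\prod_(x <- a) pochhammer x k) / (\prod_(x <- b) pochhammer x k)) / k`!%:R =
    m`!%:R ^+ 2 * (fact_ratio m k * c k)) ->
  cvgn (series (fun k => (fact_ratio m k * c k)%:C * xi ^+ k : C)) ->
  xi ^+ m / m`!%:R ^+ 2 * hypergeometric a b xi =
  xi ^+ m * pser (fun k => (fact_ratio m k * c k)%:C) xi.
Proof.
move=> E cv; rewrite -mulrA; congr (_ * _).
have m0 : (m`!%:R : C) ^+ 2 != 0 by rewrite expf_neq0// -realC_nat -normc_eq0 normc_real normr_eq0 pnatr_eq0 -lt0n fact_gt0.
apply: (mulfI m0); rewrite mulVKf//; apply: (cvg_lim (@cplx_hausdorff R)).
have -> : series (fun k : nat =>
    ((\prod_(x <- a) pochhammer x k) / (\prod_(x <- b) pochhammer x k))%:C *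
    (xi ^+ k / k`!%:R) : C) =
    (fun M => m`!%:R ^+ 2 * series (fun k => (fact_ratio m k * c k)%:C * xi ^+ k : C) M).
  apply/funext => M; rewrite /series/= mulr_sumr; apply: eq_bigr => k _.
  rewrite -!realC_nat -[(m`!%:R)%:C ^+ 2]rmorphXn/= [RHS]mulrA -realC_M -E.
  move: (\prod_(x <- a) _ / \prod_(x <- b) _) (k`!%:R) (xi ^+ k) => A q y.
  by rewrite realC_M realC_V mulrAC mulrA.
exact: (cvgCM (cvgC_cst _) cv).
Qed.

Lemma fact_ratio_cvg m (c : nat -> R) xi : pconv (fun k => (c k)%:C : C) ->
  normc xi < 1 -> cvgn (series (fun k => (fact_ratio m k * c k)%:C * xi ^+ k : C)).
Proof.
move=> cc x1; have r01 : 0 <= normc xi < 1 by rewrite normc_ge0.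
apply: (cvg_series_normc _ (pconv_summable cc r01)) => k.
have /andP[f0 f1] := fact_ratio_le m k.
rewrite normc_M normcX !normc_real normrM (ger0_norm f0).
by rewrite ler_wpM2r ?exprn_ge0 ?normc_ge0// ler_piMl.
Qed.

Lemma one_pconv : pconv (fun=> 1%:C : C).
Proof. by apply: bounded_pconv => k; rewrite normc_real normr1. Qed.

Lemma hypergeometric_termE (m k : nat) (A B : R) : B != 0 ->
  k`!%:R * (k`!%:R * (k`!%:R * A)) / ((m + k)`!%:R / m`!%:R * ((m + k)`!%:R / m`!%:R * B)) / k`!%:R =
  m`!%:R ^+ 2 * (fact_ratio m k * (A / B)).
Proof.
move=> B0; rewrite /fact_ratio.
have : (k`!%:R : R) != 0 by rewrite pnatr_eq0 -lt0n fact_gt0.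
have : ((m + k)`!%:R : R) != 0 by rewrite pnatr_eq0 -lt0n fact_gt0.
have : (m`!%:R : R) != 0 by rewrite pnatr_eq0 -lt0n fact_gt0.
by move: (m`!%:R) ((m + k)`!%:R) (k`!%:R) => x y u x0 y0 u0; field; rewrite x0 y0 u0 B0.
Qed.

Lemma hypergeometric1 m xi : normc xi < 1 ->
  xi ^+ m / m`!%:R ^+ 2 * hypergeometric [:: 1; 1; 1] [:: m.+1%:R; m.+1%:R] xi =
  xi ^+ m * pser (fun k => (fact_ratio m k * 1)%:C) xi.
Proof.
move=> x1; apply: hypergeometric_scale => [k|]; last exact: fact_ratio_cvg one_pconv x1.
rewrite !big_cons !big_nil !pochhammer1 !pochhammerS.
have := @hypergeometric_termE m k 1 1 (oner_neq0 _).
by rewrite divr1.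
Qed.

(** Cut the series at the powers [0] and [m]. The negative powers are [kernelC] in
the reverse order, the powers below [m] a geometric sum, and the other ones the
hypergeometric series. *)
Lemma kernelH_pser m p xi : 0 < normc xi < 1 ->
  kernelH m p xi = pser (fun k : nat => (kcoef m p (k%:Z - (p - m)%N%:Z))%:C) xi *
    xi ^ (- (p - m)%N%:Z).
Proof.
move=> xd; have xi0 := neq0_disk xd; case/andP: xd => _ x1.
set N := (p - m)%N; pose b (k : nat) : C := (kcoef m p (k%:Z - N%:Z))%:C.
have cb : pconv b.
  apply: bounded_pconv => k; have /andP[k0 k1] := kcoef_bound m p (k%:Z - N%:Z).
  by rewrite normc_real ger0_norm.
have cb' : pconv (fun k => b (k + N)%N).
  apply: bounded_pconv => k; have /andP[k0 k1] := kcoef_bound m p ((k + N)%N%:Z - N%:Z).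
  by rewrite normc_real ger0_norm.
rewrite -/b (pser_split N cb xi0 x1) (pser_split m cb' xi0 x1).
have xN : xi ^+ N != 0 by rewrite expf_neq0.
have xi1 := subr_neq0_lt1 x1.
rewrite -exprnN mulrDl [xi ^+ N * _]mulrC mulfK// /kernelH -addrA [RHS]addrC -!addrA.
congr (_ + (_ + _)).
- have -> : \sum_(k < m) b (k + N)%N * xi ^+ k = \sum_(k < m) xi ^+ k.
    apply: eq_bigr => k _; rewrite /b PoszD addrK /= ltn_ord.
    by rewrite -[1%:C]/(1 : C) mul1r.
  apply: (mulIf xi1); rewrite divfK// -[1 in LHS](expr1n _ m) subrXX mulrC; congr (_ * _).
  by apply: eq_bigr => k _; rewrite expr1n mul1r.
- rewrite hypergeometric1//.
  have -> // : (fun k => (fact_ratio m k * 1)%:C) = (fun k => b (k + m + N)%N).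
  apply/funext => k; rewrite /b PoszD addrK /= ltnNge leq_addl/=.
  by rewrite mulr1 /fact_ratio addnK [(m + k)%N]addnC.
- rewrite /kernelC -/N mulr_suml (reindex_inj rev_ord_inj)/=; apply: eq_bigr => k _.
  have kN := ltn_ord k; rewrite /b.
  have -> : (k : nat)%:Z - N%:Z = Negz (N - k.+1)%N by lia.
  have kN' : (N - k.+1 < p - m)%N by rewrite -/N; lia.
  rewrite /= kN' -[RHS]mulrA; congr (_ * _); rewrite subnSK//.
  have EN : xi ^+ N = xi ^+ (N - k) * xi ^+ k by rewrite -exprD subnK// ltnW.
  by apply: (mulIf xN); rewrite divfK// EN mulrA mulVf ?mul1r// expf_neq0.
Qed.

End Kernel.

(** * Right continuity and positivity of the Gamma function *)

Section GammaFunction.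
Variable R : realType.
Local Notation mu := (@lebesgue_measure R).
Implicit Types (x y t e : R).

(** From [1 + t <= n (1 + t / n) <= n exp (t / n)], with [n + 1] for [n]. *)
Lemma expR_dominates (n : nat) t : 0 <= t -> (1 + t) ^+ n.+1 <= n.+1%:R ^+ n.+1 * expR t.
Proof.
move=> t0; have n0 : (0 : R) < n.+1%:R by [].
have H : 1 + t <= n.+1%:R * expR (t / n.+1%:R).
  apply: le_trans (ler_wpM2l (ltW n0) (expR_ge1Dx _)).
  by rewrite mulrDr mulr1 mulrCA divff ?gt_eqF// mulr1 lerD2r ler1n.
apply: le_trans (_ : (n.+1%:R * expR (t / n.+1%:R)) ^+ n.+1 <= _).
  by rewrite lerXn2r ?nnegrE ?addr_ge0 ?mulr_ge0 ?expR_ge0.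
by rewrite exprMn -expRM_natr divfK// gt_eqF.
Qed.

(** The derivative of [- (x (1 + t ^ x)) ^ -1], a bounded function of [t > 0]; near the
origin it has the singularity of the integrand of the Gamma function. *)
Definition gamma_majorant x t : R := t `^ (x - 1) / (1 + t `^ x) ^+ 2.

Lemma gamma_majorant_ge0 x t : 0 <= gamma_majorant x t.
Proof. by rewrite divr_ge0 ?powR_ge0 ?sqr_ge0. Qed.

Lemma powR1D_gt0 x t : 0 < 1 + t `^ x.
Proof. by rewrite ltr_pwDl ?powR_ge0. Qed.

Lemma is_derive_gamma_majorant x t : 0 < x -> 0 < t ->
  is_derive t 1 (fun s => - (x * (1 + s `^ x))^-1) (gamma_majorant x t).
Proof.
move=> x0 t0; have p0 := powR1D_gt0 x t.
have d1 : is_derive t 1 (fun s => x * (1 + s `^ x)) (x * (x * t `^ (x - 1))).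
  have d0 := is_derive1_powR x t0.
  apply: is_derive_eq.
  by rewrite /GRing.scale/= add0r mul1r.
have nz : x * (1 + t `^ x) != 0 by rewrite mulf_neq0 ?gt_eqF.
have d2 := is_deriveN (@is_deriveV R (fun s => x * (1 + s `^ x)) t _ 1 nz d1).
apply: (is_derive_eq d2).
rewrite /gamma_majorant /GRing.scale/=.
by field; rewrite !gt_eqF.
Qed.

Lemma cvg_powRy x : 0 < x -> t `^ x @[t --> +oo] --> +oo.
Proof.
move=> x0; apply/cvgryPge => A; near=> t.
have t1 : (Num.max 1 A) `^ (x^-1) <= t by near: t; exact: nbhs_pinfty_ge.
have m1 : 0 <= Num.max 1 A by rewrite le_max ler01.
have := ge0_ler_powR (ltW x0) _ _ t1; rewrite !nnegrE powR_ge0 => /(_ isT).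
have tp : 0 <= t by apply: le_trans t1; exact: powR_ge0.
move=> /(_ tp); rewrite -powRrM mulVf ?gt_eqF// powRr1//.
by apply: le_trans; rewrite le_max lexx orbT.
Unshelve. all: by end_near. Qed.

Lemma measurable_gamma_majorant x (D : set (measurableTypeR R)) :
  measurable_fun D (gamma_majorant x).
Proof.
have -> : gamma_majorant x = (fun t => t `^ (x - 1) * (1 + t `^ x) `^ (- 2)).
  apply/funext => t; rewrite powRN -[2]/(2%:R) powR_mulrn// ltW//; exact: powR1D_gt0.
apply: measurable_funTS; apply: measurable_funM; first exact: measurable_powR.
apply: (measurableT_comp (measurable_powR _)).
by apply: measurable_funD => //; exact: measurable_powR.
Qed.

(** The integrand may be singular at the origin, hence the lower end [a > 0]. *)
Lemma integral_gamma_majorant_tail x a : 0 < x -> 0 < a ->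
  (\int[mu]_(t in `[a, +oo[) (gamma_majorant x t)%:E <= (x^-1)%:E)%E.
Proof.
move=> x0 a0.
have pos t : a <= t -> 0 < t by exact: lt_le_trans.
have D t : 0 < t -> is_derive t 1 (fun s => - (x * (1 + s `^ x))^-1) (gamma_majorant x t).
  exact: is_derive_gamma_majorant.
have powc (y t : R) : 0 < t -> s `^ y @[s --> t] --> t `^ y.
  by move=> t0; have [/derivable1_diffP/differentiable_continuous H _] := is_derive1_powR y t0.
have gc t : 0 < t -> gamma_majorant x s @[s --> t] --> gamma_majorant x t.
  move=> t0; have nz : (1 + t `^ x) ^+ 2 != 0 by rewrite expf_neq0 ?gt_eqF ?powR1D_gt0.
  have h : 1 + s `^ x @[s --> t] --> 1 + t `^ x by exact: (cvgD (cvg_cst _) (powc x t t0)).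
  exact: (cvgM (powc (x - 1) t t0) (cvgV nz (cvgM h h))).
have lim0 : (fun s => - (x * (1 + s `^ x))^-1) @ +oo --> (0 : R).
  have l1 : (fun s => 1 + s `^ x) @ +oo --> +oo.
    apply/cvgryPge => A; have /cvgryPge/(_ (A - 1)) := cvg_powRy x0.
    by apply: filterS => t; rewrite lerBlDl.
  have l2 : (fun s => x * (1 + s `^ x)) @ +oo --> +oo by exact: (gt0_cvgMry x0 l1).
  have ps : \forall s \near +oo, 0 < x * (1 + s `^ x).
    by apply: nearW => s; rewrite mulr_gt0 ?powR1D_gt0.
  have l3 : (fun s => (x * (1 + s `^ x))^-1) @ +oo --> (0 : R).
    exact: (gtr0_cvgV0 ps).2 l2.
  by rewrite -[0]oppr0; exact: (cvgN l3).
have Fa : (fun s => - (x * (1 + s `^ x))^-1) s @[s --> a^'+] --> - (x * (1 + a `^ x))^-1.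
  apply: cvg_at_right_filter.
  by have [/derivable1_diffP/differentiable_continuous H _] := D a a0.
rewrite (ge0_continuous_FTC2y _ _ lim0 _ Fa).
- rewrite -EFinB sub0r opprK lee_fin lef_pV2 ?posrE ?mulr_gt0 ?powR1D_gt0//.
  by rewrite ler_peMr ?(ltW x0)// lerDl powR_ge0.
- by move=> t _; exact: gamma_majorant_ge0.
- apply: continuous_in_subspaceT => t; rewrite inE/= in_itv/= andbT => /pos; exact: gc.
- by move=> t /ltW/pos/D[].
- by move=> t; rewrite in_itv/= andbT derive1E => /ltW/pos/D[_ ->].
Qed.

Lemma integrable_gamma_majorant x : 0 < x ->
  mu.-integrable `]0, +oo[ (EFin \o gamma_majorant x).
Proof.
move=> x0; apply/integrableP; split.
  by apply/measurable_EFinP; exact: measurable_gamma_majorant.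
under eq_integral => t _ do rewrite /= ger0_norm ?gamma_majorant_ge0//.
pose F (i : nat) : set (measurableTypeR R) := `[i.+1%:R^-1, +oo[%classic.
have E : `]0, +oo[%classic = \bigcup_i F i.
  apply/seteqP; split => t /=; rewrite in_itv/= andbT.
    move=> t0; exists (Num.bound t^-1) => //; rewrite /F/= in_itv/= andbT.
    rewrite -[leRHS]invrK lef_pV2 ?posrE ?invr_gt0//.
    apply: ltW; apply: lt_le_trans (archi_boundP _) _; first by rewrite invr_ge0 ltW.
    by rewrite ler_nat.
  by move=> [i _]; rewrite /F/= in_itv/= andbT; apply: lt_le_trans; rewrite invr_gt0.
have nF : nondecreasing_seq F.
  move=> i j ij; apply/subsetPset => t; rewrite /F/= !in_itv/= !andbT; apply: le_trans.
  by rewrite lef_pV2 ?posrE// ler_nat ltnS.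
have mF i : measurable (F i) by exact: measurable_itv.
have H : (\int[mu]_(t in F i) (gamma_majorant x t)%:E)%E @[i --> \oo] -->
    (\int[mu]_(t in \bigcup_i F i) (gamma_majorant x t)%:E)%E.
  apply: ge0_nondecreasing_set_cvg_integral.
  - exact: nF.
  - exact: mF.
  - by move=> i; apply/measurable_EFinP; exact: measurable_gamma_majorant.
  - by move=> i t _; exact: gamma_majorant_ge0.
rewrite E; apply: (@le_lt_trans _ _ (x^-1)%:E); last by rewrite ltry.
rewrite -(cvg_lim _ H)//; apply: lime_le; first by apply/cvg_ex; eexists; exact: H.
by apply: nearW => i; apply: integral_gamma_majorant_tail; rewrite ?invr_gt0.
Qed.

(** For exponents in a unit interval, [t ^ (y - x) <= 1 + t], and the exponential
dominates every power of [1 + t]. *)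
Lemma gamma_integrand_le x : 0 < x -> exists2 c, 0 < c &
  forall y t, x <= y <= x + 1 -> 0 < t -> t `^ (y - 1) * expR (- t) <= c * gamma_majorant x t.
Proof.
move=> x0; pose k := Num.bound x; pose n := (2 * k)%N.
(* One power of [1 + t] absorbs the variation of the exponent, [2 k] the square. *)
exists (4 * n.+1%:R ^+ n.+1); first by rewrite mulr_gt0// exprn_gt0.
move=> y t /andP[xy yx] t0.
have pk : t `^ x <= (1 + t) ^+ k.
  apply: (@le_trans _ _ ((1 + t) `^ x)).
    by apply: ge0_ler_powR; rewrite ?nnegrE ?(ltW x0) ?(ltW t0) ?addr_ge0 ?(ltW t0)// lerDr.
  rewrite -powR_mulrn ?addr_ge0 ?(ltW t0)//; apply: ler_powR; first by rewrite lerDl ltW.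
  by apply: ltW; exact: archi_boundP (ltW x0).
have pe : t `^ (y - x) <= 1 + t.
  have [t1|t1] := leP 1 t.
    apply: (@le_trans _ _ (t `^ 1)); first by apply: ler_powR => //; lra.
    by rewrite powRr1 ?(ltW t0)// lerDr.
  have : t `^ (y - x) <= 1 `^ (y - x).
    apply: ge0_ler_powR; rewrite ?nnegrE ?(ltW t0) ?(ltW t1)//; lra.
  rewrite powR1; lra.
have -> : t `^ (y - 1) = t `^ (x - 1) * t `^ (y - x).
  by rewrite -powRD; [congr (_ `^ _); ring|rewrite (gt_eqF t0) ?implybT].
have k1 : 1 <= (1 + t) ^+ k by rewrite exprn_ege1// lerDl ltW.
have q0 := powR1D_gt0 x t.
rewrite /gamma_majorant [leRHS]mulrCA -mulrA ler_wpM2l ?powR_ge0//.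
rewrite ler_pdivlMr ?exprn_gt0// expRN mulrAC ler_pdivrMr ?expR_gt0// -mulrA.
apply: le_trans (ler_wpM2l _ (expR_dominates n (ltW t0))); last by [].
have -> : 4 * (1 + t) ^+ n.+1 = (1 + t) * (2 * (1 + t) ^+ k) ^+ 2.
  by rewrite exprS /n mulnC exprM; ring.
apply: ler_pM; rewrite ?powR_ge0 ?sqr_ge0//.
rewrite ler_sqr ?nnegrE ?(ltW q0)//; last by rewrite mulr_ge0// (le_trans _ k1).
lra.
Qed.

Lemma measurable_gamma_integrand y (D : set (measurableTypeR R)) :
  measurable_fun D (fun t : R => t `^ (y - 1) * expR (- t)).
Proof.
apply: measurable_funTS; apply: measurable_funM; first exact: measurable_powR.
exact: measurableT_comp.
Qed.

(** Dominated convergence; one majorant with an explicit antiderivative serves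
all the exponents at distance at most one to the right of [x]. *)
Lemma cvg_Gamma x : 0 < x -> Gamma (x + e) @[e --> (0 : R)^'+] --> Gamma x.
Proof.
move=> x0; have [c c0 Hc] := gamma_integrand_le x0.
apply/cvg_at_rightP => u [u0 ul].
(* Truncation at [1] keeps the exponents where the majorant applies. *)
pose v (j : nat) : R := Num.min (u j) 1.
have v01 j : 0 < v j <= 1 by rewrite /v lt_min u0 ltr01/= ge_min lexx orbT.
have un : \forall j \near \oo, v j = u j.
  have /cvgrPdist_le/(_ 1 ltr01) := ul; apply: filterS => j.
  by rewrite sub0r normrN => /(le_trans (ler_norm _))/min_l.
have vl : v @ \oo --> (0 : R).
  by apply: cvg_trans ul; apply: near_eq_cvg; apply: filterS un => j ->.
have mD : measurable (`]0, +oo[%classic : set (measurableTypeR R)) by exact: measurable_itv.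
pose f (j : nat) (t : R) := (t `^ (x + v j - 1) * expR (- t))%:E.
have [] := @dominated_convergence _ _ _ mu `]0, +oo[%classic mD f
  (fun t => (t `^ (x - 1) * expR (- t))%:E) (EFin \o (fun t => c * gamma_majorant x t)).
- by move=> j; apply/measurable_EFinP; exact: measurable_gamma_integrand.
- by apply/measurable_EFinP; exact: measurable_gamma_integrand.
- apply: aeW => t /=; rewrite in_itv/= andbT => t0; rewrite /f.
  apply: cvg_EFin; first exact: nearW.
  apply: cvgM; last exact: cvg_cst.
  have -> : (fun j => t `^ (x + v j - 1)) = (fun j => expR ((x + v j - 1) * ln t)).
    by apply/funext => j; rewrite /powR gt_eqF.
  rewrite /powR gt_eqF//.
  have h : (fun j => (x + v j - 1) * ln t) @ \oo --> (x + 0 - 1) * ln t.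
    exact: (cvgM (cvgB (cvgD (cvg_cst _) vl) (cvg_cst _)) (cvg_cst _)).
  rewrite addr0 in h; exact: (cvg_comp _ _ h (@continuous_expR R _)).
- by have := integrableZl mD c (integrable_gamma_majorant x0).
- apply: aeW => t /=; rewrite in_itv/= andbT => j t0.
  rewrite /f/= lee_fin ger0_norm ?mulr_ge0 ?powR_ge0 ?expR_ge0//.
  by apply: Hc => //; have /andP[a b] := v01 j; apply/andP; split; lra.
move=> if0 _ cf.
have {}cf : (fun j => Gamma (x + v j)) @ \oo --> Gamma x.
  have fi := integrable_fin_num mD if0.
  rewrite -(fineK fi) in cf.
  exact: (fine_cvg cf).
by apply: cvg_trans cf; apply: near_eq_cvg; apply: filterS un => j ->.
Qed.

Lemma Gamma_gt0 x : 0 < x -> 0 < Gamma x.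
Proof.
move=> x0; have [c c0 Hc] := gamma_integrand_le x0.
have mD : measurable (`]0, +oo[%classic : set (measurableTypeR R)) by exact: measurable_itv.
have mS : measurable (`[1, 2]%classic : set (measurableTypeR R)) by exact: measurable_itv.
pose f t : R := t `^ (x - 1) * expR (- t).
have f0 t : 0 <= f t by rewrite mulr_ge0 ?powR_ge0 ?expR_ge0.
have mf (D : set (measurableTypeR R)) : measurable_fun D (EFin \o f).
  by apply/measurable_EFinP; exact: measurable_gamma_integrand.
have fi : mu.-integrable `]0, +oo[ (EFin \o f).
  have := integrableZl mD c (integrable_gamma_majorant x0).
  apply: le_integrable => // t; rewrite /= in_itv/= andbT => t0.
  rewrite lee_fin ger0_norm// [leRHS]ger0_norm ?(mulr_ge0 (ltW c0) (gamma_majorant_ge0 x t))//.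
  by apply: Hc => //; rewrite lexx lerDl ler01.
pose k : R := Num.min 1 (2 `^ (x - 1)) * expR (- 2).
have k0 : 0 < k by rewrite mulr_gt0 ?expR_gt0// lt_min ltr01 powR_gt0.
rewrite -lte_fin /Gamma /Rintegral fineK; last exact: integrable_fin_num.
apply: (@lt_le_trans _ _ (\int[mu]_(t in `[1%R, 2%R]) k%:E)%E).
  rewrite integral_cst//= lebesgue_measure_itv/= lte_fin ltr1n/= -EFinD -EFinM lte_fin.
  by rewrite mulr_gt0// subr_gt0 ltr1n.
apply: (@le_trans _ _ (\int[mu]_(t in `[1%R, 2%R]) (f t)%:E)%E).
  apply: ge0_le_integral => //; first by move=> t _; rewrite lee_fin ltW.
  move=> t; rewrite /= in_itv/= => /andP[t1 t2]; rewrite lee_fin /k /f.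
  apply: ler_pM; rewrite ?expR_ge0 ?ler_expR ?lerN2//.
  have t0 : 0 < t by lra.
  have [x1|x1] := leP 1 x.
    have : t `^ 0 <= t `^ (x - 1) by apply: ler_powR => //; lra.
    by rewrite powRr0 ge_min => ->.
  rewrite ge_min; apply/orP; right.
  rewrite -[x - 1]opprB !powRN lef_pV2 ?posrE ?powR_gt0//.
  by apply: ge0_ler_powR; rewrite ?nnegrE ?(ltW t0)//; lra.
apply: ge0_subset_integral => //.
  by move=> t _; rewrite lee_fin.
by move=> t; rewrite /= !in_itv/= andbT => /andP[t1 _]; lra.
Qed.

End GammaFunction.

(** * The kernel as a limit *)

Section LimitFormula.
Variable R : realType.
Local Notation C := (cplx R).
Implicit Types (z w xi : C) (b e : R).

Lemma pochhammer_gt0 b k : 0 < b -> 0 < pochhammer b k.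
Proof. by move=> b0; apply: prodr_gt0 => i _; rewrite ltr_wpDr. Qed.

(** Factor by factor, [(b + e + i) / (b + i) <= 1 + e / b]. *)
Lemma pochhammer_ratio_bound b e k : 0 < b -> 0 <= e ->
  0 <= pochhammer (b + e) k / pochhammer b k <= (1 + e / b) ^+ k.
Proof.
move=> b0 e0; have be : 0 < b + e by rewrite ltr_wpDr.
apply/andP; split.
  by rewrite divr_ge0//; apply: ltW; exact: pochhammer_gt0.
rewrite /pochhammer -prodfV -big_split/= -[k in leRHS]card_ord -prodr_const; apply: ler_prod => i _.
have bi : 0 < b + i%:R by rewrite ltr_wpDr.
rewrite divr_ge0 ?(ltW bi) ?addr_ge0 ?(ltW b0)//= ler_pdivrMr// mulrDl mul1r.
rewrite addrAC lerD2l mulrAC ler_pdivlMr// ler_wpM2l// lerDl.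
by [].
Qed.

Lemma cvg_pochhammer_ratio b k : 0 < b ->
  pochhammer (b + e) k / pochhammer b k @[e --> (0 : R)^'+] --> (1 : R).
Proof.
move=> b0; have p0 : pochhammer b k != 0 by rewrite gt_eqF// pochhammer_gt0.
have H : pochhammer (b + e) k @[e --> (0 : R)^'+] --> pochhammer b k.
  rewrite /pochhammer; elim: {p0}k => [|k IH].
    by under eq_fun do rewrite big_ord0; rewrite big_ord0; exact: cvg_cst.
  under eq_fun do rewrite big_ord_recr/=; rewrite big_ord_recr/=.
  have h : e @[e --> (0 : R)^'+] --> (0 : R) by exact: cvg_at_right_filter cvg_id.
  have h' : b + e + k%:R @[e --> (0 : R)^'+] --> b + 0 + k%:R.
    exact: (cvgD (cvgD (cvg_cst _) h) (cvg_cst _)).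
  by rewrite addr0 in h'; exact: (cvgM IH h').
by rewrite -(divff p0); exact: (cvgM H (cvg_cst _)).
Qed.

Lemma hypergeometricK m b e xi : 0 < b -> 0 <= e -> (1 + e / b) * normc xi < 1 ->
  xi ^+ m / m`!%:R ^+ 2 *
    hypergeometric [:: 1; 1; 1; b + e] [:: m.+1%:R; m.+1%:R; b] xi =
  xi ^+ m * pser (fun k => (fact_ratio R m k * (pochhammer (b + e) k / pochhammer b k))%:C) xi.
Proof.
move=> b0 e0 q1; have q0 : 0 <= (1 + e / b) * normc xi.
  by rewrite mulr_ge0 ?normc_ge0// addr_ge0// divr_ge0// ltW.
apply: hypergeometric_scale => [k|].
  rewrite !big_cons !big_nil !pochhammer1 !pochhammerS !mulr1.
  by apply: hypergeometric_termE; rewrite gt_eqF// pochhammer_gt0.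
apply: (cvg_series_normc (b := fun k => ((1 + e / b) * normc xi) ^+ k)); last first.
  have z2 : `|(1 + e / b) * normc xi| < 1 by rewrite ger0_norm.
  have -> : (fun k => ((1 + e / b) * normc xi) ^+ k) = geometric 1 ((1 + e / b) * normc xi).
    by apply/funext => k; rewrite /geometric/= mul1r.
  by apply/cvg_ex; eexists; exact: (cvg_geometric_series (a := 1) z2).
move=> k; have /andP[r0 r1] := pochhammer_ratio_bound k b0 e0.
have /andP[f0 f1] := fact_ratio_le R m k.
rewrite normc_M normcX normc_real ger0_norm ?(mulr_ge0 f0 r0)// exprMn.
rewrite ler_wpM2r ?exprn_ge0 ?normc_ge0//; apply: le_trans r1.
by rewrite ler_piMl.
Qed.

(** As [e] decreases to [0] every ratio of Pochhammer symbols decreases to [1],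
and geometrically growing bounds on them pass the limit through the series. *)
Lemma cvg_hypergeometricK m b xi : 0 < b -> 0 < normc xi < 1 ->
  xi ^+ m / m`!%:R ^+ 2 *
    hypergeometric [:: 1; 1; 1; b + e] [:: m.+1%:R; m.+1%:R; b] xi
  @[e --> (0 : R)^'+] -->
  xi ^+ m / m`!%:R ^+ 2 * hypergeometric [:: 1; 1; 1] [:: m.+1%:R; m.+1%:R] xi.
Proof.
move=> b0 /andP[x0 x1]; rewrite hypergeometric1//.
(* Any ratio strictly between [|xi|] and [1] would do. *)
pose q := (1 + normc xi) / 2.
have q01 : 0 <= q < 1 by rewrite /q; apply/andP; split; lra.
pose u (k : nat) e : C := (fact_ratio R m k * (pochhammer (b + e) k / pochhammer b k))%:C * xi ^+ k.
have near_e : \forall e \near (0 : R)^'+, 0 <= e /\ (1 + e / b) * normc xi <= q.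
  have d0 : 0 < b * ((1 - normc xi) / 2) by rewrite mulr_gt0// divr_gt0// subr_gt0.
  near=> e; have e0 : 0 < e by near: e; exact: nbhs_right_gt.
  split; first exact: ltW.
  have : e <= b * ((1 - normc xi) / 2) by near: e; exact: nbhs_right_le.
  rewrite mulrC -ler_pdivrMr// mulrC => eb; have eb0 : 0 <= e / b by rewrite divr_ge0// ltW.
  by move: eb eb0; rewrite [b^-1 * e]mulrC /q; move: (e / b) => y; nra.
have H : (fun e => limn (series (u^~ e))) @ (0 : R)^'+ -->
    limn (series (fun k => (fact_ratio R m k * 1)%:C * xi ^+ k : C)).
  apply: (lim_series_cvg (b := fun k => q ^+ k)).
  - move=> k; apply: (cvgCM _ (cvgC_cst _)); apply: cvgC_real.
    exact: (cvgM (cvg_cst _) (cvg_pochhammer_ratio k b0)).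
  - apply: filterS near_e => e [e0 eq] k.
    have /andP[r0 r1] := pochhammer_ratio_bound k b0 e0.
    have /andP[f0 f1] := fact_ratio_le R m k.
    rewrite /u normc_M normcX normc_real ger0_norm ?(mulr_ge0 f0 r0)//.
    apply: (@le_trans _ _ (((1 + e / b) * normc xi) ^+ k)).
      rewrite exprMn ler_wpM2r ?exprn_ge0 ?normc_ge0//; apply: le_trans r1.
      by rewrite ler_piMl.
    rewrite lerXn2r ?nnegrE//; last by case/andP: q01.
    by rewrite mulr_ge0 ?normc_ge0// addr_ge0// divr_ge0// ltW.
  - have z2 : `|q| < 1 by case/andP: q01 => a c; rewrite ger0_norm.
    have -> : (fun k => q ^+ k) = geometric 1 q by apply/funext => k; rewrite /geometric/= mul1r.
    by apply/cvg_ex; eexists; exact: (cvg_geometric_series (a := 1) z2).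
apply: cvg_trans (cvgCM (cvgC_cst (xi ^+ m)) H); apply: near_eq_cvg.
apply: filterS near_e => e [e0 eq]; rewrite hypergeometricK//.
by apply: le_lt_trans eq _; case/andP: q01.
Unshelve. all: by end_near. Qed.

Lemma cvg_Gamma_ratio x : 0 < x ->
  Gamma (x + e) / Gamma x @[e --> (0 : R)^'+] --> (1 : R).
Proof.
move=> x0; have G0 : Gamma x != 0 by rewrite gt_eqF// Gamma_gt0.
by rewrite -(divff G0); exact: (cvgM (cvg_Gamma x0) (cvg_cst _)).
Qed.

(** With [alpha = e - 1] the three parts of the kernel depend on [e] through ratios
that tend to [1]; the arguments of the Gamma function are positive because
[m + k < p] and [- 1 < beta0]. *)
Lemma cvg_kernelK (beta0 : R) (m p : nat) xi : -1 < beta0 -> 0 < normc xi < 1 ->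
  kernelK alpha (beta0 + p%:R) m p xi @[alpha --> (-1 : R)^'+] --> kernelH m p xi.
Proof.
move=> hb xd; set beta := beta0 + p%:R.
have b0 : 0 < beta + 1 by rewrite /beta; have := ler0n R p; lra.
have x1 : normc xi < 1 by case/andP: xd.
suff H : kernelK (e - 1) beta m p xi @[e --> (0 : R)^'+] --> kernelH m p xi.
  have sh : alpha + 1 @[alpha --> (-1 : R)^'+] --> (0 : R)^'+.
    move=> A [r /= r0 HA]; exists r => //= y yr y1; apply: HA.
      by move: yr; rewrite /=; have -> : 0 - (y + 1) = -1 - y by ring.
    by rewrite -(subrr (1 : R)) [1 - 1]addrC ltrD2r.
  apply: cvg_trans (cvg_comp _ _ sh H); apply: near_eq_cvg; apply: nearW => y /=.
  by rewrite addrK.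
have E1 e : e - 1 + beta + 2 = beta + 1 + e by ring.
have -> : (fun e => kernelK (e - 1) beta m p xi) = (fun e =>
    \sum_(n < m) (pochhammer (beta + 1 + e) n / pochhammer (beta + 1) n)%:C * xi ^+ n
  + xi ^+ m / m`!%:R ^+ 2 *
    hypergeometric [:: 1; 1; 1; beta + 1 + e] [:: m.+1%:R; m.+1%:R; beta + 1] xi
  + \sum_(k < p - m)
    (Gamma (beta - m%:R - k%:R + e) / Gamma (beta - m%:R - k%:R) *
     (Gamma (beta + 1) / Gamma (beta + 1 + e)) *
     (k`!%:R / (m + k)`!%:R) ^+ 2)%:C * (xi ^+ k.+1)^-1).
  apply/funext => e; rewrite /kernelK /kernelA E1; apply: (congr1 (+%R _)); apply: eq_bigr => k _.
  by have -> : e - 1 + beta + 1 - m%:R - k%:R = beta - m%:R - k%:R + e by ring.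
have s1 : \sum_(n < m) (pochhammer (beta + 1 + e) n / pochhammer (beta + 1) n)%:C * xi ^+ n
    @[e --> (0 : R)^'+] --> (\sum_(n < m) 1%:C * xi ^+ n : C).
  apply: cvgC_sum => k; apply: (cvgCM _ (cvgC_cst _)); apply: cvgC_real.
  exact: cvg_pochhammer_ratio.
have s3 : \sum_(k < p - m)
    (Gamma (beta - m%:R - k%:R + e) / Gamma (beta - m%:R - k%:R) *
     (Gamma (beta + 1) / Gamma (beta + 1 + e)) *
     (k`!%:R / (m + k)`!%:R) ^+ 2)%:C * (xi ^+ k.+1)^-1 @[e --> (0 : R)^'+] --> kernelC m p xi.
  apply: cvgC_sum => k; apply: (cvgCM _ (cvgC_cst _)); apply: cvgC_real.
  have y0 : 0 < beta - m%:R - k%:R.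
    have : (m + k.+1 <= p)%N by have := ltn_ord k; lia.
    by rewrite -(ler_nat R) natrD -natr1 /beta; lra.
  have g1 := cvg_Gamma_ratio y0.
  have g2 : (Gamma (beta + 1 + e) / Gamma (beta + 1))^-1 @[e --> (0 : R)^'+] --> (1 : R)^-1.
    exact: (cvgV (oner_neq0 R) (cvg_Gamma_ratio b0)).
  have : Gamma (beta - m%:R - k%:R + e) / Gamma (beta - m%:R - k%:R) *
     (Gamma (beta + 1 + e) / Gamma (beta + 1))^-1 * (k`!%:R / (m + k)`!%:R) ^+ 2
     @[e --> (0 : R)^'+] --> (1 * 1^-1 * (k`!%:R / (m + k)`!%:R) ^+ 2 : R).
    exact: (cvgM (cvgM g1 g2) (cvg_cst _)).
  rewrite invr1 !mul1r; apply: cvg_trans; apply: near_eq_cvg; apply: nearW => e.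
  by rewrite /= invf_div.
have E : \sum_(n < m) 1%:C * xi ^+ n = (1 - xi ^+ m) / (1 - xi) :> C.
  apply: (mulIf (subr_neq0_lt1 x1)); rewrite divfK ?subr_neq0_lt1// -[1 in RHS](expr1n _ m) subrXX.
  rewrite mulrC; congr (_ * _); apply: eq_bigr => k _.
  by rewrite expr1n !mul1r.
by rewrite /kernelH -E; exact: (cvgCD (cvgCD s1 (cvg_hypergeometricK (m := m) b0 xd)) s3).
Qed.

End LimitFormula.

(** * The reproducing property *)

Section Reproducing.
Variable R : realType.
Local Notation C := (cplx R).
Variables (m p : nat).
Implicit Types (z w : C) (f : C -> C) (n : int).

Lemma geometric_abssum (b : nat -> C) (M q : R) : 0 <= q < 1 ->
  (forall k, normc (b k) <= M * q ^+ k) -> abssum b.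
Proof.
move=> /andP[q0 q1] bM; apply: (series_le_cvg _ _ bM).
- by move=> k; exact: normc_ge0.
- by move=> k; exact: le_trans (normc_ge0 _) (bM k).
- by apply: is_cvg_geometric_series; rewrite ger0_norm.
Qed.

Lemma kcoef_below n : n < - (p - m)%N%:Z -> kcoef R m p n = 0.
Proof. by case: n => k /=; [lia|move=> pk; case: ifP => //; lia]. Qed.

Definition kernel_at w : C -> C := fun z => kernelH m p (z * conjc w).

Section AtPoint.
Variable w : C.
Hypothesis wd : 0 < normc w < 1.

Let w0 : conjc w != 0. Proof. by rewrite -normc_gt0 normc_conj; case/andP: wd. Qed.
Let W0 : normc w != 0. Proof. by rewrite gt_eqF//; case/andP: wd. Qed.
Let W01 : 0 <= normc w < 1. Proof. by case/andP: wd => /ltW -> ->. Qed.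

Let normc_wz n : normc (conjc w ^ n) = normc w ^ n.
Proof. by rewrite normc_exprz normc_conj. Qed.

Let kap n : C := (kcoef R m p n)%:C * conjc w ^ n.

Let kap_pconv : pconv (fun k : nat => kap (k%:Z - (p - m)%N%:Z)).
Proof.
apply: summable_pconv; apply: (geometric_abssum (M := normc w ^ (- (p - m)%N%:Z)) W01) => k.
have /andP[k0 k1] := kcoef_bound R m p (k%:Z - (p - m)%N%:Z).
rewrite /kap normc_M normc_real ger0_norm// normc_wz.
have -> : normc w ^ (- (p - m)%N%:Z) * normc w ^+ k = normc w ^ (k%:Z - (p - m)%N%:Z).
  by rewrite [_ - _]addrC (expfzDr _ _ W0).
by rewrite ler_piMl// exprz_ge0// normc_ge0.
Qed.

Let kernel_pser z : 0 < normc z < 1 ->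
  kernel_at w z = pser (fun k : nat => kap (k%:Z - (p - m)%N%:Z)) z * z ^ (- (p - m)%N%:Z).
Proof.
move=> zd; have z0 := neq0_disk zd; set N := (p - m)%N.
have xd : 0 < normc (z * conjc w) < 1.
  case/andP: zd => z0' z1; case/andP: wd => w0' w1.
  rewrite normc_M normc_conj mulr_gt0//= -(mulr1 1) ltr_pM// ?normc_ge0//.
have x1 : normc (z * conjc w) < 1 by case/andP: xd.
rewrite /kernel_at (kernelH_pser m p xd) -/N.
pose b (k : nat) : C := (kcoef R m p (k%:Z - N%:Z))%:C.
have cb : pconv b.
  apply: bounded_pconv => k; have /andP[k0 k1] := kcoef_bound R m p (k%:Z - N%:Z).
  by rewrite normc_real ger0_norm.
have H : (fun M => series (fun k => b k * (z * conjc w) ^+ k) M * conjc w ^ (- N%:Z)) @ \oo -->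
    pser b (z * conjc w) * conjc w ^ (- N%:Z).
  exact: (cvgCM (cvg_pser cb x1) (cvgC_cst _)).
have E : pser (fun k : nat => kap (k%:Z - N%:Z)) z = pser b (z * conjc w) * conjc w ^ (- N%:Z).
  apply: (cvg_lim (@cplx_hausdorff R)); apply: cvg_trans H; apply: near_eq_cvg.
  apply: nearW => M; rewrite /series/= mulr_suml; apply: eq_bigr => k _.
  rewrite /b /kap exprMn (expfzDr _ _ w0) -!mulrA; congr (_ * _).
  by rewrite mulrC -!mulrA; congr (_ * _); rewrite mulrC.
by rewrite E -/b [z * _]mulrC expfzMl -mulrA.
Qed.

Lemma kernel_hol : hol (kernel_at w).
Proof. by have [] := laurent_pser kap_pconv kernel_pser. Qed.

Lemma kernel_laurent n : laurent (kernel_at w) n = (kcoef R m p n)%:C * conjc w ^ n.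
Proof.
have [_ l1 l2] := laurent_pser kap_pconv kernel_pser.
case: (ltP n (- (p - m)%N%:Z)) => nN; first by rewrite l2// kcoef_below// mul0r.
have -> : n = (`|(n + (p - m)%N%:Z)%R|%N)%:Z - (p - m)%N%:Z by lia.
by rewrite l1.
Qed.

Let dk n := laurent (derive1n m (kernel_at w)) n.

Let dkE n : dk n = ffall R m (n + m%:Z) * ((kcoef R m p (n + m%:Z))%:C * conjc w ^ (n + m%:Z)).
Proof.
by rewrite -kernel_laurent -(laurent_derive1n _ _ kernel_hol) addrK.
Qed.

Let dk_bound n : normc (dk n) <= normc w ^ (n + m%:Z).
Proof.
have /andP[k0 k1] := kcoef_bound R m p (n + m%:Z).
rewrite dkE mulrA normc_M normc_wz normc_M normc_real ger0_norm//.
rewrite ler_piMl ?exprz_ge0 ?normc_ge0//; exact: ffall_kcoef_le.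
Qed.

Let dk_vanish n : n < - p%:Z \/ (0 <= n + m%:Z < m%:Z) -> dk n = 0.
Proof.
move=> H; rewrite dkE; case: (boolP (0 <= n + m%:Z < m%:Z)) => [|nm].
  by rewrite -(ffall_eq0 R) => /eqP ->; rewrite mul0r.
by rewrite kcoef_below ?mul0r ?mulr0//; case: H => [|/negP//]; lia.
Qed.

Lemma kernel_derive_abssum : abssum (fun k : nat => dk (k%:Z - p%:Z)).
Proof.
apply: (geometric_abssum (M := normc w ^ (- p%:Z + m%:Z)) W01) => k.
apply: le_trans (dk_bound _) _; rewrite -addrA addrC (expfzDr _ _ W0).
exact: lexx.
Qed.

(** If [m < p] the derivative of order [m] has a pole of order exactly [p], since the
lowest coefficient of the kernel is nonzero. If [p <= m] there are no negative
powers, and the singularity is removable. *)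
Lemma kernel_hardy_dirichlet : hardy_dirichlet m p (kernel_at w).
Proof.
split; first by apply/holomorphic_punctured; exact: kernel_hol.
have hd := hol_derive1n (m := m) kernel_hol.
have dv n : n < - p%:Z -> dk n = 0 by move=> np; apply: dk_vanish; left.
have hE z := pser_laurent (N := p) (z := z) hd dv.
have [pm|mp] := leqP p m; last first.
  apply: (hardy_pser (N := p) kernel_derive_abssum (leqnn p) _ hE).
  right; rewrite -/(dk _) dkE sub0r.
  have e1 : - p%:Z + m%:Z = Negz (p - m).-1 by lia.
  have e2 : ((p - m).-1 < p - m)%N by lia.
  rewrite e1 /= e2 -e1 !mulf_neq0 ?expfz_neq0//.
    by rewrite ffall_eq0; lia.
  rewrite -normc_eq0 normc_real normr_eq0 expf_neq0// mulf_neq0// ?invr_eq0 pnatr_eq0 -lt0n fact_gt0//.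
pose d (k : nat) := dk (k%:Z - p%:Z).
have sd' : abssum (fun k => d (k + p)%N).
  apply: (geometric_abssum (M := normc w ^ m%:Z) W01) => k.
  apply: le_trans (dk_bound _) _; rewrite PoszD addrK addrC (expfzDr _ _ W0).
  exact: lexx.
apply: (hardy_pser (N := 0) sd' (leq0n p) (or_introl erefl)).
move=> z zd; have z0 := neq0_disk zd; have z1 : normc z < 1 by case/andP: zd.
have P : pser d z = z ^+ p * pser (fun k => d (k + p)%N) z.
  rewrite (pser_split p (summable_pconv kernel_derive_abssum) z0 z1) big1 ?add0r//.
  by move=> k _; have kp := ltn_ord k; rewrite dk_vanish ?mul0r//; right; lia.
apply: (etrans (hE z zd)); rewrite -[LHS]/(pser d z * z ^ (- p%:Z)) P expr0z mulr1.
by rewrite -exprnN mulrC mulKf// expf_neq0.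
Qed.

Let termE f (k : nat) : hardy_dirichlet m p f ->
  laurent (derive1n m f) (k%:Z - p%:Z) * conjc (dk (k%:Z - p%:Z)) =
  laurent (high_part m p f) (k%:Z - p%:Z + m%:Z) * w ^ (k%:Z - p%:Z + m%:Z).
Proof.
move=> fHD; have hf : hol f by case: fHD => /holomorphic_punctured.
rewrite (high_laurentE fHD) dkE.
set n := k%:Z - p%:Z + m%:Z.
have -> : laurent (derive1n m f) (k%:Z - p%:Z) = ffall R m n * laurent f n.
  by rewrite -(laurent_derive1n _ _ hf) /n addrK.
case: ifP => [|/negbT nm].
  by rewrite -(ffall_eq0 R) => /eqP ->; rewrite !mul0r.
have [nN|nN] := ltP n (- (p - m)%N%:Z).
  by rewrite (hardy_dirichlet_vanish fHD nN) mulr0 !mul0r.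
rewrite !conjc_M conjc_R conjc_exprz conjc_K.
move: (ffall_sq_kcoef R nm nN); move: (laurent f n) (w ^ n) (ffall R m n) => L W F.
by move: (conjc F) (_%:C) => F' K E; rewrite mulrACA [L * (K * W)]mulrCA mulrA E mul1r.
Qed.

(** Both inner products are pairings of coefficients. For the low parts the kernel
contributes [conj w ^ n]; for the high parts the weights cancel against those of
the kernel; in both cases the sum is the Laurent series of [f] at [w]. *)
Lemma kernel_reproduces f : hardy_dirichlet m p f ->
  f w = hardy_dirichlet_inner m p f (kernel_at w).
Proof.
move=> fHD; have KHD := kernel_hardy_dirichlet.
have hf : hol f by case: fHD => /holomorphic_punctured.
have -> : f w = low_part m p f w + high_part m p f w by rewrite /high_part addrC subrK.
congr (_ + _).
  pose c := low_coefs m (fun k : nat => laurent f k%:Z).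
  pose d := low_coefs m (fun k : nat => laurent (kernel_at w) k%:Z).
  have fE z : 0 < normc z < 1 -> low_part m p f z = pser c z * z ^ (- 0%:Z).
    by move=> _; rewrite (low_partE _ fHD) pser_cut expr0z mulr1.
  have gE z : 0 < normc z < 1 -> low_part m p (kernel_at w) z = pser d z * z ^ (- 0%:Z).
    by move=> _; rewrite (low_partE _ KHD) pser_cut expr0z mulr1.
  have H := hardy_inner_pser (@sqsum_cut R m _) (@abssum_cut R m _) fE gE.
  have H' := @series_cut R m c (fun k => conjc (d k)).
  have c0 k : (m <= k)%N -> c k = 0 by rewrite /c /low_coefs ltnNge => ->.
  rewrite (cvgC_unique H (H' c0)) (low_partE _ fHD); apply: eq_bigr => k _.
  have km := ltn_ord k.
  by rewrite /c /d /low_coefs km kernel_laurent /= km conjc_M conjc_R -[1%:C]/(1 : C) mul1r conjc_exprz conjc_K.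
have [_ /hardy_laurent[_ fv sf]] := fHD.
have H : series (fun k : nat => laurent (derive1n m f) (k%:Z - p%:Z) *
    conjc (dk (k%:Z - p%:Z))) @ \oo --> hardy_inner (derive1n m (high_part m p f))
      (derive1n m (high_part m p (kernel_at w))).
  exact: (hardy_inner_pser sf kernel_derive_abssum (high_derive_pser fHD) (high_derive_pser KHD)).
have E : (fun k : nat => laurent (derive1n m f) (k%:Z - p%:Z) * conjc (dk (k%:Z - p%:Z))) =
    (fun k : nat => laurent (high_part m p f) (k%:Z - p%:Z + m%:Z) * w ^ (k%:Z - p%:Z + m%:Z)).
  apply/funext => k; exact: termE.
by rewrite E in H; exact: (cvgC_unique (high_part_series fHD wd) H).
Qed.

End AtPoint.

End Reproducing.

(** * The theorem *)

Lemma hardy_dirichlet_inner_conj (R : realType) m p (f g : cplx R -> cplx R) :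
  hardy_dirichlet_inner m p g f = conjc (hardy_dirichlet_inner m p f g).
Proof.
have conjcD (x y : cplx R) : conjc (x + y) = conjc x + conjc y by exact: rmorphD.
have h1 := hardy_inner_conj (low_part m p f) (low_part m p g).
have h2 := hardy_inner_conj (derive1n m (fun z : cplx R => f z - low_part m p f z))
  (derive1n m (fun z : cplx R => g z - low_part m p g z)).
exact: (etrans (congr2 +%R h1 h2) (esym (conjcD _ _))).
Qed.

Theorem theorem2 (R : realType) (m p : nat) (beta0 : R)
    (hbeta0 : -1 < beta0 <= 0) :
  let beta := beta0 + p%:R in
  let KH := fun z w : cplx R => kernelH m p (z * conjc w) in
  [/\ forall xi : cplx R, 0 < `|xi| < 1 ->
        kernelK alpha beta m p xi @[alpha --> (-1 : R)^'+] --> kernelH m p xi,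
      reproducing_kernel punctured_disk (hardy_dirichlet m p)
        (hardy_dirichlet_inner m p) KH
    & forall K : cplx R -> cplx R -> cplx R,
        reproducing_kernel punctured_disk (hardy_dirichlet m p)
          (hardy_dirichlet_inner m p) K ->
        forall z w, punctured_disk z -> punctured_disk w -> K z w = KH z w].
Proof.
case/andP: hbeta0 => hb _ beta KH.
have KHD w : punctured_disk w -> hardy_dirichlet m p (KH^~ w).
  by rewrite punctured_diskE => wd; exact: (kernel_hardy_dirichlet m p wd).
have rep f w : hardy_dirichlet m p f -> punctured_disk w ->
    f w = hardy_dirichlet_inner m p f (KH^~ w).
  by rewrite punctured_diskE => fHD wd; exact: (kernel_reproduces wd fHD).
split => [xi|//|K [K1 K2] z w zd wd].
  by rewrite ltc0r => xd; exact: cvg_kernelK.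
(* Evaluate the section of the kernel [L] at [w] with the known kernel, use that the
   inner product is hermitian, and evaluate the other section with [L]. *)
have sym (L : cplx R -> cplx R -> cplx R) :
    (forall w, punctured_disk w -> hardy_dirichlet m p (L^~ w)) ->
    (forall f w, hardy_dirichlet m p f -> punctured_disk w ->
      f w = hardy_dirichlet_inner m p f (L^~ w)) ->
    L z w = conjc (KH w z).
  move=> L1 L2; rewrite (rep (L^~ w) z (L1 _ wd) zd) hardy_dirichlet_inner_conj.
  by rewrite -(L2 (KH^~ z) w (KHD _ zd) wd).
by rewrite (sym K K1 K2) (sym KH KHD rep).
Qed.
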